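(* Let $T\in V_\ell$ with $\ell\in\{1,2,3\}$. Then $$F^{(\ell)}(z;T)=-\sum_{k=0}^3\varepsilon_k^{(\ell)}\zeta(z-\tfrac{\omega_k}{2})+(2T+\eta_{3-\ell})$$ is an elliptic solution of $F'''-4q_\ell F'-2q_\ell'F=0$, where $q_\ell=q_\ell(z;T)$. Moreover, (1) if $T\neq0$, then $\mathrm{d}_T=1$ and $\mathrm{ES}(T)$ is spanned by $F^{(\ell)}(z;T)$; (2) if $T=0$, then $\mathrm{d}_T=3$ and $\mathrm{ES}(T)$ is spanned by $F^{(1)}(z;0),F^{(2)}(z;0),F^{(3)}(z;0)$.
   Context: Let $\tau\in\mathbb{C}$ with $\mathrm{Im}\,\tau>0$, $\Lambda_\tau=\mathbb{Z}+\mathbb{Z}\tau$, $E_\tau=\mathbb{C}/\Lambda_\tau$; $\wp,\zeta$ are the Weierstrass functions of $\Lambda_\tau$ ($\zeta'=-\wp$, $\zeta$ odd). Put $\omega_0=0,\omega_1=1,\omega_2=\tau,\omega_3=1+\tau$, $\eta_0=0$, $\eta_i=\zeta(z+\omega_i)-\zeta(z)$ for $i=1,2,3$. For $\ell\in\{1,2,3\}$ let $\varepsilon^{(\ell)}_0=\varepsilon^{(\ell)}_\ell=1$ and $\varepsilon^{(\ell)}_j=-1$ for $j\in\{1,2,3\}\setminus\{\ell\}$. $V_\ell=\{(\varepsilon_0^{(\ell)}T,\varepsilon_1^{(\ell)}T,\varepsilon_2^{(\ell)}T,\varepsilon_3^{(\ell)}T,\,T^2-\eta_{3-\ell}T)\mid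 T\in\mathbb{C}\}$ is identified with $\mathbb{C}$ via $T$, and for $T\in V_\ell$ $$q_\ell(z;T)=\tfrac34\sum_{k=0}^3\wp(z-\tfrac{\omega_k}{2})+T\sum_{k=0}^3\varepsilon_k^{(\ell)}\zeta(z-\tfrac{\omega_k}{2})+T^2-\eta_{3-\ell}T.$$ Elliptic means meromorphic on $\mathbb{C}$ and $\Lambda_\tau$-periodic. $\mathrm{ES}(T)$ is the space of elliptic solutions of $F'''-4q_\ell F'-2q_\ell'F=0$ ($'=d/dz$) and $\mathrm{d}_T=\dim_{\mathbb{C}}\mathrm{ES}(T)$. When $T=0$ the potential $q_\ell(z;0)$ is the same for all $\ell$. *)

(* Defs.v *)
From Stdlib Require Export Reals ZArith List.
From Coquelicot Require Export Coquelicot.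
Export ListNotations.
Open Scope C_scope.

(** ** Meromorphic functions on the plane

    A meromorphic function is represented by a total function [C -> C] whose
    values on a discrete closed set (in particular at its poles) are
    meaningless.  Equality of meromorphic functions is therefore [mer_eq]:
    equality on a punctured neighbourhood of every point. *)

Definition mer_eq (f g : C -> C) : Prop :=
  forall a : C, locally' a (fun z => f z = g z).

(** Near [a], [f] has a Laurent expansion with finite principal part:
    [f z = (z - a) ^ (- n) * (c 0 + c 1 * (z - a) + ...)]. *)
Definition meromorphic_at (f : C -> C) (a : C) : Prop :=
  exists (n : nat) (c : nat -> C),
    locally' a (fun z =>
      is_pseries (K := C_AbsRing) (V := C_NormedModule) c (z - a)
                 ((z - a) ^ n * f z)).

Definition meromorphic (f : C -> C) : Prop :=
  forall a : C, meromorphic_at f a.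

Definition lattice_point (tau : C) (m n : Z) : C :=
  RtoC (IZR m) + RtoC (IZR n) * tau.

Definition in_lattice (tau w : C) : Prop :=
  exists m n : Z, w = lattice_point tau m n.

Definition elliptic (tau : C) (f : C -> C) : Prop :=
  meromorphic f /\
  forall w : C, in_lattice tau w -> mer_eq (fun z => f (z + w)) f.

(** ** Linear algebra of meromorphic functions modulo [mer_eq] *)

Fixpoint lincomb (c : list C) (b : list (C -> C)) (z : C) : C :=
  match c, b with
  | x :: c', f :: b' => x * f z + lincomb c' b' z
  | _, _ => 0
  end.

Definition lin_indep (b : list (C -> C)) : Prop :=
  forall c : list C, length c = length b ->
    mer_eq (lincomb c b) (fun _ => 0) -> List.Forall (fun x : C => x = 0) c.

Definition spanned_by (S : (C -> C) -> Prop) (b : list (C -> C)) : Prop :=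
  forall F : C -> C,
    S F <-> exists c : list C, length c = length b /\ mer_eq F (lincomb c b).

Definition has_dim (S : (C -> C) -> Prop) (n : nat) : Prop :=
  exists b : list (C -> C), length b = n /\ lin_indep b /\ spanned_by S b.

(** ** Weierstrass functions of [Z + Z tau] *)

Definition C_lim_seq (u : nat -> C) : C :=
  (real (Lim_seq (fun n => Re (u n))), real (Lim_seq (fun n => Im (u n)))).

(** Sum of [f] over the nonzero lattice points, as the limit of the sums over
    [|m|, |n| <= N].  It is only applied to absolutely convergent families,
    so the choice of exhaustion is immaterial. *)
Definition lattice_sum (tau : C) (f : C -> C) : C :=
  C_lim_seq (fun N =>
    sum_n (fun j => sum_n (fun k =>
      let m := (Z.of_nat j - Z.of_nat N)%Z in
      let n := (Z.of_nat k - Z.of_nat N)%Z in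
      if (Z.eqb m 0 && Z.eqb n 0)%bool then RtoC 0
      else f (lattice_point tau m n)) (2 * N)) (2 * N)).

Definition wp (tau z : C) : C :=
  1 / z ^ 2 + lattice_sum tau (fun w => 1 / (z - w) ^ 2 - 1 / w ^ 2).

Definition zeta (tau z : C) : C :=
  1 / z + lattice_sum tau (fun w => 1 / (z - w) + 1 / w + z / w ^ 2).

Definition omega (tau : C) (k : nat) : C :=
  match k with
  | 0%nat => 0
  | 1%nat => 1
  | 2%nat => tau
  | _ => 1 + tau
  end.

(** For [k = 1, 2, 3], the constant value of [zeta (z + omega_k) - zeta z]. *)
Definition eta (tau : C) (k : nat) : C :=
  match k with
  | 0%nat => 0
  | _ => iota (T := C_CompleteNormedModule) (fun c : C =>
           forall z : C, ~ in_lattice tau z ->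
             zeta tau (z + omega tau k) - zeta tau z = c)
  end.

(** ** The potentials and the differential equation *)

Definition eps (l k : nat) : C :=
  if (Nat.eqb k 0 || Nat.eqb k l)%bool then 1 else - (1).

Definition sum4 (f : nat -> C) : C := f 0%nat + f 1%nat + f 2%nat + f 3%nat.

Definition q (tau : C) (l : nat) (T z : C) : C :=
  3 / 4 * sum4 (fun k => wp tau (z - omega tau k / 2))
  + T * sum4 (fun k => eps l k * zeta tau (z - omega tau k / 2))
  + T ^ 2 - eta tau (3 - l) * T.

Definition Fl (tau : C) (l : nat) (T z : C) : C :=
  - sum4 (fun k => eps l k * zeta tau (z - omega tau k / 2))
  + (2 * T + eta tau (3 - l)).

(** [C_derive] takes the true derivative off a discrete closed set when [F]
    and [Q] are meromorphic. *)
Definition is_solution (Q F : C -> C) : Prop :=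
  mer_eq (fun z => C_derive (C_derive (C_derive F)) z
                   - 4 * Q z * C_derive F z - 2 * C_derive Q z * F z)
         (fun _ => 0).

Definition ES (tau : C) (l : nat) (T : C) (F : C -> C) : Prop :=
  elliptic tau F /\ is_solution (q tau l T) F.

(* Main.v *)
Require Import Defs.
From Stdlib Require Import Lra Lia Classical ClassicalEpsilon FunctionalExtensionality.

(** Put G_l(z) = sum_k eps_k zeta(z - omega_k/2) - eta_(3-l) and
    P(z) = sum_k wp(z - omega_k/2), so that F^(l)(z;T) = 2T - G_l(z) and
    q_l = (3/4) P + T G_l + T^2.

    The signs eps_k add up to 0 and satisfy sum_k eps_k eta_k = -2 eta_(3-l);
    the first makes G_l elliptic and the second makes it odd.  An odd elliptic
    function is odd about every half period, so G_l = eps_k/x + O(x) at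
    omega_k/2 ([G_half]).  Moreover P = 1/x^2 + O(x) there ([wp_sum_half]): the
    sum of the four translates of zeta and 2 zeta(2z) have the same poles and
    the same quasi-periods, hence differ by a constant ([duplication]), and the
    expansion of zeta at 0 has no constant and no linear term.  Comparing
    principal parts, Liouville's theorem yields P = G_l^2 + C and then that
    G_l'' - 2 G_l^3 - 3 C G_l is constant ([G_second_order]).  Its derivative
    turns the equation for 2T - G_l into a polynomial identity in T, G_l and
    G_l' ([Fl_solution]).

    Conversely let F be an elliptic solution.  The indicial polynomial of the
    equation ([ode_indicial]) is r(r-1)(r-2) where q_l is regular and
    (r+1)(r-1)(r-3) at the half periods.  Hence F has at most simple poles, at
    half periods only, and the next coefficient of the equation shows that its
    constant term at omega_k/2 is -2 T eps_k r_k, where r_k is the residue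
    ([solution_half]).  Subtract from F the combination of G_1, G_2, G_3 with
    the residues r_1, r_2, r_3 at the nonzero half periods.  What remains is
    elliptic with at most one simple pole per period cell, therefore without a
    pole ([no_single_pole]), therefore a constant b, and
    b = -2 T eps_k r_k for k = 1, 2, 3, because the G_m have no constant term
    ([solution_form]).  For T = 0 this puts F in the span of G_1, G_2, G_3; for
    T <> 0 it gives r_k = -b eps_k/(2T), so F is a multiple of 2T - G_l.  Linear
    independence is read off from the residues ([residues_zero]).

    The function theory rests on power series alone: germs that are sums of
    power series are closed under sums, products, differentiation and division
    by z - a, and such a germ is either 0 or a power of z - a times a germ that
    does not vanish at a.  No contour integral occurs.  Liouville's theorem for
    doubly periodic functions comes from the maximum principle and the
    identity theorem.  For zeta and wp, the Taylor coefficients of the summands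
    at a point are dominated by (1 + |m| + |n|)^(-3), so they can be summed over
    the lattice coefficient by coefficient ([lattice_pseries]). *)

(** * Neighbourhoods and series in the complex plane *)

Notation Cser := (is_series (K := C_AbsRing) (V := C_NormedModule)).
Notation near := (locally (T := C_UniformSpace)).
Notation near' := (locally' (T := C_UniformSpace)).
Notation der := (is_derive (K := C_AbsRing) (V := C_NormedModule)).

(** For equations whose type is [C] only up to conversion. *)
Ltac cring := cbv beta; match goal with |- @eq _ ?a ?b => change (@eq C a b) end; ring.

(** The neighbourhood filter of [C] as a product space agrees with the one given by
    the modulus; all estimates below use the latter. *)
Lemma near_iff (a : C) (P : C -> Prop) :
  near a P <-> exists d : R, (0 < d)%R /\ forall z, (Cmod (z - a) < d)%R -> P z.
Proof.
  split.
  - intros H. apply locally_C in H. destruct H as [d H].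
    exists d. split; [apply cond_pos|]. intros z Hz. apply H. exact Hz.
  - intros [d [Hd H]]. apply locally_C. exists (mkposreal d Hd). intros z Hz. apply H. exact Hz.
Qed.

Lemma near'_iff (a : C) (P : C -> Prop) :
  near' a P <-> exists d : R, (0 < d)%R /\ forall z, (Cmod (z - a) < d)%R -> z <> a -> P z.
Proof. unfold locally', within. apply near_iff. Qed.

Lemma near_and (a : C) (P Q : C -> Prop) : near a P -> near a Q -> near a (fun z => P z /\ Q z).
Proof. apply filter_and. Qed.
Arguments near_and {a} {P} {Q}.

Lemma near_imp (a : C) (P Q : C -> Prop) : (forall z, P z -> Q z) -> near a P -> near a Q.
Proof. apply filter_imp. Qed.

Lemma near'_and (a : C) (P Q : C -> Prop) : near' a P -> near' a Q -> near' a (fun z => P z /\ Q z).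
Proof.
  intros H K. generalize (near_and H K). apply near_imp. intros z [h k] e. auto.
Qed.
Arguments near'_and {a} {P} {Q}.

Lemma near'_imp (a : C) (P Q : C -> Prop) : (forall z, z <> a -> P z -> Q z) -> near' a P -> near' a Q.
Proof. intros H. apply near_imp. intros z h e. auto. Qed.

Lemma near'_imp2 (a : C) (P Q R : C -> Prop) : near' a P -> near' a Q ->
  (forall z, z <> a -> P z -> Q z -> R z) -> near' a R.
Proof.
  intros H K I. generalize (near'_and H K). apply near'_imp. intros z N [p q]. auto.
Qed.
Arguments near'_imp2 {a} {P} {Q} {R}.

Lemma near'_imp3 (a : C) (P Q R S : C -> Prop) : near' a P -> near' a Q -> near' a R ->
  (forall z, z <> a -> P z -> Q z -> R z -> S z) -> near' a S.
Proof.
  intros H K L I. apply (near'_imp2 H (near'_and K L)). intros z N p [q r]. auto.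
Qed.
Arguments near'_imp3 {a} {P} {Q} {R} {S}.

Lemma near_near' (a : C) (P : C -> Prop) : near a P -> near' a P.
Proof. apply near_imp. auto. Qed.
Arguments near_near' {a} {P}.

Lemma near_center (a : C) (P : C -> Prop) : near a P -> P a.
Proof.
  intros H. apply near_iff in H. destruct H as [d [Hd H]]. apply H.
  replace (a - a) with (RtoC 0) by ring. rewrite Cmod_0. exact Hd.
Qed.

Lemma Csub_neq (z a : C) : z <> a -> z - a <> 0.
Proof. intros H E. apply H. replace z with (z - a + a) by ring. rewrite E. ring. Qed.

(** A punctured disc is open, so what holds on it holds around each of its points.
    This lets identities between functions be differentiated. *)
Lemma near'_near (a : C) (P : C -> Prop) : near' a P -> near' a (fun z => near z P).
Proof.
  intros H. apply near'_iff in H. destruct H as [d [Hd H]].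
  apply near'_iff. exists d. split; auto. intros z Hz Hne.
  assert (0 < Cmod (z - a))%R by (apply Cmod_gt_0, Csub_neq, Hne).
  apply near_iff. exists (Rmin (d - Cmod (z - a)) (Cmod (z - a))). split.
  - apply Rmin_pos; lra.
  - intros y Hy. apply H.
    + replace (y - a) with ((y - z) + (z - a)) by ring.
      eapply Rle_lt_trans; [apply Cmod_triangle|].
      pose proof (Rmin_l (d - Cmod (z - a)) (Cmod (z - a))). lra.
    + intros E. subst y. rewrite <- Cmod_opp in Hy.
      replace (- (a - z)) with (z - a) in Hy by ring.
      pose proof (Rmin_r (d - Cmod (z - a)) (Cmod (z - a))). lra.
Qed.
Arguments near'_near {a} {P}.

Lemma near'_nonempty (a : C) (P : C -> Prop) : near' a P -> exists z, z <> a /\ P z.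
Proof.
  intros H. apply near'_iff in H. destruct H as [d [Hd H]].
  assert (E : a + RtoC (d / 2) - a = RtoC (d / 2)) by ring.
  assert (a + RtoC (d / 2) <> a).
  { intros K. rewrite K in E. replace (a - a) with (RtoC 0) in E by ring.
    apply RtoC_inj in E. lra. }
  exists (a + RtoC (d / 2)). split; auto. apply H; auto.
  rewrite E, Cmod_R, Rabs_pos_eq; lra.
Qed.

Lemma near'_False (a : C) : ~ near' a (fun _ => False).
Proof. intros H. destruct (near'_nonempty _ _ H) as [z [_ []]]. Qed.

Lemma near_scale (a : C) (s t : R) : (0 < s)%R -> (0 < t)%R ->
  near a (fun z => (Cmod (z - a) * s < t)%R).
Proof.
  intros Hs Ht. apply near_iff. exists (t / s)%R. split. { apply Rdiv_lt_0_compat; lra. }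
  intros z Hz. apply Rmult_lt_compat_r with (r := s) in Hz; auto.
  unfold Rdiv in Hz. rewrite Rmult_assoc, Rinv_l, Rmult_1_r in Hz; lra.
Qed.

Lemma near_affine (al be a : C) (P : C -> Prop) :
  near (al * a + be) P -> near a (fun z => P (al * z + be)).
Proof.
  intros H. apply near_iff in H. destruct H as [d [Hd H]]. pose proof (Cmod_ge_0 al).
  generalize (near_scale a (1 + Cmod al) d ltac:(lra) Hd). apply near_imp. intros z Hz. apply H.
  replace (al * z + be - (al * a + be)) with (al * (z - a)) by ring.
  rewrite Cmod_mult. pose proof (Cmod_ge_0 (z - a)). nra.
Qed.

Lemma near'_affine (al be a : C) (P : C -> Prop) : al <> 0 ->
  near' (al * a + be) P -> near' a (fun z => P (al * z + be)).
Proof.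
  intros Hal H. apply near_affine in H. revert H. apply near_imp.
  intros z h e. apply h. intros E. apply e.
  assert (al * (z - a) = 0).
  { replace (al * (z - a)) with (al * z + be - (al * a + be)) by ring. rewrite E. ring. }
  destruct (Ceq_dec z a) as [|N]; auto. exfalso.
  apply Csub_neq in N. revert H. apply Cmult_neq_0; auto.
Qed.

Lemma Cplus_eq_reg_r (z a w : C) : z + w = a + w -> z = a.
Proof. intros E. replace z with (z + w - w) by ring. rewrite E. ring. Qed.

Lemma near_translate (a w : C) (P : C -> Prop) : near (a + w) P -> near a (fun z => P (z + w)).
Proof.
  intros H. replace (a + w) with (1 * a + w) in H by ring.
  apply near_affine in H. revert H. apply near_imp. intros z.
  replace (1 * z + w) with (z + w) by ring. auto.
Qed.

Lemma near'_translate (a w : C) (P : C -> Prop) :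
  near' (a + w) P -> near' a (fun z => P (z + w)).
Proof.
  intros H. apply near_translate in H. revert H. apply near_imp. intros z h N. apply h.
  intros E. apply N. exact (Cplus_eq_reg_r _ _ _ E).
Qed.

Lemma Cm1_nz : - (1) <> 0.
Proof. intros K. apply C1_nz. replace (RtoC 1) with (- - (1)) by ring. rewrite K. ring. Qed.

Lemma C2_nz : RtoC 2 <> 0.
Proof. intros H. apply RtoC_inj in H. lra. Qed.

Lemma near'_reflect (a b : C) (P : C -> Prop) :
  near' (b - a) P -> near' a (fun z => P (b - z)).
Proof.
  intros H. replace (b - a) with (- (1) * a + b) in H by ring.
  apply near'_affine in H; [|apply Cm1_nz]. revert H. apply near'_imp. intros z _.
  replace (- (1) * z + b) with (b - z) by ring. auto.
Qed.


Lemma Cser_ext (a : nat -> C) (b : nat -> C) (l : C) : (forall k, a k = b k) -> Cser a l -> Cser b l.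
Proof. apply is_series_ext. Qed.
Lemma Cser_plus (a b : nat -> C) (l m : C) : Cser a l -> Cser b m -> Cser (fun k => a k + b k) (l + m).
Proof. apply (is_series_plus (K := C_AbsRing) (V := C_NormedModule)). Qed.
Lemma Cser_scal (c : C) (a : nat -> C) (l : C) : Cser a l -> Cser (fun k => c * a k) (c * l).
Proof. apply (is_series_scal (K := C_AbsRing) (V := C_NormedModule)). Qed.
Lemma Cser_unique (a : nat -> C) (l : C) (m : C) : Cser a l -> Cser a m -> l = m.
Proof. apply filterlim_locally_unique. Qed.
Lemma Cser_eq (a : nat -> C) (l : C) (m : C) : l = m -> Cser a l -> Cser a m.
Proof. intros <-; auto. Qed.

Definition Clim (u : nat -> C) (l : C) := filterlim u eventually (near l).

Lemma Clim_iff u l : Clim u l <->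
  forall eps : R, (0 < eps)%R -> exists N, forall n, (N <= n)%nat -> (Cmod (u n - l) < eps)%R.
Proof.
  split.
  - intros H eps He.
    destruct (H (fun z => Cmod (z - l) < eps)%R) as [N HN].
    { apply near_iff. exists eps. split; auto. }
    exists N. exact HN.
  - intros H P HP. apply near_iff in HP. destruct HP as [d [Hd HP]].
    destruct (H d Hd) as [N HN]. exists N. intros n Hn. apply HP, HN, Hn.
Qed.

Lemma Clim_unique u l m : Clim u l -> Clim u m -> l = m.
Proof. apply (filterlim_locally_unique (V := C_NormedModule)). Qed.

Lemma Clim_ext u v l : (forall n, u n = v n) -> Clim u l -> Clim v l.
Proof. intros H. apply filterlim_ext. exact H. Qed.

Lemma Clim_const c : Clim (fun _ => c) c.
Proof. apply filterlim_const. Qed.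

Lemma Clim_plus u v l m : Clim u l -> Clim v m -> Clim (fun n => u n + v n) (l + m).
Proof.
  intros H K. apply Clim_iff. intros e He.
  rewrite Clim_iff in H, K.
  destruct (H (e / 2)%R ltac:(lra)) as [N1 H1]. destruct (K (e / 2)%R ltac:(lra)) as [N2 H2].
  exists (N1 + N2)%nat. intros n Hn.
  specialize (H1 n ltac:(lia)). specialize (H2 n ltac:(lia)).
  replace (u n + v n - (l + m)) with ((u n - l) + (v n - m)) by ring.
  eapply Rle_lt_trans; [apply Cmod_triangle|]. lra.
Qed.

Lemma Clim_scal c u l : Clim u l -> Clim (fun n => c * u n) (c * l).
Proof.
  intros H. apply Clim_iff. intros e He.
  rewrite Clim_iff in H.
  pose proof (Cmod_ge_0 c).
  destruct (H (e / (1 + Cmod c))%R) as [N HN].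
  { apply Rdiv_lt_0_compat; lra. }
  exists N. intros n Hn. specialize (HN n Hn).
  replace (c * u n - c * l) with (c * (u n - l)) by ring.
  rewrite Cmod_mult. pose proof (Cmod_ge_0 (u n - l)).
  assert (Cmod (u n - l) * (1 + Cmod c) < e)%R.
  { apply Rmult_lt_reg_r with (/ (1 + Cmod c))%R. apply Rinv_0_lt_compat; lra.
    rewrite Rmult_assoc, Rinv_r by lra. rewrite Rmult_1_r. exact HN. }
  nra.
Qed.

Lemma Clim_le u l M : Clim u l -> (forall n, Cmod (u n) <= M)%R -> (Cmod l <= M)%R.
Proof.
  intros H K. apply le_epsilon. intros e He. rewrite Clim_iff in H.
  destruct (H e He) as [N HN]. specialize (HN N (le_n N)).
  replace l with (u N + - (u N - l)) by ring.
  eapply Rle_trans; [apply Cmod_triangle|]. rewrite Cmod_opp. specialize (K N). lra.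
Qed.

Lemma Clim_squeeze u e : (forall n, Cmod (u n) <= e n)%R -> is_lim_seq e 0 -> Clim u 0.
Proof.
  intros H K. apply Clim_iff. intros eps He.
  apply is_lim_seq_spec in K. destruct (K (mkposreal eps He)) as [N HN].
  exists N. intros n Hn. specialize (HN n Hn). simpl in HN.
  replace (u n - 0) with (u n) by ring. rewrite Rminus_0_r in HN.
  eapply Rle_lt_trans; [apply H|]. eapply Rle_lt_trans; [apply Rle_abs|exact HN].
Qed.

Definition psum (a : nat -> C) (n : nat) : C := sum_n (G := C_AbelianMonoid) a n.

Lemma psum_O (a : nat -> C) : psum a 0 = a 0%nat.
Proof. exact (sum_O (G := C_AbelianMonoid) a). Qed.

Lemma psum_S (a : nat -> C) (n : nat) : psum a (S n) = psum a n + a (S n).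
Proof. exact (sum_Sn (G := C_AbelianMonoid) a n). Qed.

Lemma Cser_Clim (a : nat -> C) (l : C) : Cser a l <-> Clim (psum a) l.
Proof. reflexivity. Qed.

Lemma Cmod_sum_n (a : nat -> C) (b : nat -> R) n : (forall k, Cmod (a k) <= b k)%R ->
  (Cmod (psum a n) <= sum_n b n)%R.
Proof.
  intros H. induction n as [|n IH].
  - rewrite psum_O, sum_O. apply H.
  - rewrite psum_S, sum_Sn. eapply Rle_trans; [apply Cmod_triangle|].
    apply Rplus_le_compat; auto.
Qed.

Lemma geom_sum_le q n : (0 <= q < 1)%R -> (sum_n (fun k => q ^ k) n <= / (1 - q))%R.
Proof.
  intros Hq.
  assert (sum_n (fun k => q ^ k) n = (1 - q ^ S n) / (1 - q))%R.
  { induction n as [|n IH]. rewrite sum_O. simpl. field. lra.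
    rewrite sum_Sn, IH. unfold plus; simpl. field. lra. }
  rewrite H. unfold Rdiv. rewrite <- (Rmult_1_l (/ (1 - q))) at 2.
  apply Rmult_le_compat_r. left; apply Rinv_0_lt_compat; lra.
  pose proof (pow_le q (S n) ltac:(lra)). lra.
Qed.

(** The single convergence criterion used below: domination by a geometric series of
    ratio 1/2.  Radii are always shrunk until it applies. *)
Lemma Cser_dom (a : nat -> C) (M : R) :
  (forall k, Cmod (a k) <= M * (1 / 2) ^ k)%R ->
  exists s : C, Cser a s /\ (Cmod s <= 2 * M)%R.
Proof.
  intros H.
  assert (HM : (0 <= M)%R).
  { specialize (H 0%nat). simpl in H. pose proof (Cmod_ge_0 (a 0%nat)). lra. }
  assert (ex_series (K := C_AbsRing) (V := C_CompleteNormedModule) a) as [s Hs].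
  { apply (ex_series_le (K := C_AbsRing) (V := C_CompleteNormedModule) a (fun k => M * (1 / 2) ^ k)%R).
    - intros n. eapply Rle_trans; [|apply H]. right. reflexivity.
    - apply (ex_series_scal (V := R_NormedModule) M). exists (/ (1 - 1/2))%R.
      apply is_series_geom. rewrite Rabs_pos_eq; lra. }
  exists s. split. exact Hs.
  apply Clim_le with (u := psum a). exact Hs.
  intros n. eapply Rle_trans. apply Cmod_sum_n. exact H.
  rewrite (sum_n_mult_l (K := R_Ring) M).
  pose proof (geom_sum_le (1/2) n ltac:(lra)). 
  assert (E2 : (/ (1 - 1/2) = 2)%R) by (field; lra). rewrite E2 in H0.
  rewrite (Rmult_comm 2). apply Rmult_le_compat_l; assumption.
Qed.

Lemma Cser_bounded (a : nat -> C) (l : C) : Cser a l -> exists M, (0 < M)%R /\ forall k, (Cmod (a k) <= M)%R.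
Proof.
  intros H. 
  assert (exists B, (0 < B)%R /\ forall n, (Cmod (psum a n) <= B)%R) as [B [HB0 HB]].
  { destruct (proj1 (Clim_iff _ _) (proj1 (Cser_Clim _ _) H) 1%R ltac:(lra)) as [N HN].
    assert (exists B, (0 < B)%R /\ forall n, (n <= N)%nat -> (Cmod (psum a n) <= B)%R) as [B [B0 HB]].
    { clear HN. induction N as [|N [B [B0 HB]]].
      - exists (1 + Cmod (psum a 0))%R. pose proof (Cmod_ge_0 (psum a 0)). 
        split. lra. intros n Hn. replace n with 0%nat by lia. lra.
      - exists (B + Cmod (psum a (S N)))%R. pose proof (Cmod_ge_0 (psum a (S N))).
        split. lra. intros n Hn. destruct (Nat.eq_dec n (S N)) as [->|]. lra.
        specialize (HB n ltac:(lia)). lra. }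
    exists (B + (1 + Cmod l))%R. pose proof (Cmod_ge_0 l). split. lra. intros n.
    destruct (le_lt_dec N n) as [h|h].
    - specialize (HN n h). 
      replace (psum a n) with ((psum a n - l) + l) by ring.
      eapply Rle_trans; [apply Cmod_triangle|]. lra.
    - specialize (HB n ltac:(lia)). lra. }
  exists (2 * B)%R. split. lra. intros [|k].
  - specialize (HB 0%nat). rewrite psum_O in HB. lra.
  - pose proof (HB k) as H1. pose proof (HB (S k)) as H2.
    assert (E : a (S k) = psum a (S k) + - psum a k).
    { rewrite psum_S. ring. }
    rewrite E. eapply Rle_trans; [apply Cmod_triangle|]. rewrite Cmod_opp. lra.
Qed.

Lemma pow_n_Cpow (x : C) k : pow_n (K := C_Ring) x k = x ^ k.
Proof. induction k; simpl. reflexivity. rewrite IHk. reflexivity. Qed.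

Lemma near'_all (a : C) (P : C -> Prop) : (forall z, z <> a -> P z) -> near' a P.
Proof. intros H. apply near'_iff. exists 1%R. split; [lra|auto]. Qed.

(** * Complex derivatives *)

Lemma der_iff (f : C -> C) (z l : C) :
  der f z l <-> forall eps : R, (0 < eps)%R ->
    near z (fun y => (Cmod (f y - f z - l * (y - z)) <= eps * Cmod (y - z))%R).
Proof.
  split.
  - intros [_ H] eps He.
    assert (L : is_filter_lim (locally (T := AbsRing_UniformSpace C_AbsRing) z) z)
      by (intros P HP; exact HP).
    specialize (H z L (mkposreal eps He)).
    apply locally_C. revert H. apply filter_imp. intros y Hy.
    replace (f y - f z - l * (y - z)) with (f y - f z - (y - z) * l) by ring. exact Hy.
  - intros H. split. apply is_linear_scal_l.
    intros x Hx eps.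
    assert (E : z = x).
    { apply (is_filter_lim_locally_unique (V := AbsRing_NormedModule C_AbsRing) z x). exact Hx. }
    subst x. specialize (H eps (cond_pos eps)).
    apply locally_C in H. revert H. apply filter_imp. intros y Hy.
    replace (f y - f z - l * (y - z)) with (f y - f z - (y - z) * l) in Hy by ring. exact Hy.
Qed.

Lemma der_ext (f g : C -> C) (z l : C) : near z (fun y => f y = g y) -> der f z l -> der g z l.
Proof. intros H. apply is_derive_ext_loc. apply locally_C. exact H. Qed.

Lemma der_plus (f g : C -> C) (z l m : C) : der f z l -> der g z m -> der (fun y => f y + g y) z (l + m).
Proof. apply (is_derive_plus (K := C_AbsRing) (V := C_NormedModule)). Qed.

Lemma der_const (c z : C) : der (fun _ => c) z (RtoC 0).
Proof. apply (is_derive_const (K := C_AbsRing) (V := C_NormedModule)). Qed.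

Lemma der_id (z : C) : der (fun y => y) z (RtoC 1).
Proof.
  apply der_iff. intros eps He. apply near_iff. exists 1%R. split; [lra|].
  intros y _. replace (y - z - 1 * (y - z)) with (RtoC 0) by ring. rewrite Cmod_0.
  pose proof (Cmod_ge_0 (y - z)). nra.
Qed.

Lemma der_eq (f : C -> C) (z l m : C) : l = m -> der f z l -> der f z m.
Proof. intros <-; auto. Qed.

Lemma der_cont (f : C -> C) (z l : C) : der f z l ->
  forall eps : R, (0 < eps)%R -> near z (fun y => (Cmod (f y - f z) < eps)%R).
Proof.
  intros H eps He. rewrite der_iff in H. specialize (H 1%R ltac:(lra)).
  apply near_iff in H. destruct H as [d [Hd H]].
  pose proof (Cmod_ge_0 l).
  assert (Hn : near z (fun y => Cmod (y - z) < d)%R) by (apply near_iff; exists d; auto).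
  generalize (near_and Hn (near_scale z (2 + Cmod l) eps ltac:(lra) He)).
  apply near_imp. intros y [Hy Hy2]. specialize (H y Hy).
  replace (f y - f z) with ((f y - f z - l * (y - z)) + l * (y - z)) by ring.
  eapply Rle_lt_trans; [apply Cmod_triangle|]. rewrite Cmod_mult.
  pose proof (Cmod_ge_0 (y - z)). nra.
Qed.

Lemma der_mult (f g : C -> C) (z l m : C) : der f z l -> der g z m ->
  der (fun y => f y * g y) z (l * g z + f z * m).
Proof.
  intros H K. pose proof (der_cont _ _ _ H) as Hc.
  rewrite der_iff in H, K. apply der_iff. intros eps He.
  (* A dominates g z, m and, since e <= 1, f near z; the three error terms are then each at
     most A * e * |y - z| *)
  set (A := (1 + Cmod (g z) + Cmod (f z) + Cmod m)%R).
  assert (HA : (1 <= A)%R).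
  { unfold A. pose proof (Cmod_ge_0 (g z)). pose proof (Cmod_ge_0 (f z)). pose proof (Cmod_ge_0 m). lra. }
  set (e := Rmin 1 (eps / (4 * A))%R).
  assert (He1 : (0 < e)%R). { apply Rmin_pos. lra. apply Rdiv_lt_0_compat; lra. }
  assert (e <= 1)%R by apply Rmin_l.
  assert (4 * A * e <= eps)%R.
  { pose proof (Rmin_r 1 (eps / (4 * A))%R). fold e in H1.
    apply Rmult_le_compat_l with (r := (4 * A)%R) in H1; [|lra].
    eapply Rle_trans; [exact H1|]. right. field. lra. }
  generalize (near_and (near_and (H e He1) (K e He1)) (Hc e He1)).
  apply near_imp. intros y [[h k] c].
  replace (f y * g y - f z * g z - (l * g z + f z * m) * (y - z))
    with ((f y - f z - l * (y - z)) * g z + (f y * (g y - g z - m * (y - z))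
           + (f y - f z) * (m * (y - z)))) by ring.
  eapply Rle_trans; [apply Cmod_triangle|].
  rewrite Cmod_mult.
  assert (Hfy : (Cmod (f y) <= Cmod (f z) + 1)%R).
  { replace (f y) with (f z + (f y - f z)) by ring.
    eapply Rle_trans; [apply Cmod_triangle|]. lra. }
  pose proof (Cmod_triangle (f y * (g y - g z - m * (y - z))) ((f y - f z) * (m * (y - z)))) as T.
  rewrite !Cmod_mult in T.
  pose proof (Cmod_ge_0 (g z)). pose proof (Cmod_ge_0 (f z)). pose proof (Cmod_ge_0 m).
  pose proof (Cmod_ge_0 (y - z)). pose proof (Cmod_ge_0 (f y)).
  set (h0 := Cmod (y - z)) in *.
  assert (Cmod (f y - f z - l * (y - z)) * Cmod (g z) <= e * h0 * A)%R.
  { apply Rmult_le_compat; auto using Cmod_ge_0. unfold A; lra. }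
  assert (Cmod (f y) * Cmod (g y - g z - m * (y - z)) <= A * (e * h0))%R.
  { apply Rmult_le_compat; auto using Cmod_ge_0. unfold A; lra. }
  assert (Cmod (f y - f z) * (Cmod m * h0) <= e * (A * h0))%R.
  { apply Rmult_le_compat; auto using Cmod_ge_0. apply Rmult_le_pos; auto. lra.
    apply Rmult_le_compat_r; auto. unfold A; lra. }
  assert (3 * (A * e) * h0 <= eps * h0)%R.
  { apply Rmult_le_compat_r; auto. assert (0 < A * e)%R by (apply Rmult_lt_0_compat; lra). lra. }
  lra.
Qed.

Lemma der_scal (c : C) (f : C -> C) (z l : C) : der f z l -> der (fun y => c * f y) z (c * l).
Proof.
  intros H. apply der_eq with (l := 0 * f z + c * l). ring.
  apply (der_mult (fun _ => c) f); auto. apply der_const.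
Qed.

Lemma der_opp (f : C -> C) (z l : C) : der f z l -> der (fun y => - f y) z (- l).
Proof.
  intros H. apply der_eq with (l := - (1) * l). ring.
  apply der_ext with (f := fun y => - (1) * f y).
  - apply filter_forall. intros y. cbv beta. change (- (1) * f y = - f y :> C). ring.
  - apply der_scal, H.
Qed.

Lemma der_minus (f g : C -> C) (z l m : C) : der f z l -> der g z m -> der (fun y => f y - g y) z (l - m).
Proof. intros H K. apply der_plus; auto. apply der_opp; auto. Qed.

Lemma der_translate (f : C -> C) (w z l : C) : der f (z + w) l -> der (fun y => f (y + w)) z l.
Proof.
  intros H. rewrite der_iff in H. apply der_iff. intros eps He.
  generalize (near_translate z w _ (H eps He)). apply near_imp. intros y.
  replace (y + w - (z + w)) with (y - z) by ring. auto.
Qed.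

Lemma der_C_derive (f : C -> C) (z l : C) : der f z l -> C_derive f z = l.
Proof. apply is_C_derive_unique. Qed.

Lemma der_unique (f : C -> C) (z l m : C) : der f z l -> der f z m -> l = m.
Proof. intros H K. apply der_C_derive in H. apply der_C_derive in K. congruence. Qed.

(** * The Cauchy product *)

Lemma is_series_eps (a : nat -> R) (l : R) :
  is_series a l <-> forall eps : R, (0 < eps)%R -> exists N, forall n, (N <= n)%nat -> (Rabs (sum_n a n - l) < eps)%R.
Proof.
  change (is_series a l) with (is_lim_seq (sum_n a) l).
  rewrite <- is_lim_seq_spec. split.
  - intros H eps He. exact (H (mkposreal eps He)).
  - intros H eps. exact (H eps (cond_pos eps)).
Qed.

Lemma Re_psum a n : Re (psum a n) = sum_n (fun k => Re (a k)) n.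
Proof.
  induction n. now rewrite psum_O, sum_O. rewrite psum_S, sum_Sn. rewrite <- IHn. reflexivity.
Qed.
Lemma Im_psum a n : Im (psum a n) = sum_n (fun k => Im (a k)) n.
Proof.
  induction n. now rewrite psum_O, sum_O. rewrite psum_S, sum_Sn. rewrite <- IHn. reflexivity.
Qed.

Lemma im_le_Cmod (c : C) : (Rabs (Im c) <= Cmod c)%R.
Proof. eapply Rle_trans; [apply Rmax_r|apply Rmax_Cmod]. Qed.

Lemma Cmod_le_sum (c : C) : (Cmod c <= Rabs (Re c) + Rabs (Im c))%R.
Proof.
  replace c with (RtoC (Re c) + Ci * RtoC (Im c)) at 1.
  - eapply Rle_trans; [apply Cmod_triangle|]. rewrite Cmod_mult, Cmod_Ci, !Cmod_R. lra.
  - destruct c as [x y]. unfold Ci, RtoC, Cplus, Cmult; simpl. f_equal; ring.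
Qed.

Lemma Cser_ReIm (a : nat -> C) (s : C) :
  Cser a s <-> is_series (fun k => Re (a k)) (Re s) /\ is_series (fun k => Im (a k)) (Im s).
Proof.
  rewrite Cser_Clim, Clim_iff, !is_series_eps. split.
  - intros H. split; intros eps He; destruct (H eps He) as [N HN]; exists N; intros n Hn;
      specialize (HN n Hn); eapply Rle_lt_trans; try exact HN.
    + rewrite <- Re_psum. apply (re_le_Cmod (psum a n - s)).
    + rewrite <- Im_psum. apply (im_le_Cmod (psum a n - s)).
  - intros [H K] eps He. destruct (H (eps/2)%R ltac:(lra)) as [N1 H1].
    destruct (K (eps/2)%R ltac:(lra)) as [N2 H2]. exists (N1 + N2)%nat. intros n Hn.
    specialize (H1 n ltac:(lia)). specialize (H2 n ltac:(lia)).
    rewrite <- Re_psum in H1. rewrite <- Im_psum in H2.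
    eapply Rle_lt_trans; [apply Cmod_le_sum|].
    change (Re (psum a n - s)) with (Re (psum a n) - Re s)%R.
    change (Im (psum a n - s)) with (Im (psum a n) - Im s)%R. lra.
Qed.

Definition cauchy_prod (a b : nat -> C) (n : nat) : C := psum (fun k => a k * b (n - k)%nat) n.

Lemma ex_series_geo_dom (a : nat -> R) (M : R) :
  (forall k, Rabs (a k) <= M * (1 / 2) ^ k)%R -> ex_series (fun k => Rabs (a k)).
Proof.
  intros H. apply (ex_series_le (V := R_CompleteNormedModule)) with (b := fun k => (M * (1/2)^k)%R).
  - intros n. unfold norm; simpl. unfold abs; simpl. rewrite Rabs_Rabsolu. apply H.
  - apply (ex_series_scal (V := R_NormedModule) M). exists (/ (1 - 1/2))%R.
    apply is_series_geom. rewrite Rabs_pos_eq; lra.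
Qed.

(** The Cauchy product of absolutely convergent real series, applied to the real and
    imaginary parts. *)
Lemma Cser_mult (a b : nat -> C) (A B : C) (M : R) :
  (forall k, Cmod (a k) <= M * (1 / 2) ^ k)%R -> (forall k, Cmod (b k) <= M * (1 / 2) ^ k)%R ->
  Cser a A -> Cser b B -> Cser (cauchy_prod a b) (A * B).
Proof.
  intros Ha Hb HA HB. apply Cser_ReIm in HA. apply Cser_ReIm in HB.
  destruct HA as [Ar Ai]. destruct HB as [Br Bi].
  assert (X : forall f : C -> R, (forall c, Rabs (f c) <= Cmod c)%R ->
     ex_series (fun k => Rabs (f (a k))) /\ ex_series (fun k => Rabs (f (b k)))).
  { intros f Hf. split; apply ex_series_geo_dom with (M := M); intros k;
    (eapply Rle_trans; [apply Hf|]); auto. }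
  destruct (X Re re_le_Cmod) as [ar br]. destruct (X Im im_le_Cmod) as [ai bi].
  pose proof (is_series_mult _ _ _ _ Ar Br ar br) as Rr.
  pose proof (is_series_mult _ _ _ _ Ai Bi ai bi) as Rii.
  pose proof (is_series_mult _ _ _ _ Ar Bi ar bi) as Ri.
  pose proof (is_series_mult _ _ _ _ Ai Br ai br) as Ir.
  assert (S2 : forall (s : R) (f g : nat -> R) n,
     sum_n (fun k => f k + s * g k)%R n = (sum_f_R0 f n + s * sum_f_R0 g n)%R).
  { intros s f g n. rewrite sum_n_Reals. induction n; simpl; [reflexivity|]. rewrite IHn. ring. }
  apply Cser_ReIm. split.
  - pose proof (is_series_minus _ _ _ _ Rr Rii) as Z. revert Z. apply is_series_ext.
    intros n. unfold cauchy_prod. rewrite Re_psum.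
    rewrite (sum_n_ext _ (fun k => Re (a k) * Re (b (n - k)%nat) + (-1) * (Im (a k) * Im (b (n - k)%nat)))%R).
    + rewrite (S2 (-1)%R (fun k => Re (a k) * Re (b (n - k)%nat))%R (fun k => Im (a k) * Im (b (n - k)%nat))%R).
      unfold plus, opp; simpl. ring.
    + intros k. unfold Cmult, Re, Im; simpl. ring.
  - pose proof (is_series_plus _ _ _ _ Ri Ir) as Z. revert Z. apply is_series_ext.
    intros n. unfold cauchy_prod. rewrite Im_psum.
    rewrite (sum_n_ext _ (fun k => Re (a k) * Im (b (n - k)%nat) + 1 * (Im (a k) * Re (b (n - k)%nat)))%R).
    + rewrite (S2 1%R (fun k => Re (a k) * Im (b (n - k)%nat))%R (fun k => Im (a k) * Re (b (n - k)%nat))%R).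
      unfold plus; simpl. ring.
    + intros k. unfold Cmult, Re, Im; simpl. ring.
Qed.

(** * Analytic germs *)

(** Holomorphy as a convergent expansion at the one point [a]. *)
Definition hol (a : C) (u : C -> C) : Prop :=
  exists c : nat -> C, near a (fun z =>
    is_pseries (K := C_AbsRing) (V := C_NormedModule) c (z - a) (u z)).

(** The quantitative form of [hol]: geometric bounds on the coefficients, and the
    expansion on the disc where they make the terms at most [M / 2 ^ k]. *)
Definition taylor_bounded (a : C) (u : C -> C) (c : nat -> C) (M s : R) : Prop :=
  (0 <= M)%R /\ (0 < s)%R /\ (forall k, Cmod (c k) <= M * s ^ k)%R /\
  (forall z, (Cmod (z - a) * s <= 1 / 2)%R -> Cser (fun k => c k * (z - a) ^ k) (u z)).

Lemma is_pseries_C (c : nat -> C) (x l : C) :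
  is_pseries (K := C_AbsRing) (V := C_NormedModule) c x l <-> Cser (fun k => c k * x ^ k) l.
Proof.
  unfold is_pseries. split; apply Cser_ext; intros k.
  - change (pow_n (K := C_Ring) x k * c k = c k * x ^ k). rewrite (pow_n_Cpow x k). ring.
  - change (c k * x ^ k = pow_n (K := C_Ring) x k * c k). rewrite (pow_n_Cpow x k). ring.
Qed.

Lemma taylor_bounded_mono a u c M s M' s' : taylor_bounded a u c M s -> (M <= M')%R -> (s <= s')%R -> taylor_bounded a u c M' s'.
Proof.
  intros [HM [Hs [Hc Hu]]] h k. split; [lra|split; [lra|split]].
  - intros n. eapply Rle_trans; [apply Hc|].
    apply Rmult_le_compat; auto. apply pow_le; lra. apply pow_incr; lra.
  - intros z Hz. apply Hu. pose proof (Cmod_ge_0 (z - a)). nra.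
Qed.

Lemma taylor_bounded_hol a u c M s : taylor_bounded a u c M s -> hol a u.
Proof.
  intros [HM [Hs [Hc Hu]]]. exists c.
  generalize (near_scale a s (1 / 2) Hs ltac:(lra)). apply near_imp. intros z Hz.
  apply (proj2 (is_pseries_C _ _ _)), Hu. lra.
Qed.

(** A series that converges at one point has bounded terms there, which bounds its
    coefficients geometrically. *)
Lemma near_taylor_bounded (a : C) (u : C -> C) (c : nat -> C) :
  near a (fun z => is_pseries (K := C_AbsRing) (V := C_NormedModule) c (z - a) (u z)) ->
  exists M s, taylor_bounded a u c M s.
Proof.
  intros H. apply near_iff in H. destruct H as [d [Hd H]].
  set (z0 := a + RtoC (d / 2)).
  assert (E : z0 - a = RtoC (d / 2)) by (unfold z0; ring).
  assert (H0 := H z0). rewrite E, Cmod_R, Rabs_pos_eq in H0 by lra.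
  specialize (H0 ltac:(lra)). apply (proj1 (is_pseries_C _ _ _)) in H0.
  apply Cser_bounded in H0. destruct H0 as [M [HM HB]].
  exists M, (2 / d)%R. split; [lra|split; [apply Rdiv_lt_0_compat; lra|split]].
  - intros k. specialize (HB k). rewrite Cmod_mult, Cmod_pow, Cmod_R, Rabs_pos_eq in HB by lra.
    assert (P : (0 < (d / 2) ^ k)%R) by (apply pow_lt; lra).
    apply Rmult_le_reg_r with ((d / 2) ^ k)%R; auto.
    rewrite Rmult_assoc, <- Rpow_mult_distr.
    replace (2 / d * (d / 2))%R with 1%R by (field; lra). rewrite pow1. lra.
  - intros z Hz. apply (proj1 (is_pseries_C _ _ _)), H.
    assert (Cmod (z - a) * (2 / d) * d <= 1 / 2 * d)%R by (apply Rmult_le_compat_r; lra).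
    replace (Cmod (z - a) * (2 / d) * d)%R with (2 * Cmod (z - a))%R in H0 by (field; lra). lra.
Qed.

Lemma hol_taylor_bounded a u : hol a u -> exists c M s, taylor_bounded a u c M s.
Proof. intros [c H]. exists c. apply near_taylor_bounded, H. Qed.

Lemma taylor_bounded_term a u c M s : taylor_bounded a u c M s -> forall x, (Cmod x * s <= 1 / 2)%R ->
  forall k, (Cmod (c k * x ^ k) <= M * (1 / 2) ^ k)%R.
Proof.
  intros [HM [Hs [Hc _]]] x Hx k. rewrite Cmod_mult, Cmod_pow.
  pose proof (Cmod_ge_0 x).
  apply Rle_trans with (M * s ^ k * Cmod x ^ k)%R.
  - apply Rmult_le_compat_r; auto. apply pow_le; auto.
  - rewrite Rmult_assoc, <- Rpow_mult_distr. apply Rmult_le_compat_l; auto.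
    apply pow_incr. split; [|lra]. nra.
Qed.

Lemma hol_ext a u v : near a (fun z => u z = v z) -> hol a u -> hol a v.
Proof.
  intros H [c K]. exists c. generalize (near_and H K). apply near_imp.
  intros z [E h]. rewrite <- E. exact h.
Qed.

Lemma hol_ext_all a u v : (forall z, u z = v z) -> hol a u -> hol a v.
Proof. intros H. apply hol_ext. apply filter_forall. exact H. Qed.

Lemma hol_plus a u v : hol a u -> hol a v -> hol a (fun z => u z + v z).
Proof.
  intros [c H] [d K]. exists (fun k => c k + d k). generalize (near_and H K). apply near_imp.
  intros z [h k]. apply (proj2 (is_pseries_C _ _ _)). apply (proj1 (is_pseries_C _ _ _)) in h. apply (proj1 (is_pseries_C _ _ _)) in k.
  generalize (Cser_plus _ _ _ _ h k). apply Cser_ext. intros n. 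
  change (c n * (z - a) ^ n + d n * (z - a) ^ n = (c n + d n) * (z - a) ^ n). ring.
Qed.

Lemma hol_mult a u v : hol a u -> hol a v -> hol a (fun z => u z * v z).
Proof.
  intros H K. apply hol_taylor_bounded in H. apply hol_taylor_bounded in K.
  destruct H as [c [M1 [s1 H]]]. destruct K as [d [M2 [s2 K]]].
  set (M := Rmax M1 M2). set (s := Rmax s1 s2).
  assert (H' : taylor_bounded a u c M s) by (eapply taylor_bounded_mono; [exact H|apply Rmax_l|apply Rmax_l]).
  assert (K' : taylor_bounded a v d M s) by (eapply taylor_bounded_mono; [exact K|apply Rmax_r|apply Rmax_r]).
  clear H K. exists (cauchy_prod c d).
  pose proof H' as [HM [Hs [_ Hu]]]. pose proof K' as [_ [_ [_ Hv]]].
  generalize (near_scale a s (1 / 2) Hs ltac:(lra)). apply near_imp. intros z Hz. apply (proj2 (is_pseries_C _ _ _)).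
  assert (Hz' : (Cmod (z - a) * s <= 1 / 2)%R) by lra.
  generalize (Cser_mult _ _ _ _ M (taylor_bounded_term _ _ _ _ _ H' _ Hz') (taylor_bounded_term _ _ _ _ _ K' _ Hz') (Hu z Hz') (Hv z Hz')).
  apply Cser_ext. intros n. unfold cauchy_prod.
  assert (X : forall m (f g : nat -> C) (t : C), (forall k, (k <= m)%nat -> f k = g k * t) ->
     psum f m = psum g m * t).
  { induction m; intros f g t Hf. rewrite !psum_O. apply Hf; lia.
    rewrite !psum_S, (IHm f g t), Hf by auto. ring. }
  apply X. intros k Hk. replace n with (k + (n - k))%nat at 4 by lia. rewrite Cpow_add_r. ring.
Qed.

Lemma hol_pseries0 a (c : nat -> C) (u : C -> C) (N : nat) :
  (forall k, (N < k)%nat -> c k = 0) -> (forall z, u z = psum (fun k => c k * (z - a) ^ k) N) -> hol a u.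
Proof.
  intros Hc Hu. exists c. apply filter_forall. intros z. apply (proj2 (is_pseries_C _ _ _)). rewrite Hu.
  apply Cser_Clim, Clim_iff. intros eps He. exists N. intros n Hn.
  assert (E : psum (fun k => c k * (z - a) ^ k) n = psum (fun k => c k * (z - a) ^ k) N).
  { induction Hn as [|m Hm IH]; auto. rewrite psum_S, IH, Hc by lia. ring. }
  rewrite E. replace (_ - _) with (RtoC 0) by ring. rewrite Cmod_0. exact He.
Qed.

Lemma hol_const a c : hol a (fun _ => c).
Proof.
  apply hol_pseries0 with (c := fun k => match k with 0%nat => c | _ => 0 end) (N := 0%nat).
  - intros [|k] Hk; auto. lia.
  - intros z. rewrite psum_O. ring.
Qed.

Lemma hol_id a : hol a (fun z => z).
Proof.
  apply hol_pseries0 with (c := fun k => match k with 0%nat => a | 1%nat => 1 | _ => 0 end) (N := 1%nat).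
  - intros [|[|k]] Hk; auto; lia.
  - intros z. rewrite psum_S, psum_O. ring.
Qed.

Lemma hol_scal a c u : hol a u -> hol a (fun z => c * u z).
Proof. intros H. apply (hol_mult a (fun _ => c) u); auto. apply hol_const. Qed.

Lemma hol_opp a u : hol a u -> hol a (fun z => - u z).
Proof.
  intros H. apply hol_ext_all with (u := fun z => - (1) * u z). intros; ring. apply hol_scal, H.
Qed.

Lemma hol_minus a u v : hol a u -> hol a v -> hol a (fun z => u z - v z).
Proof. intros H K. apply (hol_plus a u (fun z => - v z)); auto. apply hol_opp; auto. Qed.

Lemma hol_pow a u n : hol a u -> hol a (fun z => u z ^ n).
Proof.
  intros H. induction n as [|n IH]. apply (hol_const a 1). simpl. apply hol_mult; auto.
Qed.

Lemma hol_lin a : hol a (fun z => z - a).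
Proof. apply (hol_minus a (fun z => z) (fun _ => a)). apply hol_id. apply hol_const. Qed.

Lemma hol_affine (a al be : C) u : hol (al * a + be) u -> hol a (fun z => u (al * z + be)).
Proof.
  intros [c H]. exists (fun k => c k * al ^ k). apply near_affine in H. revert H. apply near_imp.
  intros z h. apply (proj2 (is_pseries_C _ _ _)). apply (proj1 (is_pseries_C _ _ _)) in h. revert h. apply Cser_ext.
  intros k. replace (al * z + be - (al * a + be)) with (al * (z - a)) by ring.
  rewrite Cpow_mult_l. change (c k * (al ^ k * (z - a) ^ k) = c k * al ^ k * (z - a) ^ k). ring.
Qed.

Lemma hol_translate (a w : C) u : hol (a + w) u -> hol a (fun z => u (z + w)).
Proof.
  intros H. apply hol_ext_all with (u := fun z => u (1 * z + w)). { intros z. f_equal. ring. }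
  apply hol_affine. replace (1 * a + w) with (a + w) by ring. exact H.
Qed.

Lemma hol_reflect (a b : C) u : hol (b - a) u -> hol a (fun z => u (b - z)).
Proof.
  intros H. apply hol_ext_all with (u := fun z => u (- (1) * z + b)). { intros z. f_equal. ring. }
  apply hol_affine. replace (- (1) * a + b) with (b - a) by ring. exact H.
Qed.

Lemma Cser_shift (a : nat -> C) (l : C) : Cser a l -> Cser (fun k => a (S k)) (l - a 0%nat).
Proof.
  intros H. apply (is_series_incr_1 (K := C_AbsRing) (V := C_NormedModule)).
  apply Cser_eq with (l := l); auto.
  change (l = l - a 0%nat + a 0%nat). ring.
Qed.

Lemma Cser_unshift (a : nat -> C) (l : C) : Cser (fun k => a (S k)) l -> Cser a (l + a 0%nat).
Proof.
  intros H. apply (is_series_decr_1 (K := C_AbsRing) (V := C_NormedModule)).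
  apply Cser_eq with (l := l); auto.
  change (l = l + a 0%nat + - a 0%nat). ring.
Qed.

Lemma Cser_0 (a : nat -> C) : (forall k, a k = 0) -> Cser a (RtoC 0).
Proof.
  intros H. apply Cser_Clim. apply Clim_ext with (u := fun _ => RtoC 0); [|apply Clim_const].
  induction n. now rewrite psum_O. rewrite psum_S, <- IHn, H. ring.
Qed.

Lemma Cser_head (a : nat -> C) : (forall k, a (S k) = 0) -> Cser a (a 0%nat).
Proof.
  intros H. apply Cser_eq with (l := 0 + a 0%nat). ring. apply Cser_unshift, Cser_0, H.
Qed.

Lemma hol_value a u c M s : taylor_bounded a u c M s -> u a = c 0%nat.
Proof.
  intros [_ [Hs [_ H]]]. specialize (H a).
  replace (a - a) with (RtoC 0) in H by ring. rewrite Cmod_0, Rmult_0_l in H.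
  specialize (H ltac:(lra)). eapply Cser_unique. exact H.
  apply Cser_eq with (l := c 0%nat * 0 ^ 0). simpl; ring.
  apply (Cser_head (fun k => c k * 0 ^ k)). intros k. simpl. ring.
Qed.

(** Dropping the constant coefficient and shifting divides by [z - a]. *)
Lemma taylor_bounded_div a u c M s : taylor_bounded a u c M s ->
  exists v, taylor_bounded a v (fun k => c (S k)) (M * s) s /\ near a (fun z => u z = u a + (z - a) * v z).
Proof.
  intros H. pose proof (hol_value _ _ _ _ _ H) as E0. pose proof H as [HM [Hs [Hc Hu]]].
  exists (fun z => if Ceq_dec z a then c 1%nat else (u z - c 0%nat) / (z - a)).
  split.
  - split; [nra|split; [auto|split]].
    + intros k. rewrite Rmult_assoc. apply (Hc (S k)).
    + intros z Hz. destruct (Ceq_dec z a) as [->|Hne].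
      * replace (a - a) with (RtoC 0) by ring.
        apply Cser_eq with (l := c 1%nat * 0 ^ 0). simpl; ring.
        apply (Cser_head (fun k => c (S k) * 0 ^ k)). intros k. simpl. ring.
      * specialize (Hu z Hz). apply Cser_shift in Hu. simpl in Hu.
        apply Cser_scal with (c := / (z - a)) in Hu. apply Csub_neq in Hne.
        eapply Cser_eq; [|eapply Cser_ext; [|exact Hu]].
        -- change (/ (z - a) * (u z - c 0%nat * 1) = (u z - c 0%nat) / (z - a)). field. auto.
        -- intros k. simpl. change (/ (z - a) * (c (S k) * ((z - a) * (z - a) ^ k)) = c (S k) * (z - a) ^ k).
           field. auto.
  - apply filter_forall. intros z. rewrite E0. destruct (Ceq_dec z a) as [->|Hne].
    + rewrite E0. ring.
    + apply Csub_neq in Hne. field. auto.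
Qed.

Lemma hol_div a u : hol a u -> exists v, hol a v /\ near a (fun z => u z = u a + (z - a) * v z).
Proof.
  intros H. apply hol_taylor_bounded in H. destruct H as [c [M [s H]]].
  destruct (taylor_bounded_div _ _ _ _ _ H) as [v [Hv E]]. exists v. split; auto. eapply taylor_bounded_hol, Hv.
Qed.

(** Factor out the first nonzero coefficient.  Every statement on zeros and poles below
    comes from this alternative. *)
Lemma hol_dichotomy a u : hol a u ->
  near a (fun z => u z = 0) \/
  exists n v, hol a v /\ v a <> 0 /\ near a (fun z => u z = (z - a) ^ n * v z).
Proof.
  intros H. apply hol_taylor_bounded in H. destruct H as [c [M [s H]]].
  destruct (classic (forall k, c k = 0)) as [Z|NZ].
  - left. destruct H as [HM [Hs [Hc Hu]]].
    generalize (near_scale a s (1 / 2) Hs ltac:(lra)). apply near_imp. intros z Hz.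
    apply (Cser_unique _ _ _ (Hu z ltac:(lra))). apply Cser_0. intros k. rewrite Z. ring.
  - right. apply not_all_ex_not in NZ. destruct NZ as [k Hk].
    revert u c M s H Hk. induction k as [|k IH]; intros u c M s H Hk.
    + exists 0%nat, u. split; [eapply taylor_bounded_hol, H|]. rewrite (hol_value _ _ _ _ _ H). split; auto.
      apply filter_forall. intros z. simpl. change (u z = 1 * u z). ring.
    + destruct (Ceq_dec (c 0%nat) 0) as [E|E].
      * destruct (taylor_bounded_div _ _ _ _ _ H) as [v [Hv Ev]].
        destruct (IH _ _ _ _ Hv Hk) as [n [w [Hw [Hw0 Ew]]]].
        exists (S n), w. split; auto. split; auto.
        generalize (near_and Ev Ew). apply near_imp. intros z [e1 e2].
        rewrite e1, e2, (hol_value _ _ _ _ _ H), E. simpl. ring.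
      * exists 0%nat, u. split; [eapply taylor_bounded_hol, H|]. rewrite (hol_value _ _ _ _ _ H). split; auto.
        apply filter_forall. intros z. simpl. change (u z = 1 * u z). ring.
Qed.

(** * Termwise differentiation *)

(** Second order Taylor estimate for a power.  The factor [r ^ 2] on the left avoids
    the exponent [k - 1] on the right. *)
Lemma pow_diff_bound (X Y : C) (r : R) (k : nat) : (0 <= r)%R -> (Cmod X <= r)%R -> (Cmod Y <= r)%R ->
  (Cmod (Y ^ S k - X ^ S k - INR (S k) * X ^ k * (Y - X)) * r ^ 2 <= INR (S k) ^ 2 * r ^ S k * Cmod (Y - X) ^ 2)%R.
Proof.
  intros Hr HX HY. induction k as [|k IH].
  - replace (Y ^ 1 - X ^ 1 - INR 1 * X ^ 0 * (Y - X)) with (RtoC 0) by (simpl; ring).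
    rewrite Cmod_0, Rmult_0_l. apply Rmult_le_pos. simpl. lra. apply pow2_ge_0.
  - set (e := Y ^ S k - X ^ S k - INR (S k) * X ^ k * (Y - X)) in *.
    replace (Y ^ S (S k) - X ^ S (S k) - INR (S (S k)) * X ^ S k * (Y - X))
      with (Y * e + (Y - X) ^ 2 * (INR (S k) * X ^ k)).
    2:{ unfold e. rewrite (S_INR (S k)), RtoC_plus. simpl Cpow. ring. }
    eapply Rle_trans. apply Rmult_le_compat_r. apply pow2_ge_0. apply Cmod_triangle.
    rewrite !Cmod_mult, !Cmod_pow, Cmod_R, Rabs_pos_eq by apply pos_INR.
    set (h := (Cmod (Y - X) ^ 2)%R) in *.
    assert (Hh : (0 <= h)%R) by apply pow2_ge_0.
    pose proof (Cmod_ge_0 e). pose proof (Cmod_ge_0 Y). pose proof (Cmod_ge_0 X).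
    rewrite (S_INR (S k)). set (n := INR (S k)) in *.
    assert (Hn : (0 <= n)%R) by apply pos_INR.
    assert (Hk : (0 <= r ^ k)%R) by (apply pow_le; auto).
    assert (HXk : (Cmod X ^ k <= r ^ k)%R) by (apply pow_incr; lra).
    assert (A1 : (Cmod Y * Cmod e * r ^ 2 <= r * (n ^ 2 * r ^ S k * h))%R).
    { rewrite Rmult_assoc. apply Rmult_le_compat; auto. apply Rmult_le_pos; auto. apply pow2_ge_0. }
    assert (A2 : (h * (n * Cmod X ^ k) * r ^ 2 <= h * (n * r ^ k) * r ^ 2)%R).
    { apply Rmult_le_compat_r. apply pow2_ge_0. apply Rmult_le_compat_l; auto.
      apply Rmult_le_compat_l; auto. }
    simpl in *. assert (0 <= h * (r ^ k * (r * r)) * (n + 1))%R.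
    { apply Rmult_le_pos; [apply Rmult_le_pos; auto; apply Rmult_le_pos; auto; nra|lra]. }
    lra.
Qed.

Lemma pow2_ge_S k : (INR (S k) <= 2 ^ k)%R.
Proof.
  induction k. simpl; lra. rewrite S_INR. change (2 ^ S k)%R with (2 * 2 ^ k)%R.
  pose proof (pow_le 2 k ltac:(lra)). assert (1 <= 2 ^ k)%R by (apply pow_R1_Rle; lra). lra.
Qed.

(** Sum [pow_diff_bound] over [k]: the remainder of the termwise differential is
    [O(|y - z| ^ 2)] as soon as [k ^ 2] is absorbed by the geometric decay, which is why the
    disc shrinks by a factor of four. *)
Lemma taylor_bounded_der a u c M s : taylor_bounded a u c M s ->
  exists u', taylor_bounded a u' (fun k => INR (S k) * c (S k)) (M * s) (4 * s) /\
    forall z, (Cmod (z - a) * s < 1 / 8)%R -> der u z (u' z).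
Proof.
  intros [HM [Hs [Hc Hu]]].
  set (c' := fun k => RtoC (INR (S k)) * c (S k)).
  assert (Hc' : forall k, (Cmod (c' k) <= M * s * (2 * s) ^ k)%R).
  { intros k. unfold c'. rewrite Cmod_mult, Cmod_R, Rabs_pos_eq by apply pos_INR.
    rewrite Rpow_mult_distr. replace (M * s * (2 ^ k * s ^ k))%R with (2 ^ k * (M * s ^ S k))%R by (simpl; ring).
    apply Rmult_le_compat; auto using pos_INR, Cmod_ge_0, pow2_ge_S. }
  assert (EX : forall z, exists l, (Cmod (z - a) * (4 * s) <= 1 / 2)%R -> Cser (fun k => c' k * (z - a) ^ k) l).
  { intros z. destruct (Rle_dec (Cmod (z - a) * (4 * s)) (1 / 2)) as [h|h].
    - destruct (Cser_dom (fun k => c' k * (z - a) ^ k) (M * s)) as [l [Hl _]].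
      + intros k. rewrite Cmod_mult, Cmod_pow.
        pose proof (Cmod_ge_0 (z - a)).
        apply Rle_trans with (M * s * (2 * s) ^ k * Cmod (z - a) ^ k)%R.
        * apply Rmult_le_compat_r; auto. apply pow_le; auto.
        * rewrite Rmult_assoc, <- Rpow_mult_distr. apply Rmult_le_compat_l. nra.
          apply pow_incr. nra.
      + exists l. auto.
    - exists (RtoC 0). intros; contradiction. }
  set (u' := fun z => proj1_sig (constructive_indefinite_description _ (EX z))).
  assert (Hu' : forall z, (Cmod (z - a) * (4 * s) <= 1 / 2)%R -> Cser (fun k => c' k * (z - a) ^ k) (u' z)).
  { intros z. unfold u'. destruct (constructive_indefinite_description _ (EX z)) as [l Hl]. exact Hl. }
  exists u'. split.
  - split; [nra|split; [lra|split; auto]].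
    intros k. eapply Rle_trans; [apply Hc'|]. apply Rmult_le_compat_l. nra.
    apply pow_incr. lra.
  - intros z Hz. apply der_iff. intros eps He.
    (* the remainder is at most 128 M s^2 |y - z|^2: the radius r = 1 / (8 s) below gives
       1 / r^2 = 64 s^2, and the geometric series a factor 2 *)
    set (B := (128 * M * s ^ 2 + 1)%R).
    assert (HB : (0 < B)%R) by (unfold B; pose proof (pow2_ge_0 s); nra).
    apply near_iff. exists (Rmin ((1 / 8 - Cmod (z - a) * s) / s) (eps / B)). split.
    { apply Rmin_pos. apply Rdiv_lt_0_compat; lra. apply Rdiv_lt_0_compat; lra. }
    intros y Hy.
    assert (Hy1 : (Cmod (y - a) * s <= 1 / 8)%R).
    { pose proof (Rlt_le_trans _ _ _ Hy (Rmin_l _ _)) as Hy1.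
      apply Rmult_lt_compat_r with (r := s) in Hy1; auto.
      replace ((1 / 8 - Cmod (z - a) * s) / s * s)%R with (1 / 8 - Cmod (z - a) * s)%R in Hy1 by (field; lra).
      replace (y - a) with ((y - z) + (z - a)) by ring.
      pose proof (Cmod_triangle (y - z) (z - a)). nra. }
    assert (Hy2 : (Cmod (y - z) * B <= eps)%R).
    { pose proof (Rlt_le_trans _ _ _ Hy (Rmin_r _ _)) as Hy2.
      apply Rmult_lt_compat_r with (r := B) in Hy2; auto.
      replace (eps / B * B)%R with eps in Hy2 by (field; lra). lra. }
    set (X := z - a) in *. set (Y := y - a) in *.
    assert (EYX : y - z = Y - X) by (unfold X, Y; ring). rewrite EYX in *.
    pose proof (Hu z ltac:(fold X; lra)) as S1. fold X in S1.
    pose proof (Hu y ltac:(fold Y; lra)) as S2. fold Y in S2.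
    pose proof (Hu' z ltac:(fold X; lra)) as S3. fold X in S3.
    (* index k now carries the derivative of the k-th power *)
    assert (S3' : Cser (fun k => match k with 0%nat => RtoC 0 | S j => c' j * X ^ j end) (u' z)).
    { apply Cser_eq with (l := u' z + 0). ring.
      apply (Cser_unshift (fun k => match k with 0%nat => RtoC 0 | S j => c' j * X ^ j end)). exact S3. }
    pose proof (Cser_plus _ _ _ _ (Cser_plus _ _ _ _ S2 (Cser_scal (- (1)) _ _ S1))
                  (Cser_scal (- (Y - X)) _ _ S3')) as S4.
    set (r := (/ (8 * s))%R).
    assert (Hr : (0 < r)%R) by (apply Rinv_0_lt_compat; lra).
    assert (HXr : (Cmod X <= r)%R).
    { apply Rmult_le_reg_r with s; auto. unfold r. replace (/ (8 * s) * s)%R with (1/8)%R by (field; lra). lra. }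
    assert (HYr : (Cmod Y <= r)%R).
    { apply Rmult_le_reg_r with s; auto. unfold r. replace (/ (8 * s) * s)%R with (1/8)%R by (field; lra). lra. }
    set (t := fun k => c k * Y ^ k + - (1) * (c k * X ^ k)
                + - (Y - X) * match k with 0%nat => RtoC 0 | S j => c' j * X ^ j end).
    assert (Ht : forall k, (Cmod (t k) <= 64 * M * s ^ 2 * Cmod (Y - X) ^ 2 * (1 / 2) ^ k)%R).
    { intros [|k].
      - unfold t. replace (_ + _ + _) with (RtoC 0) by (simpl; ring). rewrite Cmod_0.
        simpl. pose proof (Cmod_ge_0 (Y - X)). assert (0 <= Cmod (Y - X) * Cmod (Y - X))%R by nra.
        repeat apply Rmult_le_pos; auto; lra.
      - replace (t (S k)) with (c (S k) * (Y ^ S k - X ^ S k - INR (S k) * X ^ k * (Y - X)))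
          by (unfold t, c'; ring).
        pose proof (pow_diff_bound X Y r k (Rlt_le _ _ Hr) HXr HYr) as P.
        set (e := Y ^ S k - X ^ S k - INR (S k) * X ^ k * (Y - X)) in *.
        rewrite Cmod_mult.
        set (h := (Cmod (Y - X) ^ 2)%R) in *.
        assert (Hh : (0 <= h)%R) by apply pow2_ge_0.
        assert (E1 : (Cmod e <= 4 ^ S k * r ^ S k * h * (64 * s ^ 2))%R).
        { replace (Cmod e) with (Cmod e * r ^ 2 * (64 * s ^ 2))%R by (unfold r; field; lra).
          apply Rmult_le_compat_r. { pose proof (pow2_ge_0 s). lra. }
          eapply Rle_trans; [exact P|]. apply Rmult_le_compat_r; auto.
          apply Rmult_le_compat_r. apply pow_le; lra.
          pose proof (pow2_ge_S k). pose proof (pos_INR (S k)).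
          replace (4 ^ S k)%R with ((2 ^ S k) ^ 2)%R.
          - apply pow_incr. split; auto. simpl. pose proof (pow_le 2 k ltac:(lra)). simpl in H. lra.
          - rewrite <- pow_mult, Nat.mul_comm, pow_mult. f_equal. ring. }
        apply Rle_trans with (M * s ^ S k * (4 ^ S k * r ^ S k * h * (64 * s ^ 2)))%R.
        + apply Rmult_le_compat; auto using Cmod_ge_0.
        + right. replace (1 / 2)%R with (s * (4 * r))%R by (unfold r; field; lra).
          rewrite !Rpow_mult_distr. ring. }
    destruct (Cser_dom t _ Ht) as [L [HL1 HL2]].
    assert (EL : L = u y - u z - u' z * (Y - X)).
    { rewrite (Cser_unique _ _ _ HL1 S4). cring. }
    rewrite <- EL. eapply Rle_trans; [exact HL2|].
    pose proof (Cmod_ge_0 (Y - X)). unfold B in Hy2.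
    assert (Cmod (Y - X) * (128 * M * s ^ 2) <= eps)%R by lra.
    apply Rmult_le_compat_r with (r := Cmod (Y - X)) in H0; auto. lra.
Qed.

Lemma hol_der a u : hol a u -> exists u', hol a u' /\ near a (fun z => der u z (u' z)).
Proof.
  intros H. apply hol_taylor_bounded in H. destruct H as [c [M [s H]]].
  destruct (taylor_bounded_der _ _ _ _ _ H) as [u' [Hu' D]]. exists u'. split. eapply taylor_bounded_hol, Hu'.
  destruct H as [_ [Hs _]].
  generalize (near_scale a s (1 / 8) Hs ltac:(lra)). apply near_imp. exact D.
Qed.

Lemma hol_C_derive a f : hol a f -> hol a (C_derive f) /\ near a (fun z => der f z (C_derive f z)).
Proof.
  intros H. destruct (hol_der _ _ H) as [u [Hu D]]. split.
  - apply hol_ext with (u := u); auto. revert D. apply near_imp. intros z d. symmetry. apply der_C_derive, d.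
  - revert D. apply near_imp. intros z d. rewrite (der_C_derive _ _ _ d). exact d.
Qed.

(** Proves [hol] goals by following the structure of the function; what it leaves are
    the atoms about which the context says nothing. *)
Ltac analytic := repeat
    match goal with
    | H : hol ?a ?u |- hol ?a ?u => exact H
    | H : forall b, hol b ?u |- hol ?a ?u => exact (H a)
    | |- hol ?a (fun _ => ?c) => apply (hol_const a c)
    | |- hol ?a (fun z => z) => apply (hol_id a)
    | |- hol ?a (fun z => z - ?a) => apply (hol_lin a)
    | |- hol ?a (C_derive ?f) => refine (proj1 (hol_C_derive a f _))
    | |- hol ?a (fun z => ?u z) => change (hol a u)
    | |- hol ?a (fun z => @?f z + @?g z) => apply (hol_plus a f g)
    | |- hol ?a (fun z => @?f z - @?g z) => apply (hol_minus a f g)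
    | |- hol ?a (fun z => @?f z * @?g z) => apply (hol_mult a f g)
    | |- hol ?a (fun z => - @?f z) => apply (hol_opp a f)
    | |- hol ?a (fun z => @?f z ^ ?n) => apply (hol_pow a f n)
    | |- hol ?a ?u => is_var u; unfold u
    end.

Lemma hol_cont a u : hol a u -> forall eps : R, (0 < eps)%R -> near a (fun z => (Cmod (u z - u a) < eps)%R).
Proof.
  intros H. destruct (hol_der _ _ H) as [u' [_ D]]. apply near_center in D.
  apply (der_cont _ _ _ D).
Qed.

Lemma hol_near_neq0 a u : hol a u -> u a <> 0 -> near a (fun z => u z <> 0).
Proof.
  intros H H0. assert (P : (0 < Cmod (u a))%R) by (apply Cmod_gt_0; auto).
  generalize (hol_cont _ _ H _ P). apply near_imp. intros z Hz E. rewrite E in Hz.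
  replace (0 - u a) with (- u a) in Hz by ring. rewrite Cmod_opp in Hz. lra.
Qed.

Lemma hol_eq a u v : hol a u -> hol a v -> near' a (fun z => u z = v z) -> u a = v a.
Proof.
  intros H K E. destruct (Ceq_dec (u a) (v a)) as [|N]; auto. exfalso.
  assert (X : hol a (fun z => u z - v z)) by (apply hol_minus; auto).
  apply hol_near_neq0 in X. 2: { apply Csub_neq, N. }
  apply near_near' in X. generalize (near'_and E X). intros Y.
  apply (near'_False a). revert Y. apply near'_imp. intros z _ [e x]. apply x. rewrite e. ring.
Qed.

Lemma hol_zero a u : hol a u -> near' a (fun z => u z = 0) -> u a = 0.
Proof. intros H E. apply (hol_eq a u (fun _ => 0)); auto. apply hol_const. Qed.

Lemma Cser_geom (x : C) : (Cmod x <= 1 / 2)%R -> Cser (fun k => x ^ k) (/ (1 - x)).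
Proof.
  intros H.
  assert (N : 1 - x <> 0).
  { intros E. assert (E1 : x = 1) by (replace x with (1 - (1 - x)) by ring; rewrite E; ring).
    rewrite E1, Cmod_1 in H. lra. }
  destruct (Cser_dom (fun k => x ^ k) 1) as [s [Hs _]].
  - intros k. rewrite Cmod_pow, Rmult_1_l. apply pow_incr. split; auto using Cmod_ge_0.
  - apply Cser_eq with (l := s); auto.
    pose proof (Cser_shift _ _ Hs) as S1. cbv beta in S1.
    pose proof (Cser_scal x _ _ Hs) as S2.
    assert (E : s - x ^ 0 = x * s).
    { eapply Cser_unique. exact S1. revert S2. apply Cser_ext. reflexivity. }
    simpl in E. assert (E2 : s * (1 - x) = 1) by (replace (s * (1 - x)) with (s - 1 - x * s + 1) by ring; rewrite E; ring).
    replace s with (s * (1 - x) / (1 - x)) by (field; auto). rewrite E2. field. auto.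
Qed.

Lemma Cser_inv (a w z : C) : w <> a -> (2 * Cmod (z - a) <= Cmod (w - a))%R ->
  Cser (fun k => - (/ (w - a)) ^ S k * (z - a) ^ k) (1 / (z - w)).
Proof.
  intros Hne H. apply Csub_neq in Hne. pose proof (proj1 (Cmod_gt_0 _) Hne) as P.
  assert (Q : (Cmod ((z - a) / (w - a)) <= 1 / 2)%R).
  { rewrite Cmod_div by auto. apply Rmult_le_reg_r with (Cmod (w - a)); auto.
    unfold Rdiv. rewrite Rmult_assoc, Rinv_l by lra. lra. }
  assert (Hzw : z - w <> 0).
  { intros E. assert (z - a = w - a) by (replace (z - a) with (z - w + (w - a)) by ring; rewrite E; ring).
    rewrite H0 in H. lra. }
  pose proof (Cser_scal (- / (w - a)) _ _ (Cser_geom _ Q)) as S.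
  eapply Cser_eq; [|eapply Cser_ext; [|exact S]].
  - change (- / (w - a) * / (1 - (z - a) / (w - a)) = 1 / (z - w)). field.
    repeat split; auto. replace (w - a - (z - a)) with (- (z - w)) by ring.
    intros E. apply Hzw. replace (z - w) with (- - (z - w)) by ring. rewrite E. ring.
  - intros k. unfold Cdiv. rewrite Cpow_mult_l. simpl. 
    change (- / (w - a) * ((z - a) ^ k * (/ (w - a)) ^ k) = - (/ (w - a) * (/ (w - a)) ^ k) * (z - a) ^ k). ring.
Qed.

Lemma hol_inv_sub a w : w <> a -> hol a (fun z => 1 / (z - w)).
Proof.
  intros Hne. exists (fun k => - (/ (w - a)) ^ S k). apply near_iff.
  assert (P : (0 < Cmod (w - a))%R) by (apply Cmod_gt_0, Csub_neq, Hne).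
  exists (Cmod (w - a) / 2)%R. split; [lra|]. intros z Hz. apply (proj2 (is_pseries_C _ _ _)), Cser_inv; auto. lra.
Qed.

(** * Meromorphic germs *)

Lemma mero_iff (f : C -> C) (a : C) : meromorphic_at f a <->
  exists n v, hol a v /\ near' a (fun z => (z - a) ^ n * f z = v z).
Proof.
  split.
  - intros [n [c H]].
    exists n, (fun z => if Ceq_dec z a then c 0%nat else (z - a) ^ n * f z). split.
    + exists c. revert H. apply near_imp. intros z H. destruct (Ceq_dec z a) as [->|N].
      * apply is_pseries_C. replace (a - a) with (RtoC 0) by ring.
        apply Cser_eq with (l := c 0%nat * 0 ^ 0). simpl; ring.
        apply (Cser_head (fun k => c k * 0 ^ k)). intros k. simpl. ring.
      * apply H, N.
    + apply near'_all. intros z N. destruct (Ceq_dec z a); [contradiction|reflexivity].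
  - intros [n [v [[c Hv] E]]]. exists n, c.
    apply (near'_imp2 E (near_near' Hv)). intros z _ e h. rewrite e. exact h.
Qed.

Lemma mero_ext (f g : C -> C) (a : C) : near' a (fun z => f z = g z) -> meromorphic_at f a -> meromorphic_at g a.
Proof.
  intros H K. apply mero_iff in K. destruct K as [n [v [Hv E]]]. apply mero_iff. exists n, v.
  split; auto. apply (near'_imp2 H E). intros z _ <- e. exact e.
Qed.

Definition removable (a : C) (f : C -> C) : Prop :=
  exists v, hol a v /\ near' a (fun z => f z = v z).

Lemma hol_removable a f : hol a f -> removable a f.
Proof. intros H. exists f. split; auto. apply filter_forall. intros; reflexivity. Qed.

(** Cancel the common power of [z - a]: either no pole remains or the order of the pole
    is exact. *)
Lemma mero_cases (f : C -> C) (a : C) : meromorphic_at f a ->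
  removable a f \/
  exists j v, hol a v /\ v a <> 0 /\ near' a (fun z => (z - a) ^ S j * f z = v z).
Proof.
  intros H. apply mero_iff in H. destruct H as [n [v [Hv E]]].
  destruct (hol_dichotomy _ _ Hv) as [Z|[m [w [Hw [W0 Ew]]]]].
  - left. exists (fun _ => 0). split. analytic.
    apply (near'_imp2 E (near_near' Z)). intros z N e1 e2.
    rewrite e2 in e1. destruct (Ceq_dec (f z) 0) as [|F]; auto. exfalso. revert e1.
    apply Cmult_neq_0; auto. apply Cpow_nz, Csub_neq, N.
  - pose proof (near'_and E (near_near' Ew)) as EE.
    destruct (le_lt_dec n m) as [h|h].
    + left. exists (fun z => (z - a) ^ (m - n) * w z). split.
      { analytic. }
      revert EE. apply near'_imp. intros z N [e1 e2]. rewrite e2 in e1.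
      apply Csub_neq in N. pose proof (Cpow_nz (z - a) n N) as Nn.
      assert (X : (z - a) ^ n * f z = (z - a) ^ n * ((z - a) ^ (m - n) * w z)).
      { rewrite e1, Cmult_assoc, <- Cpow_add_r. do 2 f_equal. lia. }
      replace (f z) with (/ (z - a) ^ n * ((z - a) ^ n * f z)) by (field; auto).
      rewrite X. field. auto.
    + right. exists (n - m - 1)%nat, w. split; auto. split; auto.
      revert EE. apply near'_imp. intros z N [e1 e2]. rewrite e2 in e1.
      apply Csub_neq in N. pose proof (Cpow_nz (z - a) m N) as Nn.
      replace n with (m + S (n - m - 1))%nat in e1 by lia.
      rewrite Cpow_add_r in e1.
      replace (w z) with (/ (z - a) ^ m * ((z - a) ^ m * w z)) by (field; auto).
      rewrite <- e1. field. auto.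
Qed.

Lemma removable_mero a f : removable a f -> meromorphic_at f a.
Proof.
  intros [v [Hv E]]. apply mero_iff. exists 0%nat, v. split; auto.
  revert E. apply near'_imp. intros z _ <-. simpl. ring.
Qed.

Lemma mero_plus (f g : C -> C) (a : C) : meromorphic_at f a -> meromorphic_at g a -> meromorphic_at (fun z => f z + g z) a.
Proof.
  intros H K. apply mero_iff in H. apply mero_iff in K.
  destruct H as [n [v [Hv E]]]. destruct K as [m [w [Hw F]]]. apply mero_iff.
  exists (n + m)%nat, (fun z => (z - a) ^ m * v z + (z - a) ^ n * w z). split.
  - analytic.
    + analytic.
    + analytic.
  - apply (near'_imp2 E F). intros z _ <- <-.
    rewrite Cpow_add_r. ring.
Qed.

Lemma mero_mult (f g : C -> C) (a : C) : meromorphic_at f a -> meromorphic_at g a -> meromorphic_at (fun z => f z * g z) a.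
Proof.
  intros H K. apply mero_iff in H. apply mero_iff in K.
  destruct H as [n [v [Hv E]]]. destruct K as [m [w [Hw F]]]. apply mero_iff.
  exists (n + m)%nat, (fun z => v z * w z). split.
  - analytic.
  - apply (near'_imp2 E F). intros z _ <- <-.
    rewrite Cpow_add_r. ring.
Qed.

Lemma mero_const c a : meromorphic_at (fun _ => c) a.
Proof. apply removable_mero, hol_removable, hol_const. Qed.

Lemma mero_scal c f a : meromorphic_at f a -> meromorphic_at (fun z => c * f z) a.
Proof. intros H. apply (mero_mult (fun _ => c) f); auto. apply mero_const. Qed.

Lemma mero_dichotomy (f : C -> C) (a : C) : meromorphic_at f a ->
  near' a (fun z => f z = 0) \/ near' a (fun z => f z <> 0).
Proof.
  intros H. apply mero_iff in H. destruct H as [n [v [Hv E]]].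
  destruct (hol_dichotomy _ _ Hv) as [Z|[m [w [Hw [W0 Ew]]]]].
  - left. apply (near'_imp2 E (near_near' Z)). intros z N e1 e2.
    rewrite e2 in e1. destruct (Ceq_dec (f z) 0) as [|F]; auto. exfalso. revert e1.
    apply Cmult_neq_0; auto. apply Cpow_nz, Csub_neq, N.
  - right. pose proof (hol_near_neq0 _ _ Hw W0) as Wn.
    apply (near'_imp2 E (near_near' (near_and Ew Wn))). intros z N e1 [e2 e3] F. rewrite F, e2 in e1.
    assert (X : (z - a) ^ m * w z <> 0).
    { apply Cmult_neq_0; auto. apply Cpow_nz, Csub_neq, N. }
    apply X. rewrite <- e1. ring.
Qed.

(** * The identity theorem *)

(** A locally constant predicate on the line is constant: otherwise its indicator
    would be a continuous function without the value 1/2. *)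
Lemma seg_connected (W : R -> Prop) :
  (forall t, exists d : R, (0 < d)%R /\ forall t', (Rabs (t' - t) < d)%R -> (W t' <-> W t)) ->
  W 0%R -> W 1%R.
Proof.
  intros H H0. apply NNPP. intros H1.
  set (f := fun t => if excluded_middle_informative (W t) then 1%R else 0%R).
  assert (Hf : continuity f).
  { intros t. intros eps He. destruct (H t) as [d [Hd Hd']]. exists d. split; auto.
    intros t' [_ Ht']. simpl in *. unfold R_dist in *. specialize (Hd' t' Ht').
    replace (f t') with (f t). rewrite Rminus_diag, Rabs_R0. exact He.
    unfold f. destruct (excluded_middle_informative (W t)), (excluded_middle_informative (W t')); tauto. }
  assert (f0 : f 0%R = 1%R) by (unfold f; destruct (excluded_middle_informative (W 0%R)); tauto).
  assert (f1 : f 1%R = 0%R) by (unfold f; destruct (excluded_middle_informative (W 1%R)); tauto).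
  destruct (IVT_gen f 0 1 (1/2)%R Hf) as [x [_ Hx]].
  { rewrite f0, f1. unfold Rmin, Rmax. destruct (Rle_dec 1 0); lra. }
  unfold f in Hx. destruct (excluded_middle_informative (W x)); lra.
Qed.

(** By [mero_dichotomy], vanishing near a point is a locally constant property along
    the segment from [a0] to [a]. *)
Lemma identity_thm (f : C -> C) (a0 : C) : meromorphic f -> near' a0 (fun z => f z = 0) ->
  forall a : C, near' a (fun z => f z = 0).
Proof.
  intros Hf H0 a.
  set (p := fun t : R => a0 + RtoC t * (a - a0)).
  assert (X : near' (p 1%R) (fun z => f z = 0)).
  { apply (seg_connected (fun t => near' (p t) (fun z => f z = 0))).
    - intros t.
      assert (P : exists d : R, (0 < d)%R /\ forall t', (Rabs (t' - t) < d)%R -> t' <> t -> a <> a0 ->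
         (near' (p t') (fun z => f z = 0) <-> near' (p t) (fun z => f z = 0))).
      { assert (Q : near' (p t) (fun z => near' z (fun z => f z = 0) <-> near' (p t) (fun z => f z = 0))).
        { destruct (mero_dichotomy f (p t) (Hf _)) as [K|K].
          - pose proof (near'_near K) as K'. revert K'. apply near'_imp. intros z _ h.
            apply near_near' in h. tauto.
          - pose proof (near'_near K) as K'. revert K'. apply near'_imp. intros z _ h.
            apply near_near' in h. split; intros U.
            + exfalso. apply (near'_False z). generalize (near'_and h U). apply near'_imp. tauto.
            + exfalso. apply (near'_False (p t)). generalize (near'_and K U). apply near'_imp. tauto. }
        apply near'_iff in Q. destruct Q as [d [Hd Q]].
        exists (d / (1 + Cmod (a - a0)))%R. pose proof (Cmod_ge_0 (a - a0)).
        split. { apply Rdiv_lt_0_compat; lra. }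
        intros t' Ht' Hne Ha. apply Q.
        - replace (p t' - p t) with (RtoC (t' - t) * (a - a0)) by (unfold p; rewrite RtoC_minus; ring).
          rewrite Cmod_mult, Cmod_R.
          apply Rmult_lt_compat_r with (r := (1 + Cmod (a - a0))%R) in Ht'; [|lra].
          unfold Rdiv in Ht'. rewrite Rmult_assoc, Rinv_l, Rmult_1_r in Ht' by lra.
          pose proof (Rabs_pos (t' - t)). lra.
        - intros E. assert (Z : RtoC (t' - t) * (a - a0) = 0).
          { replace (RtoC (t' - t) * (a - a0)) with (p t' - p t) by (unfold p; rewrite RtoC_minus; ring).
            rewrite E. ring. }
          revert Z. apply Cmult_neq_0. intros Z. apply RtoC_inj in Z. lra. apply Csub_neq, Ha. }
      destruct P as [d [Hd P]]. exists d. split; auto. intros t' Ht'.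
      destruct (Req_dec t' t) as [->|Hne]; [tauto|].
      destruct (Ceq_dec a a0) as [->|Ha]; [|apply P; auto].
      replace (p t') with (p t) by (unfold p; ring). tauto.
    - unfold p. replace (a0 + 0%R * (a - a0)) with a0 by ring. exact H0. }
  unfold p in X. replace (a0 + 1%R * (a - a0)) with a in X by ring. exact X.
Qed.

(** * The period cell *)

Lemma tau_coords (tau z : C) : (0 < Im tau)%R -> exists x y : R, z = RtoC x + RtoC y * tau.
Proof.
  intros H. exists (Re z - Im z / Im tau * Re tau)%R, (Im z / Im tau)%R.
  destruct z as [a b], tau as [c d]. unfold Re, Im in *. simpl in *.
  unfold RtoC, Cplus, Cmult; simpl. f_equal; field; lra.
Qed.

Lemma Z_ind_iff (P : Z -> Prop) : P 0%Z -> (forall n, P n <-> P (n + 1)%Z) -> forall n, P n.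
Proof.
  intros H0 H. apply Z.bi_induction; auto. { intros x y ->. tauto. }
Qed.

Lemma IZR_split (x : R) : exists (m : Z) (s : R), (0 <= s <= 1)%R /\ x = (IZR m + s)%R.
Proof.
  exists (Int_part x), (x - IZR (Int_part x))%R.
  destruct (base_Int_part x). split; lra.
Qed.

(** Compactness of the unit square, with a gauge chosen so that [h] is at most the
    inverse of the gauge on each small square. *)
Lemma bounded_square (tau : C) (h : C -> R) :
  (forall a : C, exists B : R, near a (fun z => (h z <= B)%R)) ->
  exists B : R, forall s t : R, (0 <= s <= 1)%R -> (0 <= t <= 1)%R -> (h (RtoC s + RtoC t * tau)%C <= B)%R.
Proof.
  intros H.
  assert (EX : forall s t : R, exists d : posreal, forall u v : R, (Rabs (u - s) < d)%R -> (Rabs (v - t) < d)%R ->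
     (h (RtoC u + RtoC v * tau)%C <= / d)%R).
  { intros s t. destruct (H (RtoC s + RtoC t * tau)) as [B HB].
    apply near_iff in HB. destruct HB as [d0 [Hd0 HB]].
    pose proof (Cmod_ge_0 tau).
    set (d := Rmin (d0 / (1 + Cmod tau)) (/ (1 + Rabs B))).
    assert (Hd : (0 < d)%R).
    { apply Rmin_pos. apply Rdiv_lt_0_compat; lra. apply Rinv_0_lt_compat. pose proof (Rabs_pos B). lra. }
    exists (mkposreal d Hd). simpl. intros u v Hu Hv.
    apply Rle_trans with B.
    - apply HB. replace (RtoC u + RtoC v * tau - (RtoC s + RtoC t * tau))
        with (RtoC (u - s) + RtoC (v - t) * tau) by (rewrite !RtoC_minus; ring).
      eapply Rle_lt_trans; [apply Cmod_triangle|]. rewrite Cmod_mult, !Cmod_R.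
      assert (d * (1 + Cmod tau) <= d0)%R.
      { apply Rle_trans with (d0 / (1 + Cmod tau) * (1 + Cmod tau))%R.
        apply Rmult_le_compat_r. lra. apply Rmin_l. right. field. lra. }
      pose proof (Rabs_pos (v - t)). nra.
    - pose proof (Rabs_pos B). pose proof (Rle_abs B).
      apply Rle_trans with (1 + Rabs B)%R. lra.
      rewrite <- (Rinv_inv (1 + Rabs B)). apply Rinv_le_contravar; auto. apply Rmin_r. }
  set (delta := fun s t => proj1_sig (constructive_indefinite_description _ (EX s t))).
  destruct (compactness_value_2d 0 1 0 1 delta) as [d Hd].
  exists (/ d)%R. intros s t Hs Ht. apply NNPP. intros N.
  apply (Hd s t Hs Ht). intros [u [v [Hu [Hv [H1 [H2 H3]]]]]]. apply N.
  unfold delta in *. destruct (constructive_indefinite_description _ (EX u v)) as [e He]. simpl in *.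
  eapply Rle_trans. apply He; eauto. apply Rinv_le_contravar; auto. apply cond_pos.
Qed.

Definition cont_at_at (a : C) (u : C -> C) : Prop :=
  forall eps : R, (0 < eps)%R -> near a (fun z => (Cmod (u z - u a) < eps)%R).

Lemma cont_at_eq (a : C) (u v : C -> C) : cont_at_at a u -> cont_at_at a v -> near' a (fun z => u z = v z) -> u a = v a.
Proof.
  intros H K E. destruct (Ceq_dec (u a) (v a)) as [|N]; auto. exfalso.
  apply Csub_neq, Cmod_gt_0 in N.
  set (e := (Cmod (u a - v a) / 2)%R). assert (He : (0 < e)%R) by (unfold e; lra).
  apply (near'_False a). apply (near'_imp2 E (near_near' (near_and (H e He) (K e He)))). intros z _ e1 [h k]. rewrite e1 in h.
  assert (Cmod (u a - v a) <= Cmod (v z - v a) + Cmod (v z - u a))%R.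
  { replace (u a - v a) with ((v z - v a) + - (v z - u a)) by ring.
    rewrite <- (Cmod_opp (v z - u a)). apply Cmod_triangle. }
  unfold e in *. lra.
Qed.

(** The regular value at each point defines the extension; near [a] it agrees with the
    germ at [a] because germs are continuous. *)
Lemma entire_version f : (forall a, removable a f) -> exists g, (forall a, hol a g) /\ mer_eq f g.
Proof.
  intros H.
  set (v := fun a => proj1_sig (constructive_indefinite_description _ (H a))).
  assert (Hv : forall a, hol a (v a) /\ near' a (fun z => f z = v a z)).
  { intros a. unfold v. destruct (constructive_indefinite_description _ (H a)) as [w Hw]. exact Hw. }
  assert (E : forall a, near a (fun z => v z z = v a z)).
  { intros a. destruct (Hv a) as [h e].
    destruct (hol_der _ _ h) as [v' [_ D]].
    assert (X : near' a (fun z => v z z = v a z)).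
    { apply (near'_imp2 (near'_near e) (near_near' D)). intros z _ e1 d. destruct (Hv z) as [hz ez]. apply cont_at_eq.
      - exact (hol_cont _ _ hz).
      - exact (der_cont _ _ _ d).
      - apply (near'_imp2 ez (near_near' e1)). intros y _ <- <-. reflexivity. }
    apply near'_iff in X. destruct X as [d [Hd X]]. apply near_iff. exists d. split; auto.
    intros z Hz. destruct (Ceq_dec z a) as [->|N]; auto. }
  exists (fun a => v a a). split.
  - intros a. apply hol_ext with (u := v a). { generalize (E a). apply near_imp. intros z ->. reflexivity. }
    apply Hv.
  - intros a. apply (near'_imp2 (proj2 (Hv a)) (near_near' (E a))). intros z _ -> <-. reflexivity.
Qed.

(** * The maximum principle and Liouville's theorem *)

Definition cis (t : R) : C := (cos t, sin t).
Lemma cis_pow t n : cis t ^ n = cis (INR n * t).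
Proof.
  induction n as [|n IH].
  - simpl. unfold cis. rewrite Rmult_0_l, cos_0, sin_0. reflexivity.
  - simpl Cpow. rewrite IH. rewrite S_INR.
    replace ((INR n + 1) * t)%R with (t + INR n * t)%R by ring.
    unfold cis. rewrite cos_plus, sin_plus. unfold Cmult; simpl. f_equal; ring.
Qed.
Lemma Cmod_cis t : Cmod (cis t) = 1%R.
Proof.
  unfold Cmod, cis. simpl fst. simpl snd. transitivity (sqrt 1); [f_equal|apply sqrt_1].
  pose proof (sin2_cos2 t). unfold Rsqr in H. lra.
Qed.

(** Among the directions on which [e ^ (n + 1)] is one of 1, -1, i, -i, one turns [w]
    towards the positive real axis. *)
Lemma good_direction (n : nat) (w : C) : w <> 0 ->
  exists e, Cmod e = 1%R /\ (Cmod w / 2 <= Re (e ^ S n * w))%R.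
Proof.
  intros Hw.
  assert (Hn : INR (S n) <> 0%R) by (apply not_0_INR; lia).
  assert (X : forall phi, exists e, Cmod e = 1%R /\ e ^ S n = cis phi).
  { intros phi. exists (cis (phi / INR (S n))). split. apply Cmod_cis.
    rewrite cis_pow. f_equal. field. auto. }
  assert (Y : forall phi, (Cmod w / 2 <= Re (cis phi * w))%R -> exists e, Cmod e = 1%R /\ (Cmod w / 2 <= Re (e ^ S n * w))%R).
  { intros phi h. destruct (X phi) as [e [He1 He2]]. exists e. split; auto. rewrite He2. exact h. }
  pose proof (Cmod_le_sum w) as S.
  destruct w as [x y]. unfold Re, Im in *. simpl fst in *. simpl snd in *.
  destruct (Rle_dec (Cmod (x, y) / 2) x) as [|n1].
  { apply (Y 0%R). unfold cis. rewrite cos_0, sin_0. simpl. lra. }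
  destruct (Rle_dec (Cmod (x, y) / 2) (- x)) as [|n2].
  { apply (Y PI). unfold cis. rewrite cos_PI, sin_PI. simpl. lra. }
  destruct (Rle_dec (Cmod (x, y) / 2) y) as [|n3].
  { apply (Y (- (PI / 2))%R). unfold cis. rewrite cos_neg, sin_neg, cos_PI2, sin_PI2. simpl. lra. }
  destruct (Rle_dec (Cmod (x, y) / 2) (- y)) as [|n4].
  { apply (Y (PI / 2)%R). unfold cis. rewrite cos_PI2, sin_PI2. simpl. lra. }
  exfalso. revert S. unfold Rabs. destruct (Rcase_abs x), (Rcase_abs y); lra.
Qed.

(** If [u = u a + (z - a) ^ n * v] with [n > 0], [v a <> 0] and [u a <> 0], moving from [a] in
    the direction of [good_direction] increases the modulus to first order in [(z - a) ^ n]. *)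
Lemma max_principle (a : C) (u : C -> C) : hol a u -> near a (fun z => (Cmod (u z) <= Cmod (u a))%R) ->
  near a (fun z => u z = u a).
Proof.
  intros H Hmax.
  assert (Hd : hol a (fun z => u z - u a)) by analytic.
  destruct (hol_dichotomy _ _ Hd) as [Z|[n [v [Hv [V0 E]]]]].
  { revert Z. apply near_imp. intros z e. replace (u z) with (u z - u a + u a) by ring. rewrite e. ring. }
  exfalso.
  destruct n as [|n].
  { apply near_center in E. apply V0. simpl in E. replace (v a) with (1 * v a) by ring. rewrite <- E. ring. }
  destruct (Ceq_dec (u a) 0) as [U0|U0].
  - apply (near'_False a). pose proof (hol_near_neq0 _ _ Hv V0) as Vn.
    generalize (near_near' (near_and Hmax (near_and E Vn))). apply near'_imp.
    intros z N [h [e vn]]. rewrite U0, Cmod_0 in h. 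
    assert (Z : u z = 0). { apply Cmod_eq_0. pose proof (Cmod_ge_0 (u z)). lra. }
    rewrite Z, U0 in e.
    assert (X : (z - a) ^ S n * v z <> 0).
    { apply Cmult_neq_0; auto. apply Cpow_nz, Csub_neq, N. }
    apply X. rewrite <- e. ring.
  - set (c0 := u a) in *. set (w := v a / c0).
    assert (W0 : w <> 0). { unfold w. intros Ew. apply V0. replace (v a) with (v a / c0 * c0) by (field; auto). rewrite Ew. ring. }
    destruct (good_direction n w W0) as [e [He1 He2]].
    assert (Wp : (0 < Cmod w)%R) by (apply Cmod_gt_0; auto).
    assert (Cp : (0 < Cmod c0)%R) by (apply Cmod_gt_0; auto).
    pose proof (hol_cont _ _ Hv (Cmod w * Cmod c0 / 4)%R ltac:(nra)) as Vc.
    pose proof (near_and Hmax (near_and E Vc)) as A.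
    apply near_iff in A. destruct A as [d [Hdp A]].
    set (z := a + RtoC (d / 2) * e).
    assert (Ez : z - a = RtoC (d / 2) * e) by (unfold z; ring).
    specialize (A z). rewrite Ez, Cmod_mult, Cmod_R, He1, Rabs_pos_eq in A by lra.
    specialize (A ltac:(lra)). destruct A as [h [e1 vc]].
    set (r := (d / 2)%R) in *.
    assert (Rp : (0 < r ^ S n)%R) by (apply pow_lt; unfold r; lra).
    assert (Eu : u z / c0 = 1 + RtoC (r ^ S n) * (e ^ S n * w + e ^ S n * ((v z - v a) / c0))).
    { replace (u z) with (c0 + (u z - c0)) by ring. rewrite e1, Cpow_mult_l, <- RtoC_pow. unfold w. field. auto. }
    assert (L1 : (Cmod (u z / c0) <= 1)%R).
    { rewrite Cmod_div by auto. apply Rmult_le_reg_r with (Cmod c0); auto.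
      unfold Rdiv. rewrite Rmult_assoc, Rinv_l by lra. lra. }
    assert (L2 : (Cmod (e ^ S n * ((v z - v a) / c0)) <= Cmod w / 4)%R).
    { rewrite Cmod_mult, Cmod_pow, He1, pow1, Rmult_1_l, Cmod_div by auto.
      apply Rmult_le_reg_r with (Cmod c0); auto. unfold Rdiv. rewrite Rmult_assoc, Rinv_l by lra. lra. }
    set (t := e ^ S n * ((v z - v a) / c0)) in *. set (y := e ^ S n * w) in *.
    pose proof (re_le_Cmod (u z / c0)) as R1. rewrite Eu in R1 at 1.
    pose proof (re_le_Cmod t) as R2.
    assert (R3 : Re (1 + RtoC (r ^ S n) * (y + t)) = (1 + r ^ S n * (Re y + Re t))%R).
    { unfold Re, RtoC, Cplus, Cmult; simpl. ring. }
    rewrite R3 in R1. pose proof (Rle_abs (1 + r ^ S n * (Re y + Re t))).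
    pose proof (Rle_abs (- Re t)). rewrite Rabs_Ropp in H1.
    assert (0 < r ^ S n * (Re y + Re t))%R by (apply Rmult_lt_0_compat; auto; lra).
    lra.
Qed.

Lemma periodic_lattice {A} (tau : C) (g : C -> A) :
  (forall z, g (z + 1) = g z) -> (forall z, g (z + tau) = g z) ->
  forall m n z, g (z + lattice_point tau m n) = g z.
Proof.
  intros H1 Ht m n.
  assert (X : forall w, (forall z, g (z + w) = g z) -> forall k z, g (z + RtoC (IZR k) * w) = g z).
  { intros w Hw k. pattern k. apply Z_ind_iff.
    - intros z. f_equal. ring.
    - intros k'. split; intros I z.
      + rewrite plus_IZR, RtoC_plus. replace (z + (RtoC (IZR k') + 1) * w) with (z + RtoC (IZR k') * w + w) by ring.
        rewrite Hw. apply I.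
      + rewrite <- (I z). rewrite plus_IZR, RtoC_plus.
        replace (z + (RtoC (IZR k') + 1) * w) with (z + RtoC (IZR k') * w + w) by ring.
        rewrite Hw. reflexivity. }
  intros z. unfold lattice_point.
  replace (z + (RtoC (IZR m) + RtoC (IZR n) * tau)) with (z + RtoC (IZR m) * 1 + RtoC (IZR n) * tau) by ring.
  rewrite (X tau Ht), (X 1 H1). reflexivity.
Qed.

(** Periodicity and compactness give the modulus a supremum, which is attained (else
    [/ (S - |g|)] would be unbounded on the period cell).  At a maximum the function is
    locally constant, hence constant by the identity theorem. *)
Lemma liouville (tau : C) (f : C -> C) : (0 < Im tau)%R ->
  (forall a, removable a f) ->
  mer_eq (fun z => f (z + 1)) f -> mer_eq (fun z => f (z + tau)) f ->
  exists c, mer_eq f (fun _ => c).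
Proof.
  intros Htau Hf H1 Ht.
  destruct (entire_version f Hf) as [g [Hg E]].
  assert (Per : forall w, mer_eq (fun z => f (z + w)) f -> forall z, g (z + w) = g z).
  { intros w Hw a. apply (hol_eq a _ _ (hol_translate a w g (Hg _)) (Hg a)).
    apply (near'_imp3 (near'_translate _ _ _ (E (a + w))) (Hw a) (E a)). intros z _ e1 e2 e3. congruence. }
  pose proof (periodic_lattice tau g (Per _ H1) (Per _ Ht)) as PL.
  assert (Red : forall h : C -> R, (forall a : C, exists B : R, near a (fun z => (h (g z) <= B)%R)) ->
     exists B, forall z, (h (g z) <= B)%R).
  { intros h Hh. destruct (bounded_square tau (fun z => h (g z)) Hh) as [B HB]. exists B. intros z.
    destruct (tau_coords tau z Htau) as [x [y Ez]].
    destruct (IZR_split x) as [m [s [Hs Ex]]]. destruct (IZR_split y) as [n [t [Ht' Ey]]].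
    replace z with (RtoC s + RtoC t * tau + lattice_point tau m n).
    - rewrite PL. apply HB; auto.
    - rewrite Ez, Ex, Ey, !RtoC_plus. unfold lattice_point. ring. }
  destruct (Red Cmod) as [B HB].
  { intros a. exists (Cmod (g a) + 1)%R. generalize (hol_cont _ _ (Hg a) 1%R ltac:(lra)). apply near_imp.
    intros z Hz. replace (g z) with (g a + (g z - g a)) by ring.
    eapply Rle_trans; [apply Cmod_triangle|]. lra. }
  destruct (completeness (fun r => exists z, r = Cmod (g z))) as [S [S1 S2]].
  { exists B. intros r [z ->]. apply HB. }
  { exists (Cmod (g 0)). exists 0. reflexivity. }
  assert (M : exists z0, forall z, (Cmod (g z) <= Cmod (g z0))%R).
  { apply NNPP. intros N.
    assert (L : forall z, (Cmod (g z) < S)%R).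
    { intros z. destruct (Rle_lt_or_eq_dec (Cmod (g z)) S) as [|e]; auto. { apply S1. exists z; auto. }
      exfalso. apply N. exists z. intros y. rewrite e. apply S1. exists y; auto. }
    destruct (Red (fun c => / (S - Cmod c))%R) as [K HK].
    { intros a. specialize (L a). set (e := ((S - Cmod (g a)) / 2)%R).
      assert (He : (0 < e)%R) by (unfold e; lra).
      exists (/ e)%R. generalize (hol_cont _ _ (Hg a) e He). apply near_imp.
      intros z Hz. apply Rinv_le_contravar; auto.
      assert (Cmod (g z) <= Cmod (g a) + Cmod (g z - g a))%R.
      { replace (g z) with (g a + (g z - g a)) at 1 by ring. apply Cmod_triangle. }
      unfold e in *. lra. }
    assert (K0 : (0 < K)%R).
    { eapply Rlt_le_trans; [|apply (HK 0)]. apply Rinv_0_lt_compat. specialize (L 0). lra. }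
    assert (S <= S - / K)%R.
    { apply S2. intros r [z ->]. specialize (HK z). specialize (L z).
      assert (/ K <= S - Cmod (g z))%R.
      { rewrite <- (Rinv_inv (S - Cmod (g z))). apply Rinv_le_contravar; auto. apply Rinv_0_lt_compat; lra. }
      lra. }
    assert (0 < / K)%R by (apply Rinv_0_lt_compat; auto). lra. }
  destruct M as [z0 M]. exists (g z0).
  assert (Z : near z0 (fun z => g z = g z0)).
  { apply max_principle; auto. apply filter_forall. auto. }
  intros a. 
  assert (Mg : meromorphic (fun z => g z - g z0)).
  { intros b. apply removable_mero, hol_removable. analytic. }
  apply (near'_imp2 (E a) (identity_thm _ z0 Mg (near_near' (near_imp _ _ _ (fun z (e : g z = g z0) => eq_ind_r (fun t => t - g z0 = 0) (Cplus_opp_r (g z0)) e) Z)) a)). intros z _ e1 e2. rewrite e1.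
  replace (g z) with (g z - g z0 + g z0) by ring. rewrite e2. ring.
Qed.

(** * Sums over boxes of lattice points *)

Lemma psum_first (a : nat -> C) n : psum a (S n) = a 0%nat + psum (fun k => a (S k)) n.
Proof. induction n. now rewrite psum_S, !psum_O. rewrite psum_S, IHn, psum_S. ring. Qed.

Lemma psum_ext (a b : nat -> C) n : (forall k, a k = b k) -> psum a n = psum b n.
Proof. intros H. induction n. now rewrite !psum_O. now rewrite !psum_S, IHn, H. Qed.

Definition rsum (a : nat -> R) (n : nat) : R := sum_n a n.
Lemma rsum_O a : rsum a 0 = a 0%nat.
Proof. apply sum_O. Qed.
Lemma rsum_S a n : rsum a (S n) = (rsum a n + a (S n))%R.
Proof. exact (sum_Sn (G := R_AbelianMonoid) a n). Qed.
Lemma rsum_first a n : rsum a (S n) = (a 0%nat + rsum (fun k => a (S k)) n)%R.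
Proof. induction n. now rewrite rsum_S, !rsum_O. rewrite rsum_S, IHn, rsum_S. ring. Qed.
Lemma rsum_ext a b n : (forall k, a k = b k) -> rsum a n = rsum b n.
Proof. intros H. induction n. now rewrite !rsum_O. now rewrite !rsum_S, IHn, H. Qed.

Definition zsum (N : nat) (f : Z -> C) : C := psum (fun j => f (Z.of_nat j - Z.of_nat N)%Z) (2 * N).
Definition zsumR (N : nat) (f : Z -> R) : R := rsum (fun j => f (Z.of_nat j - Z.of_nat N)%Z) (2 * N).

Lemma zsum_O f : zsum 0 f = f 0%Z.
Proof. unfold zsum. simpl. rewrite psum_O. reflexivity. Qed.
Lemma zsumR_O f : zsumR 0 f = f 0%Z.
Proof. unfold zsumR. simpl. rewrite rsum_O. reflexivity. Qed.

Lemma zsum_S N f : zsum (S N) f = f (- Z.of_nat (S N))%Z + zsum N f + f (Z.of_nat (S N)).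
Proof.
  unfold zsum. replace (2 * S N)%nat with (S (S (2 * N))) by lia. rewrite psum_S, psum_first.
  replace (Z.of_nat 0 - Z.of_nat (S N))%Z with (- Z.of_nat (S N))%Z by lia.
  replace (Z.of_nat (S (S (2 * N))) - Z.of_nat (S N))%Z with (Z.of_nat (S N)) by lia.
  do 2 f_equal. apply psum_ext. intros k. f_equal. lia.
Qed.
Lemma zsumR_S N f : zsumR (S N) f = (f (- Z.of_nat (S N))%Z + zsumR N f + f (Z.of_nat (S N)))%R.
Proof.
  unfold zsumR. replace (2 * S N)%nat with (S (S (2 * N))) by lia. rewrite rsum_S, rsum_first.
  replace (Z.of_nat 0 - Z.of_nat (S N))%Z with (- Z.of_nat (S N))%Z by lia.
  replace (Z.of_nat (S (S (2 * N))) - Z.of_nat (S N))%Z with (Z.of_nat (S N)) by lia.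
  do 2 f_equal. apply rsum_ext. intros k. f_equal. lia.
Qed.

Lemma zsum_ext N f g : (forall m, f m = g m) -> zsum N f = zsum N g.
Proof. intros H. apply psum_ext. intros; apply H. Qed.
Lemma zsum_plus N f g : zsum N (fun m => f m + g m) = zsum N f + zsum N g.
Proof. induction N. now rewrite !zsum_O. rewrite !zsum_S, IHN. ring. Qed.
Lemma zsum_scal N c f : zsum N (fun m => c * f m) = c * zsum N f.
Proof. induction N. now rewrite !zsum_O. rewrite !zsum_S, IHN. ring. Qed.
Lemma zsum_0 N : zsum N (fun _ => 0) = 0.
Proof. induction N. now rewrite !zsum_O. rewrite !zsum_S, IHN. ring. Qed.
Lemma zsum_neg N f : zsum N (fun m => f (- m)%Z) = zsum N f.
Proof. induction N. now rewrite !zsum_O. rewrite !zsum_S, IHN, Z.opp_involutive. ring. Qed.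
Lemma zsum_shift N f : zsum N (fun m => f (m - 1)%Z) = zsum N f + f (- Z.of_nat N - 1)%Z - f (Z.of_nat N).
Proof.
  induction N. { rewrite !zsum_O. simpl. ring. }
  rewrite !zsum_S, IHN. replace (- Z.of_nat N - 1)%Z with (- Z.of_nat (S N))%Z by lia.
  replace (Z.of_nat (S N) - 1)%Z with (Z.of_nat N) by lia. ring.
Qed.
Lemma zsum_switch N M f : zsum N (fun m => zsum M (fun n => f m n)) = zsum M (fun n => zsum N (fun m => f m n)).
Proof.
  induction N. { rewrite zsum_O. apply zsum_ext. intros. now rewrite zsum_O. }
  rewrite zsum_S, IHN. 
  rewrite (zsum_ext M (fun n => zsum (S N) (fun m => f m n))
     (fun n => f (- Z.of_nat (S N))%Z n + zsum N (fun m => f m n) + f (Z.of_nat (S N)) n))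
    by (intros; apply zsum_S).
  rewrite !zsum_plus. reflexivity.
Qed.
Lemma zsumR_le N f g : (forall m, f m <= g m)%R -> (zsumR N f <= zsumR N g)%R.
Proof.
  intros H. induction N. rewrite !zsumR_O; auto. rewrite !zsumR_S.
  pose proof (H (- Z.of_nat (S N))%Z). pose proof (H (Z.of_nat (S N))). lra.
Qed.
Lemma Cmod_zsum N f g : (forall m, Cmod (f m) <= g m)%R -> (Cmod (zsum N f) <= zsumR N g)%R.
Proof.
  intros H. induction N. rewrite zsum_O, zsumR_O; auto. rewrite zsum_S, zsumR_S.
  eapply Rle_trans; [apply Cmod_triangle|]. apply Rplus_le_compat; auto.
  eapply Rle_trans; [apply Cmod_triangle|]. apply Rplus_le_compat; auto.
Qed.
Lemma zsumR_const N c : zsumR N (fun _ => c) = ((2 * INR N + 1) * c)%R.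
Proof. induction N. rewrite zsumR_O. simpl. ring. rewrite zsumR_S, IHN, S_INR. ring. Qed.
Lemma zsumR_plus N f g : zsumR N (fun m => f m + g m)%R = (zsumR N f + zsumR N g)%R.
Proof. induction N. now rewrite !zsumR_O. rewrite !zsumR_S, IHN. ring. Qed.
Lemma zsumR_scal N c f : zsumR N (fun m => c * f m)%R = (c * zsumR N f)%R.
Proof. induction N. now rewrite !zsumR_O. rewrite !zsumR_S, IHN. ring. Qed.
Lemma zsumR_ext N f g : (forall m, f m = g m) -> zsumR N f = zsumR N g.
Proof. intros H. apply rsum_ext. intros; apply H. Qed.
Lemma zsumR_pos N f : (forall m, 0 <= f m)%R -> (0 <= zsumR N f)%R.
Proof.
  intros H. induction N. rewrite zsumR_O; auto. rewrite zsumR_S.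
  pose proof (H (- Z.of_nat (S N))%Z). pose proof (H (Z.of_nat (S N))). lra.
Qed.

Definition box_sum (N : nat) (f : Z -> Z -> C) : C := zsum N (fun m => zsum N (fun n => f m n)).
Definition box_sumR (N : nat) (f : Z -> Z -> R) : R := zsumR N (fun m => zsumR N (fun n => f m n)).

Lemma box_sum_ext N f g : (forall m n, f m n = g m n) -> box_sum N f = box_sum N g.
Proof. intros H. apply zsum_ext. intros. apply zsum_ext. intros. apply H. Qed.
Lemma box_sum_plus N f g : box_sum N (fun m n => f m n + g m n) = box_sum N f + box_sum N g.
Proof. unfold box_sum. rewrite <- zsum_plus. apply zsum_ext. intros. apply zsum_plus. Qed.
Lemma box_sum_scal N c f : box_sum N (fun m n => c * f m n) = c * box_sum N f.
Proof. unfold box_sum. rewrite <- zsum_scal. apply zsum_ext. intros. apply zsum_scal. Qed.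
Lemma box_sumR_scal N c f : box_sumR N (fun m n => c * f m n)%R = (c * box_sumR N f)%R.
Proof. unfold box_sumR. rewrite <- zsumR_scal. apply zsumR_ext. intros. apply zsumR_scal. Qed.
Lemma box_sum_neg N f : box_sum N (fun m n => f (- m)%Z (- n)%Z) = box_sum N f.
Proof.
  unfold box_sum. rewrite (zsum_ext N _ (fun m => zsum N (fun n => f (- m)%Z n))).
  apply (zsum_neg N (fun m => zsum N (fun n => f m n))).
  intros m. apply (zsum_neg N (f (- m)%Z)).
Qed.
Lemma zsum_delta N c : zsum N (fun m => if (m =? 0)%Z then c else 0) = c.
Proof.
  induction N. rewrite zsum_O. reflexivity. rewrite zsum_S, IHN.
  replace (- Z.of_nat (S N) =? 0)%Z with false by (symmetry; apply Z.eqb_neq; lia).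
  replace (Z.of_nat (S N) =? 0)%Z with false by (symmetry; apply Z.eqb_neq; lia). ring.
Qed.
Lemma box_sum_delta N c : box_sum N (fun m n => if ((m =? 0) && (n =? 0))%Z%bool then c else 0) = c.
Proof.
  unfold box_sum. rewrite (zsum_ext N _ (fun m => if (m =? 0)%Z then c else 0)). apply zsum_delta.
  intros m. destruct (m =? 0)%Z; simpl. apply zsum_delta. apply zsum_0.
Qed.

Lemma box_sum_S N f : box_sum (S N) f = box_sum N f +
  (zsum (S N) (fun n => f (- Z.of_nat (S N))%Z n) + zsum (S N) (fun n => f (Z.of_nat (S N)) n)
   + (zsum N (fun m => f m (- Z.of_nat (S N))%Z) + zsum N (fun m => f m (Z.of_nat (S N))))).
Proof.
  unfold box_sum at 1. rewrite zsum_S.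
  rewrite (zsum_ext N (fun m => zsum (S N) (fun n => f m n))
    (fun m => f m (- Z.of_nat (S N))%Z + zsum N (fun n => f m n) + f m (Z.of_nat (S N))))
    by (intros; apply zsum_S).
  rewrite !zsum_plus. unfold box_sum. ring.
Qed.
Lemma box_sumR_S N f : box_sumR (S N) f = (box_sumR N f +
  (zsumR (S N) (fun n => f (- Z.of_nat (S N))%Z n) + zsumR (S N) (fun n => f (Z.of_nat (S N)) n)
   + (zsumR N (fun m => f m (- Z.of_nat (S N))%Z) + zsumR N (fun m => f m (Z.of_nat (S N))))))%R.
Proof.
  unfold box_sumR at 1. rewrite zsumR_S.
  rewrite (zsumR_ext N (fun m => zsumR (S N) (fun n => f m n))
    (fun m => f m (- Z.of_nat (S N))%Z + zsumR N (fun n => f m n) + f m (Z.of_nat (S N)))%R)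
    by (intros; apply zsumR_S).
  rewrite !zsumR_plus. unfold box_sumR. ring.
Qed.
Lemma box_sum_step N f g : (forall m n, Cmod (f m n) <= g m n)%R ->
  (Cmod (box_sum (S N) f - box_sum N f) <= box_sumR (S N) g - box_sumR N g)%R.
Proof.
  intros H. rewrite box_sum_S, box_sumR_S.
  match goal with |- (Cmod (?a + ?b - ?a) <= ?c + ?d - ?c)%R =>
    replace (a + b - a) with b by ring; replace (c + d - c)%R with d by ring end.
  do 2 (eapply Rle_trans; [apply Cmod_triangle|]; apply Rplus_le_compat);
    apply Cmod_zsum; auto.
Qed.

(** * A convergent majorant *)

Definition weight (m n : Z) : R := (1 + Rabs (IZR m) + Rabs (IZR n))%R.
Lemma weight_ge1 m n : (1 <= weight m n)%R.
Proof. unfold weight. pose proof (Rabs_pos (IZR m)). pose proof (Rabs_pos (IZR n)). lra. Qed.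

(** Comparison with a telescoping sum, on both half-lines at once. *)
Lemma zsumR_tele (phi psi : R -> R) (c : R) N :
  (forall x, c <= x -> phi (x + 1) <= psi x - psi (x + 1))%R ->
  (zsumR N (fun n => phi (c + Rabs (IZR n))) <= phi c + 2 * (psi c - psi (c + INR N)))%R.
Proof.
  intros H. induction N.
  - rewrite zsumR_O, Rabs_R0. simpl. rewrite Rplus_0_r. lra.
  - rewrite zsumR_S. rewrite opp_IZR, Rabs_Ropp, <- INR_IZR_INZ, Rabs_pos_eq by apply pos_INR.
    rewrite S_INR. specialize (H (c + INR N)%R). pose proof (pos_INR N). specialize (H ltac:(lra)).
    rewrite Rplus_assoc in H. lra.
Qed.

Lemma inv3_tele x : (1 <= x)%R -> (/ (x + 1) ^ 3 <= / x ^ 2 - / (x + 1) ^ 2)%R.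
Proof.
  intros H. assert (0 < x ^ 2 * (x + 1) ^ 3)%R by (apply Rmult_lt_0_compat; apply pow_lt; lra).
  apply Rmult_le_reg_r with (x ^ 2 * (x + 1) ^ 3)%R; auto.
  replace (/ (x + 1) ^ 3 * (x ^ 2 * (x + 1) ^ 3))%R with (x ^ 2)%R by (field; lra).
  replace ((/ x ^ 2 - / (x + 1) ^ 2) * (x ^ 2 * (x + 1) ^ 3))%R with ((x + 1) ^ 3 - x ^ 2 * (x + 1))%R by (field; lra).
  nra.
Qed.
Lemma inv2_tele x : (1 <= x)%R -> (/ (x + 1) ^ 2 <= / x - / (x + 1))%R.
Proof.
  intros H. assert (0 < x * (x + 1) ^ 2)%R by (apply Rmult_lt_0_compat; [|apply pow_lt]; lra).
  apply Rmult_le_reg_r with (x * (x + 1) ^ 2)%R; auto.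
  replace (/ (x + 1) ^ 2 * (x * (x + 1) ^ 2))%R with x by (field; lra).
  replace ((/ x - / (x + 1)) * (x * (x + 1) ^ 2))%R with (x + 1)%R by (field; lra). lra.
Qed.

Lemma inv_pow_pos x n : (0 < x)%R -> (0 < / x ^ n)%R.
Proof. intros. apply Rinv_0_lt_compat, pow_lt; auto. Qed.

(** Both summations telescope: the inner one leaves [3 / (1 + |m|) ^ 2]. *)
Lemma box_sumR_weight N : (box_sumR N (fun m n => / weight m n ^ 3) <= 9)%R.
Proof.
  unfold box_sumR. apply Rle_trans with (zsumR N (fun m => 3 * / (1 + Rabs (IZR m)) ^ 2)%R).
  - apply zsumR_le. intros m. unfold weight.
    set (c := (1 + Rabs (IZR m))%R). assert (Hc : (1 <= c)%R) by (unfold c; pose proof (Rabs_pos (IZR m)); lra).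
    eapply Rle_trans.
    + apply (zsumR_tele (fun x => / x ^ 3)%R (fun x => / x ^ 2)%R c N). intros x Hx. apply inv3_tele. lra.
    + pose proof (pos_INR N). pose proof (inv_pow_pos (c + INR N) 2 ltac:(lra)).
      assert (/ c ^ 3 <= / c ^ 2)%R.
      { apply Rinv_le_contravar. apply pow_lt; lra. apply Rle_pow; auto. }
      lra.
  - rewrite zsumR_scal. pose proof (zsumR_tele (fun x => / x ^ 2)%R (fun x => / x)%R 1 N) as T.
    specialize (T (fun x Hx => inv2_tele x Hx)). pose proof (pos_INR N).
    assert (0 < / (1 + INR N))%R by (apply Rinv_0_lt_compat; lra).
    cbv beta in T. rewrite pow1, Rinv_1 in T. lra.
Qed.

(** Dominated convergence for partial sums, with the tail of the majorant as error. *)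
Lemma seq_dom (u : nat -> C) (g : nat -> R) (G : R) :
  (forall n, Cmod (u (S n) - u n) <= g (S n) - g n)%R -> is_lim_seq g G ->
  exists l, Clim u l /\ forall n, (Cmod (l - u n) <= G - g n)%R.
Proof.
  intros H HG.
  assert (Mon : forall n k, (Cmod (u (n + k)%nat - u n) <= g (n + k)%nat - g n)%R).
  { intros n k. induction k. { rewrite Nat.add_0_r. replace (u n - u n) with (RtoC 0) by ring. rewrite Cmod_0. lra. }
    rewrite Nat.add_succ_r. replace (u (S (n + k)) - u n) with ((u (S (n + k)) - u (n + k)%nat) + (u (n + k)%nat - u n)) by ring.
    eapply Rle_trans; [apply Cmod_triangle|]. specialize (H (n + k)%nat). lra. }
  assert (gle : forall n, (g n <= G)%R).
  { apply is_lim_seq_incr_compare; auto. intros n. specialize (H n). pose proof (Cmod_ge_0 (u (S n) - u n)). lra. }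
  assert (EX : exists l, Clim u l).
  { assert (ES : ex_series (K := C_AbsRing) (V := C_CompleteNormedModule) (fun n => u (S n) - u n)).
    { apply (ex_series_le (K := C_AbsRing) (V := C_CompleteNormedModule) (fun n => u (S n) - u n) (fun n => g (S n) - g n)%R).
      - intros n. exact (H n).
      - exists (G - g 0%nat)%R. change (is_lim_seq (sum_n (fun n => g (S n) - g n)%R) (G - g 0%nat)%R).
        apply is_lim_seq_ext with (u := fun n => (g (S n) - g 0%nat)%R).
        + induction n. now rewrite sum_O. rewrite sum_Sn, <- IHn. unfold plus; simpl. ring.
        + apply is_lim_seq_minus'. apply is_lim_seq_incr_1 in HG. exact HG. apply is_lim_seq_const. }
    destruct ES as [l Hl]. exists (l + u 0%nat).
    apply Clim_iff. intros eps He.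
    destruct (proj1 (Clim_iff _ _) (proj1 (Cser_Clim _ _) Hl) eps He) as [N HN].
    exists (S N). intros [|n] Hn. lia. specialize (HN n ltac:(lia)).
    replace (u (S n) - (l + u 0%nat)) with (psum (fun n => u (S n) - u n) n - l); auto.
    assert (E : psum (fun n => u (S n) - u n) n = u (S n) - u 0%nat).
    { clear. induction n. now rewrite psum_O. rewrite psum_S, IHn. ring. }
    rewrite E. ring. }
  destruct EX as [l Hl]. exists l. split; auto. intros n. apply le_epsilon. intros eps He.
  destruct (proj1 (Clim_iff _ _) Hl eps He) as [N HN]. specialize (HN (n + N)%nat ltac:(lia)).
  replace (l - u n) with (- (u (n + N)%nat - l) + (u (n + N)%nat - u n)) by ring.
  eapply Rle_trans; [apply Cmod_triangle|]. rewrite Cmod_opp.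
  specialize (Mon n N). specialize (gle (n + N)%nat). lra.
Qed.

Lemma Cser_zsum N (A : Z -> nat -> C) (l : Z -> C) : (forall m, Cser (A m) (l m)) ->
  Cser (fun k => zsum N (fun m => A m k)) (zsum N l).
Proof.
  intros H. induction N.
  - rewrite zsum_O. generalize (H 0%Z). apply Cser_ext. intros k. now rewrite zsum_O.
  - rewrite zsum_S. generalize (Cser_plus _ _ _ _ (Cser_plus _ _ _ _ (H (- Z.of_nat (S N))%Z) IHN) (H (Z.of_nat (S N)))).
    apply Cser_ext. intros k. now rewrite zsum_S.
Qed.
Lemma Cser_box_sum N (A : Z -> Z -> nat -> C) (l : Z -> Z -> C) : (forall m n, Cser (A m n) (l m n)) ->
  Cser (fun k => box_sum N (fun m n => A m n k)) (box_sum N l).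
Proof.
  intros H. apply (Cser_zsum N (fun m k => zsum N (fun n => A m n k)) (fun m => zsum N (fun n => l m n))).
  intros m. apply (Cser_zsum N (A m) (l m)). auto.
Qed.

(** Summation over the lattice commutes with summation of the power series: the error
    in the [k]-th coefficient is at most [K * s ^ k] times the tail of the majorant, and this is
    summable over [k] when [|x| * s <= 1/2]. *)
Lemma lattice_pseries (A : Z -> Z -> nat -> C) (K s : R) : (0 <= K)%R -> (0 < s)%R ->
  (forall m n k, Cmod (A m n k) <= K * s ^ k * / weight m n ^ 3)%R ->
  exists b : nat -> C,
    (forall k, Clim (fun N => box_sum N (fun m n => A m n k)) (b k)) /\
    (exists M, forall k, Cmod (b k) <= M * s ^ k)%R /\
    (forall (x : C) (f : Z -> Z -> C), (Cmod x * s <= 1 / 2)%R -> (forall m n, Cser (fun k => A m n k * x ^ k) (f m n)) ->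
       exists l : C, Clim (fun N => box_sum N f) l /\ Cser (fun k => b k * x ^ k) l).
Proof.
  intros HK Hs HA.
  set (g := fun N => box_sumR N (fun m n => / weight m n ^ 3)%R).
  assert (Lp : forall m n, (0 <= / weight m n ^ 3)%R).
  { intros. left. apply inv_pow_pos. pose proof (weight_ge1 m n). lra. }
  assert (gpos : forall N, (0 <= g N)%R). { intros. apply zsumR_pos. intros. apply zsumR_pos. auto. }
  assert (gmon : forall n, (g n <= g (S n))%R).
  { intros n. pose proof (box_sum_step n (fun _ _ => 0) (fun m n => / weight m n ^ 3)%R) as P.
    pose proof (Cmod_ge_0 (box_sum (S n) (fun _ _ : Z => 0) - box_sum n (fun _ _ : Z => 0))) as P0.
    assert (P1 : forall m n : Z, (Cmod 0 <= / weight m n ^ 3)%R) by (intros; rewrite Cmod_0; auto).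
    specialize (P P1). unfold g. lra. }
  assert (EG : exists G : R, is_lim_seq g G).
  { apply ex_finite_lim_seq_incr with (M := 9%R).
    - exact gmon.
    - intros n. exact (box_sumR_weight n). }
  destruct EG as [G HG].
  assert (Hb : forall k, exists l, Clim (fun N => box_sum N (fun m n => A m n k)) l /\
     forall N, (Cmod (l - box_sum N (fun m n => A m n k)) <= K * s ^ k * (G - g N))%R).
  { intros k. destruct (seq_dom (fun N => box_sum N (fun m n => A m n k)) (fun N => K * s ^ k * g N)%R (K * s ^ k * G)%R) as [l [Hl Hd]].
    - intros N. eapply Rle_trans. apply (box_sum_step N _ (fun m n => K * s ^ k * / weight m n ^ 3)%R). intros; apply HA.
      rewrite !box_sumR_scal. right. reflexivity.
    - apply (is_lim_seq_scal_l g (K * s ^ k)%R G HG).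
    - exists l. split; auto. intros N. eapply Rle_trans; [apply Hd|]. lra. }
  set (b := fun k => proj1_sig (constructive_indefinite_description _ (Hb k))).
  assert (Hb' : forall k, Clim (fun N => box_sum N (fun m n => A m n k)) (b k) /\
     forall N, (Cmod (b k - box_sum N (fun m n => A m n k)) <= K * s ^ k * (G - g N))%R).
  { intros k. unfold b. destruct (constructive_indefinite_description _ (Hb k)) as [l Hl]. exact Hl. }
  assert (HM : forall k, (Cmod (b k) <= K * (G + / weight 0 0 ^ 3) * s ^ k)%R).
  { intros k. destruct (Hb' k) as [_ h]. specialize (h 0%nat). specialize (HA 0%Z 0%Z k).
    unfold box_sum in h. rewrite !zsum_O in h.
    replace (b k) with ((b k - A 0%Z 0%Z k) + A 0%Z 0%Z k) by ring.
    eapply Rle_trans; [apply Cmod_triangle|]. pose proof (gpos 0%nat).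
    assert (0 <= K * s ^ k * g 0%nat)%R. { apply Rmult_le_pos; auto. apply Rmult_le_pos; auto. apply pow_le; lra. }
    lra. }
  exists b. split; [intros; apply Hb'|]. split.
  { exists (K * (G + / weight 0 0 ^ 3))%R. exact HM. }
  intros x f Hx Hf.
  pose proof (Cmod_ge_0 x).
  assert (Hgeo : forall k, (s ^ k * Cmod x ^ k <= (1 / 2) ^ k)%R).
  { intros k. rewrite <- Rpow_mult_distr. apply pow_incr. nra. }
  destruct (Cser_dom (fun k => b k * x ^ k) (K * (G + / weight 0 0 ^ 3))%R) as [l [Hl _]].
  { intros k. rewrite Cmod_mult, Cmod_pow.
    apply Rle_trans with (K * (G + / weight 0 0 ^ 3) * s ^ k * Cmod x ^ k)%R.
    - apply Rmult_le_compat_r; auto. apply pow_le; auto.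
    - rewrite Rmult_assoc. apply Rmult_le_compat_l; auto.
      specialize (HM 0%nat). rewrite pow_O, Rmult_1_r in HM. pose proof (Cmod_ge_0 (b 0%nat)). lra. }
  exists l. split; auto.
  assert (D : Clim (fun N => l - box_sum N f) 0).
  { apply Clim_squeeze with (e := fun N => (2 * (K * (G - g N)))%R).
    - intros N. 
      pose proof (Cser_box_sum N (fun m n k => A m n k * x ^ k) f Hf) as S1.
      pose proof (Cser_plus _ _ _ _ Hl (Cser_scal (- (1)) _ _ S1)) as S2.
      destruct (Cser_dom (fun k => (b k - box_sum N (fun m n => A m n k)) * x ^ k) (K * (G - g N))%R) as [l' [Hl' B]].
      + intros k. rewrite Cmod_mult, Cmod_pow. destruct (Hb' k) as [_ h]. specialize (h N).
        apply Rle_trans with (K * s ^ k * (G - g N) * Cmod x ^ k)%R.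
        * apply Rmult_le_compat_r; auto. apply pow_le; auto.
        * replace (K * s ^ k * (G - g N) * Cmod x ^ k)%R with (K * (G - g N) * (s ^ k * Cmod x ^ k))%R by ring.
          apply Rmult_le_compat_l; auto. apply Rmult_le_pos; auto.
          destruct (Hb' 0%nat) as [_ h0]. 
          assert (g N <= G)%R. 2: lra.
          apply is_lim_seq_incr_compare; auto.
      + replace (l - box_sum N f) with l'; auto.
        eapply Cser_unique. exact Hl'. eapply Cser_eq; [|eapply Cser_ext; [|exact S2]].
        * cring.
        * intros k. cbv beta. rewrite (box_sum_ext N (fun m n => A m n k * x ^ k) (fun m n => x ^ k * A m n k)) by (intros; ring).
          rewrite box_sum_scal. cring.
    - replace (Finite 0) with (Rbar_mult 2 (Rbar_mult K (G - G)%R)).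
      + apply is_lim_seq_scal_l. apply is_lim_seq_scal_l. apply is_lim_seq_minus'. apply is_lim_seq_const. exact HG.
      + simpl. f_equal. ring. }
  apply Clim_ext with (u := fun N => l + - (1) * (l - box_sum N f)). { intros; cring. }
  assert (E0 : l = l + - (1) * 0) by ring.
  pose proof (Clim_plus _ _ _ _ (Clim_const l) (Clim_scal (- (1)) _ _ D)) as D2.
  rewrite <- E0 in D2. exact D2.
Qed.

(** * Distances to the lattice *)

(** The imaginary part controls the coefficient of [tau], then the modulus controls the
    other one. *)
Lemma lat_lower (tau : C) : (0 < Im tau)%R ->
  exists ka : R, (0 < ka)%R /\ forall x y : R, (ka * (Rabs x + Rabs y) <= Cmod (RtoC x + RtoC y * tau)%C)%R.
Proof.
  intros H. set (c := (1 + (Cmod tau + 1) / Im tau)%R).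
  pose proof (Cmod_ge_0 tau).
  assert (Hc : (0 < c)%R). { unfold c. assert (0 < (Cmod tau + 1) / Im tau)%R by (apply Rdiv_lt_0_compat; lra). lra. }
  exists (/ c)%R. split. apply Rinv_0_lt_compat; auto.
  intros x y. set (w := RtoC x + RtoC y * tau).
  assert (H1 : (Rabs y * Im tau <= Cmod w)%R).
  { replace (Rabs y * Im tau)%R with (Rabs (Im w)). apply im_le_Cmod.
    rewrite <- (Rabs_pos_eq (Im tau)) at 1 by lra. rewrite <- Rabs_mult. f_equal.
    unfold w, Im, RtoC, Cplus, Cmult; simpl. ring. }
  assert (H2 : (Rabs x <= Cmod w + Rabs y * Cmod tau)%R).
  { rewrite <- (Cmod_R x), <- (Cmod_R y), <- Cmod_mult, <- (Cmod_opp (y * tau)).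
    replace (RtoC x) with (w + - (RtoC y * tau)) by (unfold w; ring). apply Cmod_triangle. }
  assert (H3 : (Rabs y <= Cmod w / Im tau)%R).
  { apply Rmult_le_reg_r with (Im tau); auto. unfold Rdiv. rewrite Rmult_assoc, Rinv_l; lra. }
  apply Rmult_le_reg_l with c; auto. rewrite <- Rmult_assoc, Rinv_r, Rmult_1_l by lra.
  unfold c. replace ((1 + (Cmod tau + 1) / Im tau) * Cmod w)%R with (Cmod w + (Cmod tau + 1) * (Cmod w / Im tau))%R by (field; lra).
  nra.
Qed.

Lemma dist_Z (al : R) : exists d : R, (0 < d)%R /\ forall m : Z, IZR m <> al -> (d <= Rabs (IZR m - al))%R.
Proof.
  destruct (base_Int_part al) as [H1 H2]. set (k := Int_part al) in *.
  destruct (Req_dec (IZR k) al) as [E|N].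
  - exists 1%R. split; [lra|]. intros m Hm. rewrite <- E in *.
    assert (Hk : m <> k) by congruence. rewrite <- minus_IZR, <- abs_IZR.
    apply (IZR_le 1). lia.
  - exists (Rmin (al - IZR k) (IZR k + 1 - al)). split. { apply Rmin_pos; lra. }
    intros m Hm. destruct (Z_le_gt_dec m k) as [h|h].
    + apply IZR_le in h. rewrite Rabs_left1 by lra. pose proof (Rmin_l (al - IZR k) (IZR k + 1 - al)). lra.
    + assert (h' : (k + 1 <= m)%Z) by lia. apply IZR_le in h'. rewrite plus_IZR in h'.
      rewrite Rabs_pos_eq by lra. pose proof (Rmin_r (al - IZR k) (IZR k + 1 - al)). lra.
Qed.

(** Far from [a] the bound is [lat_lower]; near [a] it is the discreteness of the
    integers in the coordinates of [a] with respect to 1 and [tau]. *)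
Lemma lat_dist (tau a : C) : (0 < Im tau)%R ->
  exists de : R, (0 < de <= 1)%R /\ forall m n, lattice_point tau m n <> a ->
    (de * weight m n <= Cmod (lattice_point tau m n - a))%R.
Proof.
  intros H. destruct (lat_lower tau H) as [ka [Hka L]].
  destruct (tau_coords tau a H) as [al [be Ea]].
  destruct (dist_Z al) as [d1 [Hd1 D1]]. destruct (dist_Z be) as [d2 [Hd2 D2]].
  (* a lower bound for the distance from a to the other lattice points *)
  set (d := (ka * Rmin d1 d2)%R).
  assert (Hd : (0 < d)%R) by (apply Rmult_lt_0_compat; auto; apply Rmin_pos; auto).
  set (c := (1 + / d + / ka + Cmod a / (ka * d))%R).
  assert (0 < / d)%R by (apply Rinv_0_lt_compat; auto).
  assert (0 < / ka)%R by (apply Rinv_0_lt_compat; auto).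
  assert (0 <= Cmod a / (ka * d))%R.
  { apply Rmult_le_pos. apply Cmod_ge_0. left. apply Rinv_0_lt_compat. apply Rmult_lt_0_compat; auto. }
  assert (Hc : (1 < c)%R) by (unfold c; lra).
  exists (/ c)%R. split. { split. apply Rinv_0_lt_compat; lra. rewrite <- Rinv_1. apply Rinv_le_contravar; lra. }
  intros m n Hne. set (w := lattice_point tau m n) in *.
  assert (W1 : (d <= Cmod (w - a))%R).
  { replace (w - a) with (RtoC (IZR m - al) + RtoC (IZR n - be) * tau)
      by (unfold w, lattice_point; rewrite Ea, !RtoC_minus; ring).
    eapply Rle_trans; [|apply L]. unfold d. apply Rmult_le_compat_l; [lra|].
    pose proof (Rabs_pos (IZR m - al)). pose proof (Rabs_pos (IZR n - be)).
    pose proof (Rmin_l d1 d2). pose proof (Rmin_r d1 d2).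
    destruct (Req_dec (IZR m) al) as [E1|N1].
    - destruct (Req_dec (IZR n) be) as [E2|N2].
      + exfalso. apply Hne. unfold w, lattice_point. rewrite Ea, E1, E2. reflexivity.
      + specialize (D2 n N2). lra.
    - specialize (D1 m N1). lra. }
  assert (W2 : (ka * (weight m n - 1) <= Cmod (w - a) + Cmod a)%R).
  { unfold weight. replace (1 + Rabs (IZR m) + Rabs (IZR n) - 1)%R with (Rabs (IZR m) + Rabs (IZR n))%R by ring.
    eapply Rle_trans; [apply L|]. change (RtoC (IZR m) + RtoC (IZR n) * tau) with w.
    replace w with ((w - a) + a) at 1 by ring. apply Cmod_triangle. }
  apply Rmult_le_reg_l with c; [lra|]. rewrite <- Rmult_assoc, Rinv_r, Rmult_1_l by lra.
  assert (W3 : (weight m n - 1 <= (Cmod (w - a) + Cmod a) / ka)%R).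
  { apply Rmult_le_reg_l with ka; auto. replace (ka * ((Cmod (w - a) + Cmod a) / ka))%R with (Cmod (w - a) + Cmod a)%R by (field; lra). exact W2. }
  assert (W4 : (1 <= Cmod (w - a) / d)%R).
  { apply Rmult_le_reg_r with d; auto. unfold Rdiv. rewrite Rmult_assoc, Rinv_l; lra. }
  assert (W5 : (Cmod a / ka <= Cmod a / ka * (Cmod (w - a) / d))%R).
  { rewrite <- (Rmult_1_r (Cmod a / ka)) at 1. apply Rmult_le_compat_l; auto.
    apply Rmult_le_pos; [apply Cmod_ge_0|lra]. }
  replace (c * Cmod (w - a))%R with (Cmod (w - a) + Cmod (w - a) / d + Cmod (w - a) / ka + Cmod a / ka * (Cmod (w - a) / d))%R
    by (unfold c; field; split; lra).
  replace ((Cmod (w - a) + Cmod a) / ka)%R with (Cmod (w - a) / ka + Cmod a / ka)%R in W3 by (field; lra).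
  pose proof (Cmod_ge_0 (w - a)). lra.
Qed.

Lemma lattice_point_0 tau m n : (0 < Im tau)%R -> lattice_point tau m n = 0 -> m = 0%Z /\ n = 0%Z.
Proof.
  intros H E. unfold lattice_point in E.
  assert (E2 : Im (RtoC (IZR m) + RtoC (IZR n) * tau) = 0%R) by (rewrite E; reflexivity).
  assert (E3 : (IZR n * Im tau)%R = 0%R). { rewrite <- E2. unfold Im, RtoC, Cplus, Cmult; simpl. ring. }
  assert (n = 0%Z). { apply eq_IZR. apply Rmult_integral in E3. destruct E3; auto; lra. }
  subst n. split; auto. replace (RtoC (IZR m) + 0%R * tau) with (RtoC (IZR m)) in E by ring.
  apply RtoC_inj in E. apply eq_IZR. exact E.
Qed.

(** * Local expansion of the lattice sums *)

Lemma C_lim_seq_Clim u l : Clim u l -> C_lim_seq u = l.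
Proof.
  intros H. rewrite Clim_iff in H. unfold C_lim_seq.
  assert (R1 : is_lim_seq (fun n => Re (u n)) (Re l)).
  { apply is_lim_seq_spec. intros eps. destruct (H eps (cond_pos eps)) as [N HN]. exists N. intros n Hn.
    eapply Rle_lt_trans; [apply (re_le_Cmod (u n - l))|apply HN, Hn]. }
  assert (R2 : is_lim_seq (fun n => Im (u n)) (Im l)).
  { apply is_lim_seq_spec. intros eps. destruct (H eps (cond_pos eps)) as [N HN]. exists N. intros n Hn.
    eapply Rle_lt_trans; [apply (im_le_Cmod (u n - l))|apply HN, Hn]. }
  rewrite (is_lim_seq_unique _ _ R1), (is_lim_seq_unique _ _ R2). destruct l; reflexivity.
Qed.

Definition on_nonzero (tau : C) (f : C -> C) (m n : Z) : C :=
  if (Z.eqb m 0 && Z.eqb n 0)%bool then 0 else f (lattice_point tau m n).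

(** [lattice_sum] is a total operation; this gives its value once the limit is known. *)
Lemma lattice_sum_Clim tau f l : Clim (fun N => box_sum N (on_nonzero tau f)) l -> lattice_sum tau f = l.
Proof. intros H. apply C_lim_seq_Clim. exact H. Qed.

Definition zeta_term (z w : C) : C := 1 / (z - w) + 1 / w + z / w ^ 2.
Definition wp_term (z w : C) : C := 1 / (z - w) ^ 2 - 1 / w ^ 2.

(** Taylor coefficients at [a] of [zeta_term z w] as a function of [z].  The two
    correction terms of zeta only enter in degrees 0 and 1. *)
Definition zeta_coef (a w : C) (k : nat) : C :=
  match k with
  | 0%nat => - / (w - a) + 1 / w + a / w ^ 2
  | 1%nat => - (/ (w - a)) ^ 2 + 1 / w ^ 2
  | _ => - (/ (w - a)) ^ S k
  end.

Lemma zeta_coef_series (a w z : C) : w <> a -> (2 * Cmod (z - a) <= Cmod (w - a))%R -> 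
  Cser (fun k => zeta_coef a w k * (z - a) ^ k) (zeta_term z w).
Proof.
  intros Hne Hz.
  pose proof (Cser_inv a w z Hne Hz) as S1.
  assert (S2 : Cser (fun k => match k with 0%nat => 1 / w + a / w ^ 2 | 1%nat => 1 / w ^ 2 * (z - a) | _ => RtoC 0 end)
                 (0 + 1 / w ^ 2 * (z - a) + (1 / w + a / w ^ 2))).
  { apply (Cser_unshift (fun k => match k with 0%nat => 1 / w + a / w ^ 2 | 1%nat => 1 / w ^ 2 * (z - a) | _ => RtoC 0 end)).
    apply (Cser_unshift (fun k => match k with 0%nat => 1 / w ^ 2 * (z - a) | _ => RtoC 0 end)).
    apply Cser_0. reflexivity. }
  eapply Cser_eq; [|eapply Cser_ext; [|exact (Cser_plus _ _ _ _ S1 S2)]].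
  - unfold zeta_term, Cdiv. cring.
  - intros [|[|k]]; unfold zeta_coef; simpl Cpow; unfold Cdiv; cring.
Qed.

Lemma der_inv_sub (w z : C) : z <> w -> der (fun y => 1 / (y - w)) z (- (1 / (z - w) ^ 2)).
Proof.
  intros H. assert (Hne : w <> z) by congruence.
  destruct (hol_der _ _ (hol_inv_sub z w Hne)) as [u' [_ D]]. apply near_center in D.
  assert (D2 : der (fun y => 1 / (y - w) * (y - w)) z (u' z * (z - w) + 1 / (z - w) * (1 - 0))).
  { apply (der_mult (fun y => 1 / (y - w)) (fun y => y - w)); auto.
    apply (der_minus (fun y => y) (fun _ => w)). apply der_id. apply der_const. }
  assert (D3 : der (fun y => 1 / (y - w) * (y - w)) z (RtoC 0)).
  { apply der_ext with (f := fun _ => RtoC 1); [|apply der_const].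
    assert (P : (0 < Cmod (z - w))%R) by (apply Cmod_gt_0, Csub_neq, H).
    apply near_iff. exists (Cmod (z - w)). split; auto. intros y Hy.
    assert (y - w <> 0).
    { intros E. assert (E2 : y = w) by (replace y with (y - w + w) by ring; rewrite E; ring). subst y.
      rewrite <- Cmod_opp in Hy. replace (- (w - z)) with (z - w) in Hy by ring. lra. }
    field. auto. }
  pose proof (der_unique _ _ _ _ D2 D3) as E. apply Csub_neq in H.
  apply der_eq with (l := u' z); auto.
  replace (u' z) with ((u' z * (z - w) + 1 / (z - w) * (1 - 0)) / (z - w) - 1 / (z - w) ^ 2) by (field; auto).
  rewrite E. field. auto.
Qed.

Lemma der_inv_pow (a z : C) (n : nat) : z <> a ->
  der (fun y => (1 / (y - a)) ^ n) z (- (RtoC (INR n) * (1 / (z - a)) ^ S n)).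
Proof.
  intros H. induction n as [|n IH].
  - apply der_eq with (l := RtoC 0). simpl. ring. apply (der_const 1).
  - simpl Cpow at 1.
    apply der_eq with (l := - (1 / (z - a) ^ 2) * (1 / (z - a)) ^ n
                            + 1 / (z - a) * (- (RtoC (INR n) * (1 / (z - a)) ^ S n))).
    + rewrite (S_INR n), RtoC_plus. simpl Cpow. apply Csub_neq in H. field. auto.
    + apply (der_mult (fun y => 1 / (y - a)) (fun y => (1 / (y - a)) ^ n)); auto.
      apply der_inv_sub; auto.
Qed.

Lemma der_inv_sub2 (a z : C) : z <> a -> der (fun y => 1 / (y - a) ^ 2) z (- (2 / (z - a) ^ 3)).
Proof.
  intros H. apply der_eq with (l := - (RtoC (INR 2) * (1 / (z - a)) ^ 3)).
  { simpl INR. replace (RtoC (1 + 1)) with (RtoC 2) by (f_equal; ring). apply Csub_neq in H. field. auto. }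
  apply der_ext with (f := fun y => (1 / (y - a)) ^ 2). 2: apply der_inv_pow; auto.
  apply filter_forall. intros y. unfold Cdiv. simpl. 
  change (1 * / (y - a) * (1 * / (y - a) * 1) = 1 * / ((y - a) * ((y - a) * 1))).
  destruct (Ceq_dec (y - a) 0) as [->|N].
  - replace (0 * (0 * 1)) with (RtoC 0) by ring. 
    assert (E0 : / 0 = 0). { unfold Cinv, RtoC. simpl. f_equal; unfold Rdiv; ring. }
    rewrite E0. ring.
  - field. auto.
Qed.

(** Computes the derivative of a function built from functions whose derivatives are in
    the context. *)
Ltac derive_term :=
    lazymatch goal with
    | H : der ?f ?z _ |- der ?f ?z _ => exact H
    | |- der (fun _ => ?c) ?z _ => apply (der_const c z)
    | |- der (fun y => y) ?z _ => apply (der_id z)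
    | |- der (fun y => RtoC 1 / (y - ?a)) ?z _ => apply (der_inv_sub a z); assumption
    | |- der (fun y => RtoC 1 / (y - ?a) ^ 2) ?z _ => apply (der_inv_sub2 a z); assumption
    | |- der (fun y => @?f y + @?g y) ?z _ => eapply (der_plus f g); derive_term
    | |- der (fun y => @?f y - @?g y) ?z _ => eapply (der_minus f g); derive_term
    | |- der (fun y => @?f y * @?g y) ?z _ => eapply (der_mult f g); derive_term
    | |- der (fun y => - @?f y) ?z _ => eapply (der_opp f); derive_term
    | |- der (fun y => @?f y ^ O) ?z _ => apply (der_const 1 z)
    | |- der (fun y => @?f y ^ S ?n) ?z _ => eapply (der_mult f (fun y => f y ^ n)); derive_term
    | |- der (fun y => ?u y) ?z _ => change (fun y : C => u y) with u; derive_term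
    end.
Ltac derive := eapply der_eq; [ | derive_term ]; cbv beta.

(** Termwise differentiation of [zeta_coef_series], since [- wp_term] is the
    derivative of [zeta_term]. *)
Lemma zeta_coef_wterm (a w z : C) (K s : R) : w <> a -> (0 < s)%R -> (0 <= K)%R ->
  (1 <= s * Cmod (w - a))%R -> (forall k, Cmod (zeta_coef a w k) <= K * s ^ k)%R ->
  (Cmod (z - a) * s <= 1 / 16)%R ->
  Cser (fun k => (RtoC (INR (S k)) * zeta_coef a w (S k)) * (z - a) ^ k) (- wp_term z w).
Proof.
  intros Hne Hs HK Hw Hc Hz.
  assert (H : taylor_bounded a (fun z => zeta_term z w) (zeta_coef a w) K s).
  { split; auto. split; auto. split; auto. intros y Hy. apply zeta_coef_series; auto.
    apply Rmult_le_reg_r with s; auto. lra. }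
  destruct (taylor_bounded_der _ _ _ _ _ H) as [u' [[_ [_ [_ Hu]]] D]].
  specialize (Hu z ltac:(lra)). specialize (D z ltac:(lra)).
  assert (Hzw : z <> w).
  { intros ->. rewrite Rmult_comm in Hz. lra. }
  replace (- wp_term z w) with (u' z); auto.
  apply (der_unique (fun z => zeta_term z w) z); auto.
  unfold zeta_term, wp_term. apply der_ext with (f := fun z => 1 / (z - w) + 1 / w + / w ^ 2 * z).
  { apply filter_forall. intros y. unfold Cdiv. cring. }
  derive. unfold Cdiv. ring.
Qed.

Lemma Cmod_inv_le (w : C) (x : R) : (0 < x)%R -> (x <= Cmod w)%R -> (Cmod (/ w) <= / x)%R.
Proof.
  intros Hx H. rewrite Cmod_inv. apply Rinv_le_contravar; auto. apply Cmod_gt_0. lra.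
Qed.

(** In degrees 0 and 1 the correction terms improve the decay to the third power of the
    distance; from degree 2 on it holds anyway. *)
Lemma zeta_coef_bound (a w : C) (de L : R) : (0 < de <= 1)%R -> (1 <= L)%R -> 
  (de * L <= Cmod w)%R -> (de * L <= Cmod (w - a))%R -> forall k,
  (Cmod (zeta_coef a w k) <= (Cmod a ^ 2 + 2 * Cmod a + 1) * / de ^ 4 * (/ de) ^ k * / L ^ 3)%R.
Proof.
  intros Hde HL H1 H2 k.
  assert (P : (0 < de * L)%R) by (apply Rmult_lt_0_compat; lra).
  assert (N1 : w <> 0) by (apply Cmod_gt_0; lra).
  assert (N2 : w - a <> 0) by (apply Cmod_gt_0; lra).
  pose proof (Cmod_inv_le w _ P H1) as I1. pose proof (Cmod_inv_le (w - a) _ P H2) as I2.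
  set (s := (/ de)%R). assert (Hs : (1 <= s)%R). { unfold s. rewrite <- Rinv_1. apply Rinv_le_contravar; lra. }
  set (i := (/ L)%R). assert (Hi : (0 < i <= 1)%R).
  { unfold i. split. apply Rinv_0_lt_compat; lra. rewrite <- Rinv_1. apply Rinv_le_contravar; lra. }
  assert (E : (/ (de * L) = s * i)%R) by (unfold s, i; field; lra).
  rewrite E in I1, I2.
  replace (/ de ^ 4)%R with (s ^ 4)%R by (unfold s; field; lra).
  replace (/ L ^ 3)%R with (i ^ 3)%R by (unfold i; field; lra).
  pose proof (Cmod_ge_0 (/ w)) as z1. pose proof (Cmod_ge_0 (/ (w - a))) as z2. pose proof (Cmod_ge_0 a) as za.
  set (p := Cmod (/ w)) in *. set (q := Cmod (/ (w - a))) in *. set (al := Cmod a) in *.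
  assert (si : (0 <= s * i)%R) by nra.
  assert (s1 : forall n, (1 <= s ^ n)%R) by (intros; apply pow_R1_Rle; auto).
  assert (Hcomb : forall u v, (0 <= u)%R -> (0 <= v <= 1)%R -> (u * v <= u)%R) by (intros; nra).
  destruct k as [|[|k]].
  - replace (zeta_coef a w 0) with (- (a ^ 2 * (/ w * (/ w * / (w - a))))) by (unfold zeta_coef; field; auto).
    rewrite Cmod_opp, !Cmod_mult, Cmod_pow. fold p q al. simpl (s ^ 0)%R. rewrite Rmult_1_r.
    assert (Q : (p * (p * q) <= s * i * (s * i * (s * i)))%R).
    { apply Rmult_le_compat; auto. apply Rmult_le_pos; auto. apply Rmult_le_compat; auto. }
    apply Rle_trans with (al ^ 2 * (s * i * (s * i * (s * i))))%R.
    { apply Rmult_le_compat_l; auto. apply pow2_ge_0. }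
    replace (al ^ 2 * (s * i * (s * i * (s * i))))%R with (al ^ 2 * (s ^ 3 * i ^ 3))%R by ring.
    rewrite Rmult_assoc. apply Rmult_le_compat. apply pow2_ge_0. apply Rmult_le_pos; apply pow_le; lra.
    pose proof (pow2_ge_0 al). lra.
    apply Rmult_le_compat_r. apply pow_le; lra. apply Rle_pow; auto.
  - replace (zeta_coef a w 1) with (a ^ 2 * (/ w * / w * (/ (w - a) * / (w - a))) + - (2) * (a * (/ w * (/ (w - a) * / (w - a)))))
      by (unfold zeta_coef; field; auto).
    eapply Rle_trans; [apply Cmod_triangle|]. rewrite !Cmod_mult, Cmod_pow, Cmod_opp, Cmod_R, (Rabs_pos_eq 2) by lra. fold p q al.
    assert (Q1 : (p * (q * q) <= s ^ 3 * i ^ 3)%R).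
    { replace (s ^ 3 * i ^ 3)%R with (s * i * (s * i * (s * i)))%R by ring. 
      apply Rmult_le_compat; auto. apply Rmult_le_pos; auto. apply Rmult_le_compat; auto. }
    assert (Q2 : (p * p * (q * q) <= s ^ 4 * i ^ 3)%R).
    { apply Rle_trans with (s ^ 4 * i ^ 3 * i)%R.
      - replace (s ^ 4 * i ^ 3 * i)%R with ((s * i) * (s * i) * ((s * i) * (s * i)))%R by ring.
        apply Rmult_le_compat; try (apply Rmult_le_pos; auto; fail); apply Rmult_le_compat; auto.
      - apply Hcomb; [|lra]. apply Rmult_le_pos; apply pow_le; lra. }
    assert (Q3 : (s ^ 3 * i ^ 3 <= s ^ 4 * i ^ 3)%R).
    { apply Rmult_le_compat_r. apply pow_le; lra. apply Rle_pow; auto. }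
    set (X := (s ^ 4 * i ^ 3)%R) in *.
    assert (X0 : (0 <= X)%R) by (apply Rmult_le_pos; apply pow_le; lra).
    replace ((al ^ 2 + 2 * al + 1) * s ^ 4 * s ^ 1 * i ^ 3)%R with ((al ^ 2 + 2 * al + 1) * X * s)%R by (unfold X; ring).
    assert (Q4 : ((al ^ 2 + 2 * al + 1) * X <= (al ^ 2 + 2 * al + 1) * X * s)%R).
    { rewrite <- (Rmult_1_r ((al ^ 2 + 2 * al + 1) * X)) at 1. apply Rmult_le_compat_l; auto.
      apply Rmult_le_pos; auto. pose proof (pow2_ge_0 al). lra. }
    assert (al ^ 2 * (p * p * (q * q)) <= al ^ 2 * X)%R by (apply Rmult_le_compat_l; auto; apply pow2_ge_0).
    assert (2 * (al * (p * (q * q))) <= 2 * (al * X))%R.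
    { apply Rmult_le_compat_l; [lra|]. apply Rmult_le_compat_l; auto. lra. }
    lra.
  - change (zeta_coef a w (S (S k))) with (- (/ (w - a)) ^ S (S (S k))). rewrite Cmod_opp, Cmod_pow. fold q.
    apply Rle_trans with ((s * i) ^ S (S (S k)))%R. { apply pow_incr. auto. }
    rewrite Rpow_mult_distr.
    apply Rle_trans with (s ^ S (S (S k)) * i ^ 3)%R.
    { apply Rmult_le_compat_l. apply pow_le; lra.
      replace (S (S (S k))) with (3 + k)%nat by lia. rewrite pow_add.
      apply Hcomb. apply pow_le; lra. split. apply pow_le; lra.
      rewrite <- (pow1 k). apply pow_incr. lra. }
    apply Rmult_le_compat_r. apply pow_le; lra.
    rewrite Rmult_assoc, <- pow_add.
    apply Rle_trans with (1 * s ^ (4 + S (S k)))%R.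
    { rewrite Rmult_1_l. apply Rle_pow; auto. lia. }
    apply Rmult_le_compat_r. apply pow_le; lra. pose proof (pow2_ge_0 al). lra.
Qed.

(** [zeta_reg] and [wp_reg] are what remains of zeta and wp without the pole at 0, so
    they are also defined at 0. *)
Definition zeta_reg (tau z : C) : C := lattice_sum tau (zeta_term z).
Definition wp_reg (tau z : C) : C := lattice_sum tau (wp_term z).

Definition off_nonzero (tau a : C) : Prop := forall m n, ~ (m = 0%Z /\ n = 0%Z) -> lattice_point tau m n <> a.

(** One expansion serves both functions: the coefficients of [- wp_reg] are those of
    the derivative of [zeta_reg].  The point [a] may be 0, which later gives the expansion of
    zeta at its pole. *)
Lemma zeta_reg_expand (tau a : C) : (0 < Im tau)%R -> off_nonzero tau a ->
  (forall z, z = a -> Clim (fun N => box_sum N (on_nonzero tau (zeta_term z))) (zeta_reg tau z)) /\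
  hol a (zeta_reg tau) /\ hol a (wp_reg tau) /\ near a (fun z => der (zeta_reg tau) z (- wp_reg tau z)).
Proof.
  intros Ht Ha.
  destruct (lat_dist tau a Ht) as [d1 [Hd1 D1]]. destruct (lat_dist tau 0 Ht) as [d2 [Hd2 D2]].
  set (de := Rmin d1 d2).
  assert (Hde : (0 < de <= 1)%R). { split. apply Rmin_pos; lra. eapply Rle_trans. apply Rmin_l. lra. }
  assert (D : forall m n, ~ (m = 0%Z /\ n = 0%Z) ->
    (de * weight m n <= Cmod (lattice_point tau m n))%R /\ (de * weight m n <= Cmod (lattice_point tau m n - a))%R).
  { intros m n Hmn. pose proof (weight_ge1 m n). split.
    - replace (lattice_point tau m n) with (lattice_point tau m n - 0) by ring.
      eapply Rle_trans; [|apply D2]. apply Rmult_le_compat_r; [lra|apply Rmin_r].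
      intros E. apply Hmn. apply (lattice_point_0 tau); auto.
    - eapply Rle_trans; [|apply D1]. apply Rmult_le_compat_r; [lra|apply Rmin_l]. apply Ha, Hmn. }
  (* the summand with index (0, 0) is left out of the lattice sums *)
  set (A := fun m n k => if (Z.eqb m 0 && Z.eqb n 0)%bool then RtoC 0 else zeta_coef a (lattice_point tau m n) k).
  set (K := ((Cmod a ^ 2 + 2 * Cmod a + 1) * / de ^ 4)%R). set (s := (/ de)%R).
  assert (Hs : (1 <= s)%R). { unfold s. rewrite <- Rinv_1. apply Rinv_le_contravar; lra. }
  assert (HK : (0 <= K)%R).
  { apply Rmult_le_pos. pose proof (pow2_ge_0 (Cmod a)). pose proof (Cmod_ge_0 a). lra. left. apply inv_pow_pos. lra. }
  assert (Hmn0 : forall m n, (Z.eqb m 0 && Z.eqb n 0)%bool = false -> ~ (m = 0%Z /\ n = 0%Z)).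
  { intros m n E [-> ->]. discriminate. }
  assert (HA : forall m n k, (Cmod (A m n k) <= K * s ^ k * / weight m n ^ 3)%R).
  { intros m n k. unfold A. destruct (Z.eqb m 0 && Z.eqb n 0)%bool eqn:E.
    - rewrite Cmod_0. apply Rmult_le_pos. apply Rmult_le_pos; auto. apply pow_le; lra.
      left. apply inv_pow_pos. pose proof (weight_ge1 m n); lra.
    - destruct (D m n (Hmn0 _ _ E)). apply zeta_coef_bound; auto. apply weight_ge1. }
  destruct (lattice_pseries A K s HK ltac:(lra) HA) as [b [Hb [[M HM] Hsum]]].
  set (A' := fun m n k => RtoC (INR (S k)) * A m n (S k)).
  assert (HA' : forall m n k, (Cmod (A' m n k) <= K * s * (2 * s) ^ k * / weight m n ^ 3)%R).
  { intros m n k. unfold A'. rewrite Cmod_mult, Cmod_R, Rabs_pos_eq by apply pos_INR.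
    apply Rle_trans with (2 ^ k * (K * s ^ S k * / weight m n ^ 3))%R.
    - apply Rmult_le_compat; auto using pos_INR, Cmod_ge_0, pow2_ge_S.
    - right. rewrite Rpow_mult_distr. simpl. ring. }
  destruct (lattice_pseries A' (K * s) (2 * s) ltac:(nra) ltac:(lra) HA') as [b' [Hb' [_ Hsum']]].
  assert (Eb : forall k, b' k = RtoC (INR (S k)) * b (S k)).
  { intros k. eapply Clim_unique. apply Hb'. apply Clim_ext with (u := fun N => RtoC (INR (S k)) * box_sum N (fun m n => A m n (S k))).
    intros N. rewrite <- box_sum_scal. reflexivity. apply Clim_scal, Hb. }
  assert (Dw : forall m n, ~ (m = 0%Z /\ n = 0%Z) -> (1 <= s * Cmod (lattice_point tau m n - a))%R).
  { intros m n h. destruct (D m n h) as [_ h2]. pose proof (weight_ge1 m n).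
    apply Rmult_le_reg_l with de; [lra|]. unfold s. rewrite <- Rmult_assoc, Rinv_r, Rmult_1_l by lra. nra. }
  assert (Z : forall z, (Cmod (z - a) * s <= 1 / 2)%R ->
     Clim (fun N => box_sum N (on_nonzero tau (zeta_term z))) (zeta_reg tau z) /\ Cser (fun k => b k * (z - a) ^ k) (zeta_reg tau z)).
  { intros z Hz. destruct (Hsum (z - a) (on_nonzero tau (zeta_term z)) Hz) as [l [L1 L2]].
    - intros m n. unfold on_nonzero, A. destruct (Z.eqb m 0 && Z.eqb n 0)%bool eqn:E.
      + apply Cser_0. intros; ring.
      + apply zeta_coef_series. apply Ha. auto. pose proof (Dw m n (Hmn0 _ _ E)).
        apply Rmult_le_reg_r with s; lra.
    - unfold zeta_reg. rewrite (lattice_sum_Clim tau _ l L1). auto. }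
  assert (W : forall z, (Cmod (z - a) * (16 * s) <= 1)%R ->
     Cser (fun k => b' k * (z - a) ^ k) (- wp_reg tau z)).
  { intros z Hz. destruct (Hsum' (z - a) (fun m n => - (1) * on_nonzero tau (wp_term z) m n)) as [l [L1 L2]].
    - lra.
    - intros m n. unfold on_nonzero, A', A. destruct (Z.eqb m 0 && Z.eqb n 0)%bool eqn:E.
      + apply Cser_eq with (l := RtoC 0). ring. apply Cser_0. intros; ring.
      + apply Cser_eq with (l := - wp_term z (lattice_point tau m n)). ring.
        apply zeta_coef_wterm with (K := K) (s := s); auto; try lra.
        intros k. specialize (HA m n k). unfold A in HA. rewrite E in HA.
        eapply Rle_trans; [exact HA|]. rewrite <- (Rmult_1_r (K * s ^ k)) at 2.
        apply Rmult_le_compat_l. apply Rmult_le_pos; auto. apply pow_le; lra.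
        rewrite <- Rinv_1. apply Rinv_le_contravar. lra. rewrite <- (pow1 3). apply pow_incr. pose proof (weight_ge1 m n); lra.
    - assert (EW : wp_reg tau z = - l).
      { apply lattice_sum_Clim. apply Clim_ext with (u := fun N => - (1) * box_sum N (fun m n => - (1) * on_nonzero tau (wp_term z) m n)).
        - intros N. rewrite <- box_sum_scal. apply box_sum_ext. intros; ring.
        - replace (- l) with (- (1) * l) by ring. apply Clim_scal. exact L1. }
      rewrite EW. apply Cser_eq with (l := l); auto. ring. }
  assert (HZ : taylor_bounded a (zeta_reg tau) b (Rmax M 0) s).
  { split. apply Rmax_r. split. lra. split.
    - intros k. eapply Rle_trans; [apply HM|]. apply Rmult_le_compat_r. apply pow_le; lra. apply Rmax_l.
    - intros z Hz. apply Z, Hz. }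
  destruct (taylor_bounded_der _ _ _ _ _ HZ) as [u' [[_ [_ [_ Hu]]] Dz]].
  pose proof (near_scale a (16 * s) 1 ltac:(lra) ltac:(lra)) as N16.
  split; [|split; [|split]].
  - intros z ->. apply (Z a). replace (a - a) with (RtoC 0) by ring. rewrite Cmod_0. lra.
  - eapply taylor_bounded_hol, HZ.
  - apply hol_ext_all with (u := fun z => - (- wp_reg tau z)). { intros; ring. }
    apply (hol_opp a (fun z => - wp_reg tau z)). exists b'. revert N16. apply near_imp. intros z Hz.
    apply is_pseries_C, W. lra.
  - revert N16. apply near_imp. intros z Hz. apply der_eq with (l := u' z).
    + apply (Cser_unique _ _ _ (Hu z ltac:(lra))).
      apply Cser_ext with (a := fun k => b' k * (z - a) ^ k). { intros k. rewrite Eb. reflexivity. }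
      apply W. lra.
    + apply Dz. lra.
Qed.

(** * Properties of the zeta function *)

Definition off_lattice (tau z : C) : Prop := ~ in_lattice tau z.

Lemma in_lattice_plus tau z w : in_lattice tau z -> in_lattice tau w -> in_lattice tau (z + w).
Proof.
  intros [m [n ->]] [m' [n' ->]]. exists (m + m')%Z, (n + n')%Z. unfold lattice_point.
  rewrite !plus_IZR, !RtoC_plus. ring.
Qed.
Lemma in_lattice_opp tau z : in_lattice tau z -> in_lattice tau (- z).
Proof.
  intros [m [n ->]]. exists (- m)%Z, (- n)%Z. unfold lattice_point.
  rewrite !opp_IZR, !RtoC_opp. ring.
Qed.
Lemma in_lattice_1 tau : in_lattice tau 1.
Proof. exists 1%Z, 0%Z. unfold lattice_point. ring. Qed.
Lemma in_lattice_tau tau : in_lattice tau tau.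
Proof. exists 0%Z, 1%Z. unfold lattice_point. ring. Qed.
Lemma in_lattice_0 tau : in_lattice tau 0.
Proof. exists 0%Z, 0%Z. unfold lattice_point. ring. Qed.

Lemma off_lattice_plus tau z w : in_lattice tau w -> off_lattice tau z -> off_lattice tau (z + w).
Proof.
  intros Hw Hz H. apply Hz. replace z with ((z + w) + - w) by ring.
  apply in_lattice_plus; auto. apply in_lattice_opp; auto.
Qed.
Lemma off_lattice_opp tau z : off_lattice tau z -> off_lattice tau (- z).
Proof. intros Hz H. apply Hz. replace z with (- - z) by ring. apply in_lattice_opp; auto. Qed.

Lemma off_lattice_off tau z : off_lattice tau z -> off_nonzero tau z.
Proof. intros H m n _ E. apply H. exists m, n. auto. Qed.
Lemma off_nonzero_0 tau : (0 < Im tau)%R -> off_nonzero tau 0.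
Proof. intros H m n N E. apply N. apply (lattice_point_0 tau); auto. Qed.

Lemma off_lattice_neq0 tau z : off_lattice tau z -> z <> 0.
Proof. intros H ->. apply H, in_lattice_0. Qed.

Lemma off_lattice_discrete tau (a : C) : (0 < Im tau)%R -> near' a (off_lattice tau).
Proof.
  intros H. destruct (lat_dist tau a H) as [de [Hde D]]. apply near'_iff. exists de. split; [lra|].
  intros z Hz N [m [n E]]. subst z. specialize (D m n N). pose proof (weight_ge1 m n). nra.
Qed.

Lemma off_lattice_near tau (a : C) : (0 < Im tau)%R -> off_lattice tau a -> near a (off_lattice tau).
Proof.
  intros H N. destruct (proj1 (near'_iff _ _) (off_lattice_discrete tau a H)) as [d [Hd D]].
  apply near_iff. exists d. split; auto. intros z Hz. destruct (Ceq_dec z a) as [->|Hn]; auto.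
Qed.

Section Zeta.
Context (tau : C) (Ht : (0 < Im tau)%R).

Lemma zeta_eq z : zeta tau z = 1 / z + zeta_reg tau z.
Proof. reflexivity. Qed.
Lemma wp_eq z : wp tau z = 1 / z ^ 2 + wp_reg tau z.
Proof. reflexivity. Qed.

Lemma zeta_der z : off_lattice tau z -> der (zeta tau) z (- wp tau z).
Proof.
  intros H. destruct (zeta_reg_expand tau z Ht (off_lattice_off _ _ H)) as [_ [_ [_ D]]]. apply near_center in D.
  rewrite wp_eq. pose proof (off_lattice_neq0 _ _ H) as N.
  apply der_ext with (f := fun y => 1 / (y - 0) + zeta_reg tau y).
  { apply filter_forall. intros y. rewrite zeta_eq. f_equal. f_equal. ring. }
  derive. replace (z - 0) with z by ring. field. auto.
Qed.

Lemma zeta_hol a : off_lattice tau a -> hol a (zeta tau).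
Proof.
  intros H. destruct (zeta_reg_expand tau a Ht (off_lattice_off _ _ H)) as [_ [Z _]].
  apply hol_ext_all with (u := fun y => 1 / (y - 0) + zeta_reg tau y).
  { intros y. rewrite zeta_eq. f_equal. f_equal. ring. }
  apply (hol_plus a (fun y => 1 / (y - 0)) (zeta_reg tau)); auto. apply hol_inv_sub.
  pose proof (off_lattice_neq0 _ _ H). congruence.
Qed.

Lemma lattice_sum_0 (f : C -> C) : (forall w : C, w <> 0 -> f w = 0) -> lattice_sum tau f = 0.
Proof.
  intros H. apply lattice_sum_Clim. apply Clim_ext with (u := fun _ => RtoC 0); [|apply Clim_const].
  intros N. rewrite (box_sum_ext N _ (fun _ _ => 0 * 0)). { rewrite box_sum_scal. ring. }
  intros m n. unfold on_nonzero. destruct (Z.eqb m 0 && Z.eqb n 0)%bool eqn:E. ring.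
  rewrite H. ring. intros K. apply (lattice_point_0 tau) in K; auto. destruct K; subst. discriminate.
Qed.

(** Every summand of [zeta_reg] and of its derivative vanishes at 0. *)
Lemma zeta_at_0 : exists v, hol 0 v /\ near' (RtoC 0) (fun z => zeta tau z = 1 / z + z ^ 2 * v z).
Proof.
  destruct (zeta_reg_expand tau 0 Ht (off_nonzero_0 _ Ht)) as [_ [Z [_ D]]]. apply near_center in D.
  destruct (hol_div _ _ Z) as [v1 [H1 E1]]. destruct (hol_div _ _ H1) as [v2 [H2 E2]].
  exists v2. split; auto.
  assert (Z0 : zeta_reg tau 0 = 0).
  { apply lattice_sum_0. intros w Hw. unfold zeta_term. field. auto. }
  assert (W0 : wp_reg tau 0 = 0).
  { apply lattice_sum_0. intros w Hw. unfold wp_term. field. auto. }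
  assert (V0 : v1 0 = 0).
  { destruct (hol_der _ _ H1) as [v1' [_ D1]]. apply near_center in D1.
    assert (D2 : der (zeta_reg tau) (RtoC 0) (v1 0)).
    { apply der_ext with (f := fun z => zeta_reg tau 0 + (z - 0) * v1 z).
      { revert E1. apply near_imp. intros z e. symmetry. exact e. }
      derive. ring. }
    pose proof (der_unique _ _ _ _ D D2) as E. rewrite W0 in E.
    rewrite <- E. ring. }
  generalize (near_near' (near_and E1 E2)). apply near'_imp. intros z _ [e1 e2].
  rewrite zeta_eq, e1, e2, Z0, V0. ring.
Qed.

(** The summand of zeta with the pole at 0 included, so that translations act on it by
    shifting the indices. *)
Definition zeta_summand (z : C) (m n : Z) : C :=
  1 / (z - lattice_point tau m n) + on_nonzero tau (fun w => 1 / w + z / w ^ 2) m n.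

Lemma zeta_box_limit z : off_lattice tau z -> Clim (fun N => box_sum N (zeta_summand z)) (zeta tau z).
Proof.
  intros H. destruct (zeta_reg_expand tau z Ht (off_lattice_off _ _ H)) as [L _]. specialize (L z eq_refl).
  rewrite zeta_eq.
  apply Clim_ext with (u := fun N => 1 / z + box_sum N (on_nonzero tau (zeta_term z))).
  2: { apply Clim_plus; auto. apply Clim_const. }
  intros N. rewrite <- (box_sum_delta N (1 / z)) at 1. rewrite <- box_sum_plus. apply box_sum_ext. intros m n.
  unfold zeta_summand, on_nonzero, zeta_term. destruct (Z.eqb m 0 && Z.eqb n 0)%bool eqn:E.
  - apply andb_prop in E. destruct E as [E1 E2]. apply Z.eqb_eq in E1. apply Z.eqb_eq in E2. subst.
    replace (z - lattice_point tau 0 0) with z by (unfold lattice_point; ring). ring.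
  - ring.
Qed.

Lemma lattice_point_opp m n : lattice_point tau (- m) (- n) = - lattice_point tau m n.
Proof. unfold lattice_point. rewrite !opp_IZR, !RtoC_opp. ring. Qed.

(** The boxes are symmetric under negation. *)
Lemma zeta_odd z : off_lattice tau z -> zeta tau (- z) = - zeta tau z.
Proof.
  intros H. pose proof (zeta_box_limit _ H) as L1. pose proof (zeta_box_limit _ (off_lattice_opp _ _ H)) as L2.
  eapply Clim_unique. exact L2. replace (- zeta tau z) with (- (1) * zeta tau z) by ring.
  apply Clim_ext with (u := fun N => - (1) * box_sum N (zeta_summand z)). 2: apply Clim_scal; auto.
  intros N. rewrite <- box_sum_scal, <- box_sum_neg. apply box_sum_ext. intros m n.
  unfold zeta_summand, on_nonzero.
  assert (E0 : ((- m =? 0) && (- n =? 0))%Z%bool = ((m =? 0) && (n =? 0))%Z%bool).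
  { destruct m, n; reflexivity. }
  rewrite E0.
  assert (Hne : z + lattice_point tau m n <> 0).
  { intros E. apply H. exists (- m)%Z, (- n)%Z. rewrite lattice_point_opp.
    replace z with (z + lattice_point tau m n - lattice_point tau m n) by ring. rewrite E. ring. }
  rewrite lattice_point_opp.
  assert (Hne2 : - z - lattice_point tau m n <> 0).
  { intros E. apply Hne. replace (z + lattice_point tau m n) with (- (- z - lattice_point tau m n)) by ring. rewrite E. ring. }
  destruct (Z.eqb m 0 && Z.eqb n 0)%bool eqn:E.
  - field. split; auto. replace (z - - lattice_point tau m n) with (z + lattice_point tau m n) by ring. auto.
  - assert (lattice_point tau m n <> 0).
    { intros K. apply (lattice_point_0 tau) in K; auto. destruct K; subst. discriminate. }
    field. repeat split; auto. replace (z - - lattice_point tau m n) with (z + lattice_point tau m n) by ring. auto.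
Qed.

(** A side of the box has [2 N + 1] points, and on it the difference of two
    summands is [O(N ^ -2)]. *)
Lemma boundary_small (z z' : C) (p : nat -> Z -> Z * Z) : off_lattice tau z -> off_lattice tau z' ->
  (forall N k, INR N <= weight (fst (p N k)) (snd (p N k)))%R ->
  Clim (fun N => zsum N (fun k => 1 / (z - lattice_point tau (fst (p N k)) (snd (p N k)))
                          - 1 / (z' - lattice_point tau (fst (p N k)) (snd (p N k))))) 0.
Proof.
  intros Hz Hz' Hp.
  destruct (lat_dist tau z Ht) as [d1 [Hd1 D1]]. destruct (lat_dist tau z' Ht) as [d2 [Hd2 D2]].
  set (K := (Cmod (z' - z) * (/ d1 * / d2))%R).
  assert (HK : (0 <= K)%R).
  { apply Rmult_le_pos. apply Cmod_ge_0. apply Rmult_le_pos; left; apply Rinv_0_lt_compat; lra. }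
  apply Clim_squeeze with (e := fun N => ((2 * INR N + 1) * (K * (/ (INR N + 1) ^ 2 * 4)))%R).
  - intros N. rewrite <- zsumR_const. apply Cmod_zsum. intros k.
    set (w := lattice_point tau (fst (p N k)) (snd (p N k))).
    assert (N1 : w <> z). { intros E. apply Hz. exists (fst (p N k)), (snd (p N k)). auto. }
    assert (N2 : w <> z'). { intros E. apply Hz'. exists (fst (p N k)), (snd (p N k)). auto. }
    specialize (D1 _ _ N1). specialize (D2 _ _ N2). fold w in D1, D2.
    specialize (Hp N k). pose proof (weight_ge1 (fst (p N k)) (snd (p N k))) as Hp1.
    set (L := weight (fst (p N k)) (snd (p N k))) in *.
    pose proof (pos_INR N) as HN.
    assert (HL : ((INR N + 1) / 2 <= L)%R) by lra.
    apply Csub_neq in N1. apply Csub_neq in N2.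
    assert (M1 : (Cmod (/ (w - z)) <= / (d1 * L))%R).
    { apply Cmod_inv_le; auto. apply Rmult_lt_0_compat; lra. }
    assert (M2 : (Cmod (/ (w - z')) <= / (d2 * L))%R).
    { apply Cmod_inv_le; auto. apply Rmult_lt_0_compat; lra. }
    assert (N1' : z - w <> 0) by (intros E; apply N1; replace (w - z) with (- (z - w)) by ring; rewrite E; ring).
    assert (N2' : z' - w <> 0) by (intros E; apply N2; replace (w - z') with (- (z' - w)) by ring; rewrite E; ring).
    replace (1 / (z - w) - 1 / (z' - w)) with ((z' - z) * (/ (w - z) * / (w - z'))) by (field; auto).
    rewrite !Cmod_mult. unfold K. rewrite Rmult_assoc. apply Rmult_le_compat_l. apply Cmod_ge_0.
    apply Rle_trans with (/ (d1 * L) * / (d2 * L))%R.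
    { apply Rmult_le_compat; auto using Cmod_ge_0. }
    replace (/ (d1 * L) * / (d2 * L))%R with (/ d1 * / d2 * / L ^ 2)%R by (field; lra).
    apply Rmult_le_compat_l. apply Rmult_le_pos; left; apply Rinv_0_lt_compat; lra.
    replace (/ (INR N + 1) ^ 2 * 4)%R with (/ ((INR N + 1) / 2) ^ 2)%R by (field; lra).
    apply Rinv_le_contravar. apply pow_lt; lra. apply pow_incr; lra.
  - apply is_lim_seq_le_le with (u := fun _ => 0%R) (w := fun n => (8 * K * / (INR n + 1))%R).
    + intros n. pose proof (pos_INR n). split.
      * apply Rmult_le_pos; [lra|]. apply Rmult_le_pos; auto. pose proof (inv_pow_pos (INR n + 1) 2 ltac:(lra)). lra.
      * replace (8 * K * / (INR n + 1))%R with (2 * (INR n + 1) * (K * (/ (INR n + 1) ^ 2 * 4)))%R by (field; lra).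
        apply Rmult_le_compat_r; [|lra]. apply Rmult_le_pos; auto. pose proof (inv_pow_pos (INR n + 1) 2 ltac:(lra)). lra.
    + apply is_lim_seq_const.
    + replace (Finite 0) with (Rbar_mult (8 * K)%R 0) by (simpl; f_equal; ring).
      apply is_lim_seq_scal_l. 
      apply is_lim_seq_ext with (u := fun n => (/ INR (S n))%R). { intros n. rewrite S_INR. reflexivity. }
      apply (is_lim_seq_incr_1 (fun n => (/ INR n)%R)).
      replace (Finite 0) with (Rbar_inv p_infty) by reflexivity.
      apply is_lim_seq_inv. apply is_lim_seq_INR. discriminate.
Qed.

(** The box sums of [zeta (z + w) - zeta z] telescope to sums over two sides of the box,
    up to terms independent of [z]. *)
Lemma zeta_shift_const (w : C) (z z' : C) : w = 1 \/ w = tau -> off_lattice tau z -> off_lattice tau z' ->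
  zeta tau (z + w) - zeta tau z = zeta tau (z' + w) - zeta tau z'.
Proof.
  intros Hw Hz Hz'.
  assert (Lw' : in_lattice tau w) by (destruct Hw as [-> | ->]; [apply in_lattice_1|apply in_lattice_tau]).
  pose proof (zeta_box_limit _ Hz) as L1. pose proof (zeta_box_limit _ Hz') as L2.
  pose proof (zeta_box_limit _ (off_lattice_plus _ _ _ Lw' Hz)) as L3. pose proof (zeta_box_limit _ (off_lattice_plus _ _ _ Lw' Hz')) as L4.
  pose proof (Clim_plus _ _ _ _ (Clim_plus _ _ _ _ L3 (Clim_scal (- (1)) _ _ L1))
               (Clim_scal (- (1)) _ _ (Clim_plus _ _ _ _ L4 (Clim_scal (- (1)) _ _ L2)))) as L.
  assert (Z : Clim (fun N => box_sum N (zeta_summand (z + w)) + - (1) * box_sum N (zeta_summand z)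
              + - (1) * (box_sum N (zeta_summand (z' + w)) + - (1) * box_sum N (zeta_summand z'))) 0).
  { assert (E : forall N, box_sum N (zeta_summand (z + w)) + - (1) * box_sum N (zeta_summand z)
              + - (1) * (box_sum N (zeta_summand (z' + w)) + - (1) * box_sum N (zeta_summand z')) =
       box_sum N (fun m n => (1 / (z + w - lattice_point tau m n) - 1 / (z' + w - lattice_point tau m n))
                        + - (1) * (1 / (z - lattice_point tau m n) - 1 / (z' - lattice_point tau m n)))).
    { intros N. rewrite <- !box_sum_scal, <- !box_sum_plus, <- !box_sum_scal, <- !box_sum_plus. apply box_sum_ext. intros m n.
      unfold zeta_summand, on_nonzero, Cdiv. destruct (Z.eqb m 0 && Z.eqb n 0)%bool; ring. }
    set (phi := fun m n => 1 / (z - lattice_point tau m n) - 1 / (z' - lattice_point tau m n)).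
    destruct Hw as [-> | ->].
    - apply Clim_ext with (u := fun N => zsum N (fun n => phi (- Z.of_nat N - 1)%Z n) + - (1) * zsum N (fun n => phi (Z.of_nat N) n)).
      + intros N. rewrite E. rewrite box_sum_plus, box_sum_scal.
        assert (E2 : box_sum N (fun m n => 1 / (z + 1 - lattice_point tau m n) - 1 / (z' + 1 - lattice_point tau m n))
           = box_sum N (fun m n => phi (m - 1)%Z n)).
        { apply box_sum_ext. intros m n. unfold phi, lattice_point. rewrite minus_IZR, RtoC_minus.
          replace (z + 1 - (RtoC (IZR m) + RtoC (IZR n) * tau)) with (z - (RtoC (IZR m) - RtoC 1 + RtoC (IZR n) * tau)) by ring.
          replace (z' + 1 - (RtoC (IZR m) + RtoC (IZR n) * tau)) with (z' - (RtoC (IZR m) - RtoC 1 + RtoC (IZR n) * tau)) by ring.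
          reflexivity. }
        rewrite E2. unfold box_sum. rewrite (zsum_shift N (fun m => zsum N (fun n => phi m n))). fold phi. unfold phi. ring.
      + replace (RtoC 0) with (0 + - (1) * 0) by ring. apply Clim_plus; [|apply Clim_scal].
        * apply (boundary_small z z' (fun N k => ((- Z.of_nat N - 1)%Z, k))); auto.
          intros N k. simpl. unfold weight. replace (- Z.of_nat N - 1)%Z with (- Z.of_nat (S N))%Z by lia.
          rewrite opp_IZR, Rabs_Ropp, <- INR_IZR_INZ, S_INR. pose proof (pos_INR N). rewrite Rabs_pos_eq by lra. pose proof (Rabs_pos (IZR k)). lra.
        * apply (boundary_small z z' (fun N k => (Z.of_nat N, k))); auto.
          intros N k. simpl. unfold weight. rewrite <- INR_IZR_INZ. pose proof (pos_INR N). rewrite Rabs_pos_eq by lra. pose proof (Rabs_pos (IZR k)). lra.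
    - apply Clim_ext with (u := fun N => zsum N (fun m => phi m (- Z.of_nat N - 1)%Z) + - (1) * zsum N (fun m => phi m (Z.of_nat N))).
      + intros N. rewrite E. rewrite box_sum_plus, box_sum_scal.
        assert (E2 : box_sum N (fun m n => 1 / (z + tau - lattice_point tau m n) - 1 / (z' + tau - lattice_point tau m n))
           = box_sum N (fun m n => phi m (n - 1)%Z)).
        { apply box_sum_ext. intros m n. unfold phi, lattice_point. rewrite minus_IZR, RtoC_minus.
          replace (z + tau - (RtoC (IZR m) + RtoC (IZR n) * tau)) with (z - (RtoC (IZR m) + (RtoC (IZR n) - RtoC 1) * tau)) by ring.
          replace (z' + tau - (RtoC (IZR m) + RtoC (IZR n) * tau)) with (z' - (RtoC (IZR m) + (RtoC (IZR n) - RtoC 1) * tau)) by ring.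
          reflexivity. }
        rewrite E2. unfold box_sum.
        rewrite (zsum_switch N N (fun m n => phi m (n - 1)%Z)).
        rewrite (zsum_switch N N (fun m n => 1 / (z - lattice_point tau m n) - 1 / (z' - lattice_point tau m n))).
        rewrite (zsum_shift N (fun n => zsum N (fun m => phi m n))). unfold phi. ring.
      + replace (RtoC 0) with (0 + - (1) * 0) by ring. apply Clim_plus; [|apply Clim_scal].
        * apply (boundary_small z z' (fun N k => (k, (- Z.of_nat N - 1)%Z))); auto.
          intros N k. simpl. unfold weight. replace (- Z.of_nat N - 1)%Z with (- Z.of_nat (S N))%Z by lia.
          rewrite opp_IZR, Rabs_Ropp, <- INR_IZR_INZ, S_INR. pose proof (pos_INR N). rewrite (Rabs_pos_eq (INR N + 1)) by lra. pose proof (Rabs_pos (IZR k)). lra.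
        * apply (boundary_small z z' (fun N k => (k, Z.of_nat N))); auto.
          intros N k. simpl. unfold weight. rewrite <- INR_IZR_INZ. pose proof (pos_INR N). rewrite (Rabs_pos_eq (INR N)) by lra. pose proof (Rabs_pos (IZR k)). lra. }
  pose proof (Clim_unique _ _ _ L Z) as E.
  replace (zeta tau (z + w) - zeta tau z) with
    (zeta tau (z + w) + - (1) * zeta tau z + - (1) * (zeta tau (z' + w) + - (1) * zeta tau z') + (zeta tau (z' + w) - zeta tau z')) by ring.
  rewrite E. ring.
Qed.

Lemma off_lattice_half : off_lattice tau (1 / 2).
Proof.
  intros [m [n E]]. unfold lattice_point in E.
  assert (E2 : Im (1 / 2) = Im (RtoC (IZR m) + RtoC (IZR n) * tau)) by (rewrite E; reflexivity).
  assert (Hh : 1 / 2 = RtoC (1 / 2)) by (rewrite RtoC_div; auto; lra).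
  rewrite Hh in E, E2.
  assert (E3 : (IZR n * Im tau)%R = 0%R).
  { transitivity (Im (RtoC (1 / 2))); [rewrite E2|reflexivity]. unfold Im, RtoC, Cplus, Cmult; simpl. ring. }
  assert (Hn : n = 0%Z). { apply eq_IZR. apply Rmult_integral in E3. destruct E3; auto; lra. }
  subst n. replace (RtoC (IZR m) + 0%R * tau) with (RtoC (IZR m)) in E by ring.
  apply RtoC_inj in E. assert (E4 : IZR (2 * m) = IZR 1) by (rewrite mult_IZR; lra). apply eq_IZR in E4. lia.
Qed.

Lemma omega_lattice k : in_lattice tau (omega tau k).
Proof.
  destruct k as [|[|[|k]]]; simpl. apply in_lattice_0. apply in_lattice_1. apply in_lattice_tau.
  apply in_lattice_plus. apply in_lattice_1. apply in_lattice_tau.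
Qed.

(** For the third period, compose the translations by 1 and [tau]; then [eta] is the unique
    constant with this property. *)
Lemma zeta_omega k z : off_lattice tau z -> zeta tau (z + omega tau k) = zeta tau z + eta tau k.
Proof.
  intros Hz.
  assert (X : forall z z', off_lattice tau z -> off_lattice tau z' ->
     zeta tau (z + omega tau k) - zeta tau z = zeta tau (z' + omega tau k) - zeta tau z').
  { clear z Hz. intros z z' Hz Hz'. destruct k as [|[|[|k]]]; simpl.
    - replace (z + 0) with z by ring. replace (z' + 0) with z' by ring. ring.
    - apply zeta_shift_const; auto.
    - apply zeta_shift_const; auto.
    - replace (z + (1 + tau)) with (z + 1 + tau) by ring. replace (z' + (1 + tau)) with (z' + 1 + tau) by ring.
      pose proof (zeta_shift_const 1 z z' (or_introl eq_refl) Hz Hz') as E1.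
      pose proof (zeta_shift_const tau (z + 1) (z' + 1) (or_intror eq_refl)
        (off_lattice_plus _ _ _ (in_lattice_1 tau) Hz) (off_lattice_plus _ _ _ (in_lattice_1 tau) Hz')) as E2.
      replace (zeta tau (z + 1 + tau) - zeta tau z) with
        (zeta tau (z + 1 + tau) - zeta tau (z + 1) + (zeta tau (z + 1) - zeta tau z)) by ring.
      rewrite E2, E1. ring. }
  destruct (Nat.eq_dec k 0) as [->|Hk].
  { simpl. replace (z + 0) with z by ring. ring. }
  assert (E : forall z, ~ in_lattice tau z -> zeta tau (z + omega tau k) - zeta tau z = eta tau k).
  { assert (Q : exists ! c, forall z, ~ in_lattice tau z -> zeta tau (z + omega tau k) - zeta tau z = c).
    { exists (zeta tau (1 / 2 + omega tau k) - zeta tau (1 / 2)). split.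
      - intros y Hy. apply X; auto. apply off_lattice_half.
      - intros c Hc. apply Hc. apply off_lattice_half. }
    pose proof (iota_correct (V := C_CompleteNormedModule) _ Q) as I.
    destruct k as [|k]; [lia|]. exact I. }
  rewrite <- (E z Hz). ring.
Qed.

Lemma zeta_lattice m n : exists c, forall z, off_lattice tau z -> zeta tau (z + lattice_point tau m n) = zeta tau z + c.
Proof.
  assert (X : forall w, in_lattice tau w -> (exists c, forall z, off_lattice tau z -> zeta tau (z + w) = zeta tau z + c) ->
     forall k, exists c, forall z, off_lattice tau z -> zeta tau (z + RtoC (IZR k) * w) = zeta tau z + c).
  { intros w weight [c Hc] k. pattern k. apply Z_ind_iff.
    - exists 0. intros z _. replace (z + 0%R * w) with z by ring. ring.
    - intros k'. 
      assert (Lk : in_lattice tau (RtoC (IZR k') * w)).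
      { clear - weight. destruct weight as [m [n ->]]. exists (k' * m)%Z, (k' * n)%Z.
        unfold lattice_point. rewrite !mult_IZR, !RtoC_mult. ring. }
      assert (E : forall z, z + RtoC (IZR (k' + 1)) * w = z + RtoC (IZR k') * w + w).
      { intros. rewrite plus_IZR, RtoC_plus. ring. }
      split; intros [d Hd].
      + exists (d + c). intros z Hz. rewrite E, Hc, Hd; auto. ring. apply off_lattice_plus; auto.
      + exists (d - c). intros z Hz. pose proof (Hd z Hz) as H1. rewrite E, Hc in H1 by (apply off_lattice_plus; auto).
        replace (zeta tau (z + RtoC (IZR k') * w)) with (zeta tau (z + RtoC (IZR k') * w) + c - c) by ring.
        rewrite H1. ring. }
  destruct (X 1 (in_lattice_1 tau)) with (k := m) as [c1 H1].
  { exists (eta tau 1). intros z Hz. apply (zeta_omega 1 z Hz). }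
  destruct (X tau (in_lattice_tau tau)) with (k := n) as [c2 H2].
  { exists (eta tau 2). intros z Hz. apply (zeta_omega 2 z Hz). }
  exists (c1 + c2). intros z Hz. unfold lattice_point.
  replace (z + (RtoC (IZR m) + RtoC (IZR n) * tau)) with (z + RtoC (IZR m) * 1 + RtoC (IZR n) * tau) by ring.
  rewrite H2, H1; auto. ring. apply off_lattice_plus; auto. exists m, 0%Z. unfold lattice_point. ring.
Qed.

End Zeta.

(** * Derivatives of meromorphic functions *)

Lemma near'_der (a : C) (f g g' : C -> C) : near' a (fun z => f z = g z) -> near' a (fun z => der g z (g' z)) ->
  near' a (fun z => der f z (g' z)).
Proof.
  intros H D. apply (near'_imp2 (near'_near H) D). intros z _ h d.
  apply der_ext with (f := g); auto. revert h. apply near_imp. intros y e. symmetry. exact e.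
Qed.

Lemma near'_C_derive (a : C) (f g g' : C -> C) : near' a (fun z => f z = g z) -> near' a (fun z => der g z (g' z)) ->
  near' a (fun z => C_derive f z = g' z).
Proof.
  intros H D. generalize (near'_der a f g g' H D). apply near'_imp. intros z _. apply der_C_derive.
Qed.

(** Differentiating [f = v / (z - a) ^ n] with the denominator cleared.  Keeping [n]
    symbolic allows poles of unknown order to be treated. *)
Lemma mero_der (f v : C -> C) (a : C) (n : nat) : hol a v -> near' a (fun z => (z - a) ^ n * f z = v z) ->
  near' a (fun z => der f z (C_derive f z)) /\
  near' a (fun z => (z - a) ^ S n * C_derive f z = (z - a) * C_derive v z - RtoC (INR n) * v z).
Proof.
  intros Hv E. destruct (hol_C_derive _ _ Hv) as [_ Dv].
  assert (E2 : near' a (fun z => f z = (1 / (z - a)) ^ n * v z)).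
  { revert E. apply near'_imp. intros z N <-. apply Csub_neq in N. pose proof (Cpow_nz _ n N).
    replace (1 / (z - a)) with (/ (z - a)) by (field; auto). rewrite Cpow_inv by auto. field. auto. }
  assert (D : near' a (fun z => der (fun z => (1 / (z - a)) ^ n * v z) z
     (- (RtoC (INR n) * (1 / (z - a)) ^ S n) * v z + (1 / (z - a)) ^ n * C_derive v z))).
  { generalize (near_near' Dv). apply near'_imp. intros z N d.
    apply (der_mult (fun z => (1 / (z - a)) ^ n) v); auto. apply der_inv_pow; auto. }
  pose proof (near'_der _ _ _ _ E2 D) as D2. split.
  - revert D2. apply near'_imp. intros z _ d. rewrite (der_C_derive _ _ _ d). exact d.
  - revert D2. apply near'_imp. intros z N d. rewrite (der_C_derive _ _ _ d).
    apply Csub_neq in N. pose proof (Cpow_nz _ n N).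
    replace (1 / (z - a)) with (/ (z - a)) by (field; auto). rewrite !Cpow_inv by auto. simpl. field. auto.
Qed.

Lemma mero_C_derive f a : meromorphic_at f a ->
  meromorphic_at (C_derive f) a /\ near' a (fun z => der f z (C_derive f z)).
Proof.
  intros H. apply mero_iff in H. destruct H as [n [v [Hv E]]].
  destruct (mero_der _ _ _ _ Hv E) as [D D2]. split; auto.
  apply mero_iff. exists (S n), (fun z => (z - a) * C_derive v z - RtoC (INR n) * v z). split; auto.
  analytic.
Qed.

Lemma mer_derive_shift (f : C -> C) (w : C) : meromorphic f -> mer_eq (fun z => f (z + w)) f ->
  mer_eq (fun z => C_derive f (z + w)) (C_derive f).
Proof.
  intros Hf H a.
  destruct (mero_C_derive f (a + w) (Hf _)) as [_ D]. apply near'_translate in D.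
  assert (D2 : near' a (fun z => der (fun y => f (y + w)) z (C_derive f (z + w)))).
  { revert D. apply near'_imp. intros z _. apply der_translate. }
  assert (H' : near' a (fun z => f z = f (z + w))).
  { generalize (H a). apply near'_imp. intros; congruence. }
  generalize (near'_C_derive a f (fun z => f (z + w)) _ H' D2). apply near'_imp. intros; congruence.
Qed.

Section Half.
Context (tau : C) (Ht : (0 < Im tau)%R).

(** * Half periods *)

Lemma lattice_coords x y : in_lattice tau (RtoC x + RtoC y * tau) -> exists m n : Z, x = IZR m /\ y = IZR n.
Proof.
  intros [m [n E]]. exists m, n. unfold lattice_point in E.
  assert (E3 : (y * Im tau = IZR n * Im tau)%R).
  { transitivity (Im (RtoC x + RtoC y * tau)). unfold Im, RtoC, Cplus, Cmult; simpl; ring.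
    rewrite E. unfold Im, RtoC, Cplus, Cmult; simpl; ring. }
  assert (Ey : y = IZR n). { apply Rmult_eq_reg_r with (Im tau); lra. }
  split; auto. apply RtoC_inj.
  replace (RtoC x) with (RtoC x + RtoC y * tau - RtoC y * tau) by ring. rewrite E, Ey. ring.
Qed.

Definition half_period (k : nat) : C := omega tau k / 2.
(** The points where none of the four translates of zeta and wp has a pole. *)
Definition regular_pt (z : C) : Prop := forall k, (k <= 3)%nat -> off_lattice tau (z - half_period k).

Lemma half_period_coords k : (k <= 3)%nat -> exists x y : R, half_period k = RtoC (x / 2) + RtoC (y / 2) * tau /\
  match k with 0%nat => x = 0 /\ y = 0 | 1%nat => x = 1 /\ y = 0 | 2%nat => x = 0 /\ y = 1 | _ => x = 1 /\ y = 1 end%R.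
Proof.
  intros Hk. pose proof C2_nz as H2.
  destruct k as [|[|[|[|k]]]]; [| | | |lia].
  - exists 0%R, 0%R. split; auto. unfold half_period; simpl. rewrite !RtoC_div by lra. field; auto.
  - exists 1%R, 0%R. split; auto. unfold half_period; simpl. rewrite !RtoC_div by lra. field; auto.
  - exists 0%R, 1%R. split; auto. unfold half_period; simpl. rewrite !RtoC_div by lra. field; auto.
  - exists 1%R, 1%R. split; auto. unfold half_period; simpl. rewrite !RtoC_div by lra. field; auto.
Qed.

Lemma not_half_int (x : R) (m : Z) : (x = 1 / 2 \/ x = - (1 / 2))%R -> x <> IZR m.
Proof.
  intros H E. destruct H as [H|H].
  - assert (E4 : IZR (2 * m) = IZR 1) by (rewrite mult_IZR; lra). apply eq_IZR in E4. lia.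
  - assert (E4 : IZR (2 * m) = IZR (-1)) by (rewrite mult_IZR; lra). apply eq_IZR in E4. lia.
Qed.

(** In the coordinates with respect to 1 and [tau] one of the entries is 1/2 or -1/2. *)
Lemma half_period_diff j k : (j <= 3)%nat -> (k <= 3)%nat -> j <> k -> off_lattice tau (half_period k - half_period j).
Proof.
  intros Hj Hk N H.
  destruct (half_period_coords j Hj) as [x [y [E P]]]. destruct (half_period_coords k Hk) as [x' [y' [E' P']]].
  rewrite E, E' in H.
  replace (RtoC (x' / 2) + RtoC (y' / 2) * tau - (RtoC (x / 2) + RtoC (y / 2) * tau))
    with (RtoC (x' / 2 - x / 2) + RtoC (y' / 2 - y / 2) * tau) in H by (rewrite !RtoC_minus; ring).
  apply lattice_coords in H. destruct H as [m [n [H1 H2]]].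
  destruct j as [|[|[|[|j]]]]; try lia; destruct k as [|[|[|[|k]]]]; try lia;
    destruct P as [-> ->]; destruct P' as [-> ->];
    first [ exfalso; revert H1; apply not_half_int; lra | exfalso; revert H2; apply not_half_int; lra ].
Qed.

Lemma half_cases a : regular_pt a \/ exists k, (k <= 3)%nat /\ in_lattice tau (a - half_period k).
Proof.
  destruct (classic (regular_pt a)) as [|N]; auto. right.
  apply not_all_ex_not in N. destruct N as [k N]. exists k. unfold off_lattice in N. tauto.
Qed.

Lemma half_others a k j : (k <= 3)%nat -> (j <= 3)%nat -> j <> k -> in_lattice tau (a - half_period k) -> off_lattice tau (a - half_period j).
Proof.
  intros Hk Hj N H K. apply (half_period_diff j k Hj Hk N).
  replace (half_period k - half_period j) with ((a - half_period j) + - (a - half_period k)) by ring.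
  apply in_lattice_plus; auto. apply in_lattice_opp; auto.
Qed.

Lemma double_half_period k : 2 * half_period k = omega tau k.
Proof. unfold half_period. field; apply C2_nz. Qed.

Lemma half_double a k : in_lattice tau (a - half_period k) -> in_lattice tau (2 * a).
Proof.
  intros H. replace (2 * a) with ((a - half_period k) + (a - half_period k) + 2 * half_period k) by ring. rewrite double_half_period.
  apply in_lattice_plus. apply in_lattice_plus; auto. apply omega_lattice.
Qed.

(** A lattice point divided by 2 is a half period up to the lattice, by the parities of
    its coordinates. *)
Lemma off_lattice_double a : regular_pt a -> off_lattice tau (2 * a).
Proof.
  intros Hg [m [n E]].
  assert (P : forall m : Z, exists (q : Z) (r : R), (r = 0 \/ r = 1)%R /\ (IZR m / 2 = IZR q + r / 2)%R).
  { intros m'. exists (m' / 2)%Z, (IZR (m' mod 2)). split.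
    - pose proof (Z.mod_pos_bound m' 2 ltac:(lia)). assert (H0 : (m' mod 2 = 0 \/ m' mod 2 = 1)%Z) by lia.
      destruct H0 as [-> | ->]; auto.
    - rewrite (Z.div_mod m' 2) at 1 by lia. rewrite plus_IZR, mult_IZR. lra. }
  destruct (P m) as [qm [rm [Hm Em]]]. destruct (P n) as [qn [rn [Hn En]]].
  assert (Ea : a = RtoC (IZR qm + rm / 2) + RtoC (IZR qn + rn / 2) * tau).
  { rewrite <- Em, <- En. replace a with (2 * a / 2) by (field; apply C2_nz). rewrite E. unfold lattice_point.
    rewrite !RtoC_div by lra. field; apply C2_nz. }
  assert (X : exists k, (k <= 3)%nat /\ half_period k = RtoC (rm / 2) + RtoC (rn / 2) * tau).
  { pose proof C2_nz. destruct Hm as [-> | ->], Hn as [-> | ->].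
    - exists 0%nat. split; [lia|]. unfold half_period; simpl. rewrite !RtoC_div by lra. field; auto.
    - exists 2%nat. split; [lia|]. unfold half_period; simpl. rewrite !RtoC_div by lra. field; auto.
    - exists 1%nat. split; [lia|]. unfold half_period; simpl. rewrite !RtoC_div by lra. field; auto.
    - exists 3%nat. split; [lia|]. unfold half_period; simpl. rewrite !RtoC_div by lra. field; auto. }
  destruct X as [k [Hk Ek]]. apply (Hg k Hk). exists qm, qn. rewrite Ek, Ea. unfold lattice_point.
  rewrite !RtoC_plus. ring.
Qed.

Lemma regular_pt_near' (a : C) : near' a regular_pt.
Proof.
  assert (X : forall k, near' a (fun z => off_lattice tau (z - half_period k))).
  { intros k. apply (near'_translate a (- half_period k)). apply off_lattice_discrete; auto. }
  generalize (near'_and (near'_and (X 0%nat) (X 1%nat)) (near'_and (X 2%nat) (X 3%nat))).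
  apply near'_imp. intros z _ [[h0 h1] [h2 h3]] k Hk.
  destruct k as [|[|[|[|k]]]]; try lia; auto.
Qed.

Lemma regular_pt_opp z : regular_pt z -> regular_pt (- z).
Proof.
  intros H k Hk. replace (- z - half_period k) with (- (z - half_period k) + - (omega tau k)).
  apply off_lattice_plus. apply in_lattice_opp, omega_lattice. apply off_lattice_opp; auto.
  rewrite <- double_half_period. ring.
Qed.

(** * The four translates of zeta *)

Definition zeta_tr (k : nat) (z : C) : C := zeta tau (z - half_period k).
Definition wp_tr (k : nat) (z : C) : C := wp tau (z - half_period k).

Lemma zeta_tr_der k z : off_lattice tau (z - half_period k) -> der (zeta_tr k) z (- wp_tr k z).
Proof. intros H. exact (der_translate (zeta tau) (- half_period k) z _ (zeta_der tau Ht _ H)). Qed.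

Lemma zeta_tr_hol k a : off_lattice tau (a - half_period k) -> hol a (zeta_tr k).
Proof. intros H. exact (hol_translate a (- half_period k) (zeta tau) (zeta_hol tau Ht _ H)). Qed.

Lemma zeta_tr_shift k j z : off_lattice tau (z - half_period k) -> zeta_tr k (z + omega tau j) = zeta_tr k z + eta tau j.
Proof.
  intros H. unfold zeta_tr. replace (z + omega tau j - half_period k) with (z - half_period k + omega tau j) by ring.
  apply zeta_omega; auto.
Qed.

Lemma zeta_pole (b : C) : in_lattice tau b ->
  exists c v, hol 0 v /\ near' (RtoC 0) (fun x => zeta tau (b + x) = 1 / x + c + x ^ 2 * v x).
Proof.
  intros [m [n ->]]. destruct (zeta_at_0 tau Ht) as [v [Hv E]]. destruct (zeta_lattice tau Ht m n) as [c Hc].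
  exists c, v. split; auto. apply (near'_imp2 E (off_lattice_discrete tau 0 Ht)). intros x _ e h. rewrite Cplus_comm, Hc, e by auto. ring.
Qed.

Lemma zeta_tr_pole k a : in_lattice tau (a - half_period k) ->
  exists c v, hol a v /\ near' a (fun z => zeta_tr k z = 1 / (z - a) + c + (z - a) ^ 2 * v z).
Proof.
  intros H. destruct (zeta_pole _ H) as [c [v [Hv E]]].
  replace (RtoC 0) with (a + - a) in Hv, E by ring.
  exists c, (fun z => v (z + - a)). split.
  - apply hol_translate. exact Hv.
  - apply near'_translate in E. revert E. apply near'_imp.
    intros z _ E. unfold zeta_tr. replace (z - half_period k) with (a - half_period k + (z + - a)) by ring. exact E.
Qed.

(** The derivative of [zeta_tr_shift]. *)
Lemma wp_tr_shift k j z : off_lattice tau (z - half_period k) -> wp_tr k (z + omega tau j) = wp_tr k z.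
Proof.
  intros H.
  assert (D : der (fun y => zeta_tr k (y + omega tau j)) z (- wp_tr k (z + omega tau j))).
  { apply der_translate, zeta_tr_der.
    replace (z + omega tau j - half_period k) with (z - half_period k + omega tau j) by ring.
    apply off_lattice_plus; auto. apply omega_lattice. }
  assert (D2 : der (fun y => zeta_tr k (y + omega tau j)) z (- wp_tr k z + 0)).
  { apply der_ext with (f := fun y => zeta_tr k y + eta tau j).
    - generalize (near_translate z (- half_period k) _ (off_lattice_near tau (z - half_period k) Ht H)).
      apply near_imp. intros y h. symmetry. apply zeta_tr_shift; auto.
    - apply (der_plus (zeta_tr k) (fun _ => eta tau j)). apply zeta_tr_der; auto. apply der_const. }
  pose proof (der_unique _ _ _ _ D D2) as E.
  replace (wp_tr k (z + omega tau j)) with (- (- wp_tr k (z + omega tau j))) by ring. rewrite E. ring.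
Qed.

Definition zeta_sum (z : C) : C := sum4 (fun k => zeta_tr k z).
Definition wp_sum (z : C) : C := sum4 (fun k => wp_tr k z).

Lemma zeta_sum_der z : regular_pt z -> der zeta_sum z (- wp_sum z).
Proof.
  intros H. assert (D : forall k, (k <= 3)%nat -> der (zeta_tr k) z (- wp_tr k z)) by (intros; apply zeta_tr_der; auto).
  pose proof (D 0%nat ltac:(lia)). pose proof (D 1%nat ltac:(lia)).
  pose proof (D 2%nat ltac:(lia)). pose proof (D 3%nat ltac:(lia)).
  unfold zeta_sum, sum4. derive. unfold wp_sum, sum4. ring.
Qed.

Lemma comb_regular (c : nat -> C) a : regular_pt a -> hol a (fun z => sum4 (fun k => c k * zeta_tr k z)).
Proof.
  intros H. unfold sum4.
  analytic; apply zeta_tr_hol, H; lia.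
Qed.

(** Only the [k]-th translate has a pole there. *)
Lemma comb_half (c : nat -> C) a k : (k <= 3)%nat -> in_lattice tau (a - half_period k) ->
  exists u, hol a u /\ near' a (fun z => sum4 (fun k => c k * zeta_tr k z) = c k / (z - a) + u z).
Proof.
  intros Hk H. destruct (zeta_tr_pole k a H) as [d [v [Hv E]]].
  assert (N : forall j, (j <= 3)%nat -> j <> k -> hol a (zeta_tr j)).
  { intros j Hj Nj. apply zeta_tr_hol. exact (half_others a k j Hk Hj Nj H). }
  set (p := fun z => d + (z - a) ^ 2 * v z).
  assert (Hp : hol a p) by analytic.
  exists (fun z => sum4 (fun j => c j * (if Nat.eqb j k then p z else zeta_tr j z))). unfold sum4. split.
  - destruct k as [|[|[|[|k]]]]; try lia; cbn [Nat.eqb]; analytic; apply N; lia.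
  - revert E. apply near'_imp. intros z _ E.
    destruct k as [|[|[|[|k]]]]; try lia; cbn [Nat.eqb]; rewrite E; unfold p, Cdiv; ring.
Qed.

Lemma zeta_sum_regular a : regular_pt a -> hol a zeta_sum.
Proof.
  intros H. unfold zeta_sum, sum4. analytic; apply zeta_tr_hol, H; lia.
Qed.

Lemma zeta_sum_comb z : zeta_sum z = sum4 (fun k => 1 * zeta_tr k z).
Proof. unfold zeta_sum, sum4. ring. Qed.

(** * Duplication *)

Lemma zeta_double_half a k : in_lattice tau (a - half_period k) ->
  exists c v, hol a v /\ near' a (fun z => 2 * zeta tau (2 * z) = 1 / (z - a) + c + (z - a) ^ 2 * v z).
Proof.
  intros H. destruct (zeta_pole _ (half_double _ _ H)) as [c [v [Hv E]]].
  exists (2 * c), (fun z => 8 * v (2 * z + - (2 * a))). split.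
  - analytic. apply hol_affine.
    replace (2 * a + - (2 * a)) with (RtoC 0) by ring. exact Hv.
  - replace (RtoC 0) with (2 * a + - (2 * a)) in E by ring. apply near'_affine in E; [|apply C2_nz].
    revert E. apply near'_imp. intros z N E. apply Csub_neq in N.
    replace (2 * z) with (2 * a + (2 * z + - (2 * a))) at 1 by ring. rewrite E.
    replace (2 * z + - (2 * a)) with (2 * (z - a)) by ring. field; repeat split; auto using C2_nz.
Qed.

(** The difference has no poles, since both sides have residue 1 at the half periods, and
    it has periods 1 and [tau], since both sides change by the same multiple of [eta]. *)
Lemma duplication : exists c, mer_eq zeta_sum (fun z => 2 * zeta tau (2 * z) + c).
Proof.
  destruct (liouville tau (fun z => zeta_sum z - 2 * zeta tau (2 * z)) Ht) as [c Hc].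
  - intros a. destruct (half_cases a) as [Hg | [k [Hk Hh]]].
    + apply hol_removable. analytic.
      * apply zeta_sum_regular; auto.
      * apply hol_ext_all with (u := fun z => zeta tau (2 * z + 0)). { intros; f_equal; ring. }
        apply hol_affine. replace (2 * a + 0) with (2 * a) by ring. apply zeta_hol; auto. apply off_lattice_double; auto.
    + destruct (comb_half (fun _ => 1) a k Hk Hh) as [u [Hu E1]].
      destruct (zeta_double_half a k Hh) as [c [v [Hv E2]]].
      exists (fun z => u z - (c + (z - a) ^ 2 * v z)). split.
      * analytic.
      * apply (near'_imp2 E1 E2). intros z _ e1 e2. rewrite zeta_sum_comb, e1, e2. ring.
  - intros a. generalize (regular_pt_near' a). apply near'_imp. intros z _ Hg. unfold zeta_sum, sum4.
    rewrite !(zeta_tr_shift _ 1 z) by (apply Hg; lia).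
    replace (2 * (z + 1)) with (2 * z + 1 + 1) by ring. pose proof (off_lattice_double _ Hg) as H2.
    pose proof (zeta_omega tau Ht 1 _ H2) as A1.
    pose proof (zeta_omega tau Ht 1 _ (off_lattice_plus _ _ _ (in_lattice_1 tau) H2)) as A2.
    simpl omega in A1, A2. rewrite A2, A1. ring.
  - intros a. generalize (regular_pt_near' a). apply near'_imp. intros z _ Hg. unfold zeta_sum, sum4.
    rewrite !(zeta_tr_shift _ 2 z) by (apply Hg; lia).
    replace (2 * (z + tau)) with (2 * z + tau + tau) by ring. pose proof (off_lattice_double _ Hg) as H2.
    pose proof (zeta_omega tau Ht 2 _ H2) as A1.
    pose proof (zeta_omega tau Ht 2 _ (off_lattice_plus _ _ _ (in_lattice_tau tau) H2)) as A2.
    simpl omega in A1, A2. rewrite A2, A1. ring.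
  - exists c. intros a. generalize (Hc a). apply near'_imp. intros z _ E. rewrite <- E. ring.
Qed.

(** Differentiating [duplication], the constant term of the sum of the [wp_tr] comes from
    the linear term of zeta at 0, which vanishes.  At the half period 0 this is the classical
    relation e1 + e2 + e3 = 0. *)
Lemma wp_sum_half a k : (k <= 3)%nat -> in_lattice tau (a - half_period k) ->
  exists v, hol a v /\ near' a (fun z => wp_sum z = 1 / (z - a) ^ 2 + (z - a) * v z).
Proof.
  intros Hk Hh. destruct duplication as [c0 Hdup].
  destruct (zeta_double_half a k Hh) as [c [v [Hv E2]]].
  destruct (hol_C_derive _ _ Hv) as [Hv' Dv].
  exists (fun z => - (2 * v z + (z - a) * C_derive v z)). split.
  - analytic.
  - assert (E : near' a (fun z => zeta_sum z = 1 / (z - a) + (c + c0) + (z - a) * (z - a) * v z)).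
    { apply (near'_imp2 (Hdup a) E2). intros z _ e1 e2. rewrite e1, e2. ring. }
    apply (near'_imp3 (near'_near E) (regular_pt_near' a) (near_near' Dv)). intros z N e g d.
    pose proof (zeta_sum_der z g) as D1.
    assert (D2 : der zeta_sum z (- (1 / (z - a) ^ 2) + (2 * (z - a) * v z + (z - a) * (z - a) * C_derive v z))).
    { apply der_ext with (f := fun z => 1 / (z - a) + (c + c0) + (z - a) * (z - a) * v z).
      { revert e. apply near_imp. intros y ey. symmetry. exact ey. }
      derive. ring. }
    pose proof (der_unique _ _ _ _ D1 D2) as F. apply Csub_neq in N.
    replace (wp_sum z) with (- (- wp_sum z)) by ring. rewrite F. field. auto.
Qed.

Lemma wp_sum_regular a : regular_pt a -> hol a wp_sum.
Proof.
  intros H.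
  destruct (hol_der _ _ (zeta_sum_regular a H)) as [u [Hu D]].
  assert (Gn : near a regular_pt).
  { destruct (proj1 (near'_iff _ _) (regular_pt_near' a)) as [d [Hd Dd]]. apply near_iff. exists d. split; auto.
    intros z Hz. destruct (Ceq_dec z a) as [->|Hn]; auto. }
  apply hol_ext with (u := fun z => - u z).
  - generalize (near_and Gn D). apply near_imp. intros z [g d].
    pose proof (der_unique _ _ _ _ d (zeta_sum_der z g)) as E. rewrite E. cring.
  - analytic.
Qed.

Lemma eta_3 : eta tau 3 = eta tau 1 + eta tau 2.
Proof.
  pose proof (off_lattice_half tau Ht) as H.
  pose proof (zeta_omega tau Ht 3 _ H) as E3. pose proof (zeta_omega tau Ht 1 _ H) as E1.
  pose proof (zeta_omega tau Ht 2 _ (off_lattice_plus _ _ _ (in_lattice_1 tau) H)) as E2.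
  simpl omega in *. replace (1 / 2 + (1 + tau)) with (1 / 2 + 1 + tau) in E3 by ring.
  rewrite E2, E1 in E3. replace (eta tau 3) with (zeta tau (1 / 2) + eta tau 3 - zeta tau (1 / 2)) by ring.
  rewrite <- E3. ring.
Qed.

(** * The odd elliptic functions G *)

(** [G l] is [Fl] at [T = 0] with the sign reversed; it is a branch of
    2 sqrt(wp(2z) - e_l). *)
Definition G (l : nat) (z : C) : C := sum4 (fun k => eps l k * zeta_tr k z) - eta tau (3 - l).

Lemma l_cases (l : nat) : (1 <= l <= 3)%nat -> l = 1%nat \/ l = 2%nat \/ l = 3%nat.
Proof. lia. Qed.

Lemma eps_sq l k : eps l k * eps l k = 1.
Proof. unfold eps. destruct (_ || _)%bool; ring. Qed.

Lemma eps_sum l : (1 <= l <= 3)%nat -> sum4 (eps l) = 0.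
Proof. intros H. destruct (l_cases l H) as [-> | [-> | ->]]; unfold sum4, eps; simpl; ring. Qed.

(** The four translates of zeta change by the same constant, and the signs add up to 0. *)
Lemma G_shift l z w : (1 <= l <= 3)%nat -> regular_pt z -> in_lattice tau w -> G l (z + w) = G l z.
Proof.
  intros Hl Hg [m [n ->]]. destruct (zeta_lattice tau Ht m n) as [c Hc].
  assert (E : forall k, (k <= 3)%nat -> zeta_tr k (z + lattice_point tau m n) = zeta_tr k z + c).
  { intros k Hk. unfold zeta_tr. replace (z + lattice_point tau m n - half_period k) with (z - half_period k + lattice_point tau m n) by ring.
    apply Hc, Hg, Hk. }
  unfold G, sum4. rewrite !E by lia. pose proof (eps_sum l Hl) as S. unfold sum4 in S.
  match goal with |- ?a = ?b => replace a with (b + c * (eps l 0 + eps l 1 + eps l 2 + eps l 3)) by ring end.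
  rewrite S. ring.
Qed.

Lemma zeta_tr_odd k z : (k <= 3)%nat -> regular_pt z -> zeta_tr k (- z) = - (zeta_tr k z + eta tau k).
Proof.
  intros Hk Hg. unfold zeta_tr. replace (- z - half_period k) with (- (z - half_period k + omega tau k)).
  2: { rewrite <- double_half_period. ring. }
  rewrite zeta_odd; auto. rewrite zeta_omega; auto. apply off_lattice_plus; auto. apply omega_lattice.
Qed.

(** Reflecting [z] contributes [eta tau k] to the [k]-th translate, and
    [eta tau 3 = eta tau 1 + eta tau 2] makes the signed sum of these equal to
    [- 2 * eta tau (3 - l)]. *)
Lemma G_odd l z : (1 <= l <= 3)%nat -> regular_pt z -> G l (- z) = - G l z.
Proof.
  intros Hl Hg. unfold G, sum4. rewrite !zeta_tr_odd by (auto; lia). pose proof eta_3 as E3.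
  assert (E0 : eta tau 0 = 0) by reflexivity.
  destruct (l_cases l Hl) as [-> | [-> | ->]]; simpl Nat.sub; unfold eps; simpl (_ || _)%bool; cbv iota;
    rewrite E3, E0; ring.
Qed.

Lemma G_regular l a : regular_pt a -> hol a (G l).
Proof.
  intros H. unfold G. analytic. apply comb_regular; auto.
Qed.

(** As [2 * a] is a period, [G l] is odd about [a]; this removes the constant term. *)
Lemma G_half l a k : (1 <= l <= 3)%nat -> (k <= 3)%nat -> in_lattice tau (a - half_period k) ->
  exists u, hol a u /\ near' a (fun z => G l z = eps l k / (z - a) + (z - a) * u z).
Proof.
  intros Hl Hk Hh. destruct (comb_half (eps l) a k Hk Hh) as [u0 [Hu0 E0]].
  set (u := fun z => u0 z - eta tau (3 - l)).
  assert (Hu : hol a u) by analytic.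
  assert (E : near' a (fun z => G l z = eps l k / (z - a) + u z)).
  { revert E0. apply near'_imp. intros z _ E. unfold G, u. rewrite E. ring. }
  assert (Ua : u a = 0).
  { assert (E2a : 2 * a - a = a) by ring.
    assert (S : u a = - u (2 * a - a)).
    { apply (hol_eq a u (fun z => - u (2 * a - z))); auto.
      - analytic. apply hol_reflect. rewrite E2a. exact Hu.
      - assert (E' := E). rewrite <- E2a in E' at 1. apply near'_reflect in E'.
        apply (near'_imp3 E E' (regular_pt_near' a)). intros z N e1 e2 g.
        assert (S : G l (2 * a - z) = - G l z).
        { replace (2 * a - z) with (- z + 2 * a) by ring. rewrite G_shift, G_odd; auto. apply regular_pt_opp; auto.
          eapply half_double; eauto. }
        rewrite S, e1 in e2. apply Csub_neq in N.
        replace (u (2 * a - z)) with (eps l k / (2 * a - z - a) + u (2 * a - z) - eps l k / (2 * a - z - a)) by ring.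
        rewrite <- e2. replace (2 * a - z - a) with (- (z - a)) by ring. field. auto. }
    rewrite E2a in S.
    replace (u a) with ((u a - - u a) / 2) by (field; apply C2_nz). rewrite S at 1. field; apply C2_nz. }
  destruct (hol_div _ _ Hu) as [v [Hv Ev]]. exists v. split; auto.
  apply (near'_imp2 E (near_near' Ev)). intros z _ e1 e2.
  rewrite e1, e2, Ua. ring.
Qed.

Lemma wp_sum_shift z j : regular_pt z -> wp_sum (z + omega tau j) = wp_sum z.
Proof. intros H. unfold wp_sum, sum4. rewrite !wp_tr_shift by (apply H; lia). reflexivity. Qed.

(** The double poles cancel because [eps l k ^ 2 = 1], and there are no simple poles
    because neither expansion has the term that would produce one. *)
Lemma G_square_half l a k : (1 <= l <= 3)%nat -> (k <= 3)%nat -> in_lattice tau (a - half_period k) ->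
  exists u w, hol a u /\ hol a w /\ near' a (fun z => G l z = eps l k / (z - a) + (z - a) * u z) /\
    near' a (fun z => G l z ^ 2 - wp_sum z = w z) /\ w a = 2 * eps l k * u a.
Proof.
  intros Hl Hk Hh.
  destruct (G_half l a k Hl Hk Hh) as [u [Hu E1]]. destruct (wp_sum_half a k Hk Hh) as [v [Hv E2]].
  exists u, (fun z => 2 * eps l k * u z + (z - a) ^ 2 * (u z * u z) - (z - a) * v z).
  split; auto. split; [analytic|]. split; auto. split; [|ring].
  apply (near'_imp2 E1 E2). intros z N e1 e2. rewrite e1, e2.
  apply Csub_neq in N. set (x := z - a) in *. pose proof (eps_sq l k) as S.
  replace ((eps l k / x + x * u z) ^ 2 - (1 / x ^ 2 + x * v z)) with
    ((eps l k * eps l k - 1) / x ^ 2 + 2 * eps l k * u z + x ^ 2 * (u z * u z) - x * v z) by (field; auto).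
  rewrite S. field. auto.
Qed.

Lemma G_square l : (1 <= l <= 3)%nat -> exists Cc, mer_eq (fun z => G l z ^ 2 - wp_sum z) (fun _ => Cc).
Proof.
  intros Hl. apply (liouville tau _ Ht).
  - intros a. destruct (half_cases a) as [Hg | [k [Hk Hh]]].
    + apply hol_removable. analytic. apply G_regular; auto. apply wp_sum_regular; auto.
    + destruct (G_square_half l a k Hl Hk Hh) as [u [w [_ [Hw [_ [E _]]]]]]. exists w. auto.
  - intros a. generalize (regular_pt_near' a). apply near'_imp. intros z _ Hg.
    pose proof (wp_sum_shift z 1 Hg) as A. simpl omega in A. rewrite G_shift, A; auto. apply in_lattice_1.
  - intros a. generalize (regular_pt_near' a). apply near'_imp. intros z _ Hg.
    pose proof (wp_sum_shift z 2 Hg) as A. simpl omega in A. rewrite G_shift, A; auto. apply in_lattice_tau.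
Qed.

Lemma G_mero l : (1 <= l <= 3)%nat -> meromorphic (G l).
Proof.
  intros Hl a. destruct (half_cases a) as [Hg | [k [Hk Hh]]].
  - apply removable_mero, hol_removable, G_regular; auto.
  - destruct (G_half l a k Hl Hk Hh) as [u [Hu E]]. apply mero_iff.
    exists 1%nat, (fun z => eps l k + (z - a) * (z - a) * u z). split.
    + analytic.
    + revert E. apply near'_imp. intros z N E. rewrite E. apply Csub_neq in N. simpl. field. auto.
Qed.

Lemma G_elliptic l : (1 <= l <= 3)%nat -> elliptic tau (G l).
Proof.
  intros Hl. split. apply G_mero; auto. intros w Hw a. generalize (regular_pt_near' a). apply near'_imp.
  intros z _ Hg. apply G_shift; auto.
Qed.

(** At a half period the pole of [G'' - 2 G ^ 3] is a multiple of the linear Taylor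
    coefficient of [G], and that coefficient is given by the constant in [G_square]. *)
Lemma G_second_order l : (1 <= l <= 3)%nat -> exists Cc K,
  mer_eq (fun z => wp_sum z) (fun z => G l z ^ 2 + Cc) /\
  mer_eq (fun z => C_derive (C_derive (G l)) z - 2 * G l z ^ 3 - 3 * Cc * G l z) (fun _ => K).
Proof.
  intros Hl. destruct (G_square l Hl) as [C0 HC0]. exists (- C0).
  pose proof (G_mero l Hl) as M.
  assert (M1 : meromorphic (C_derive (G l))) by (intros a; apply mero_C_derive, M).
  destruct (liouville tau (fun z => C_derive (C_derive (G l)) z - 2 * G l z ^ 3 - 3 * - C0 * G l z) Ht) as [K HK].
  - intros a. destruct (half_cases a) as [Hg | [k [Hk Hh]]].
    + pose proof (G_regular l a Hg) as H0. destruct (hol_C_derive _ _ H0) as [H1 _]. destruct (hol_C_derive _ _ H1) as [H2 _].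
      apply hol_removable.
      analytic.
    + destruct (G_square_half l a k Hl Hk Hh) as [u [w [Hu [Hw [E1 [E2 Wa]]]]]].
      set (e := eps l k) in *. assert (ee : e * e = 1) by apply eps_sq.
      (* the constant G^2 - P determines the linear Taylor coefficient of G *)
      assert (U : 2 * e * u a = C0).
      { rewrite <- Wa. apply (hol_eq a w (fun _ => C0)); auto. analytic.
        apply (near'_imp2 E2 (HC0 a)). intros z _ <- e0. exact e0. }
      destruct (hol_div _ _ Hu) as [u1 [Hu1 Eu]].
      destruct (hol_C_derive _ _ Hu) as [Hu' Du]. destruct (hol_C_derive _ _ Hu') as [Hu'' Du'].
      assert (F1 : near' a (fun z => C_derive (G l) z = - e * (1 / (z - a) ^ 2) + u z + (z - a) * C_derive u z)).
      { apply (near'_C_derive a (G l) (fun z => e * (1 / (z - a)) + (z - a) * u z)).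
        { revert E1. apply near'_imp. intros z _ ->. unfold Cdiv. ring. }
        generalize (near_near' Du). apply near'_imp. intros z N d.
        derive. ring. }
      assert (F2 : near' a (fun z => C_derive (C_derive (G l)) z = 2 * e / (z - a) ^ 3 + 2 * C_derive u z + (z - a) * C_derive (C_derive u) z)).
      { apply (near'_C_derive a _ _ _ F1).
        generalize (near_near' (near_and Du Du')). apply near'_imp. intros z N [d d'].
        derive. unfold Cdiv. ring. }
      (* what remains of G'' - 2 G^3 - 3 C G for G = e / x + x u, after e^2 = 1 and
         u = u(a) + x u1 have been used to cancel the poles *)
      exists (fun z => 2 * C_derive u z + (z - a) * C_derive (C_derive u) z
               - 6 * u1 z - 6 * e * (z - a) * (u z * u z) - 2 * (z - a) ^ 3 * (u z * u z * u z) + 3 * C0 * (z - a) * u z).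
      split.
      * analytic.
      * apply (near'_imp3 E1 F2 (near_near' Eu)). intros z N e1 e2 eu. rewrite e2, e1. apply Csub_neq in N.
        set (x := z - a) in *. set (U0 := u z) in *. set (A := C_derive u z). set (B := C_derive (C_derive u) z).
        assert (Eu1 : u1 z = (U0 - u a) / x). { rewrite eu. field. auto. }
        assert (Ua : C0 = 2 * e * u a) by auto.
        assert (Ua2 : u a = e * C0 / 2). { rewrite Ua. replace (e * (2 * e * u a) / 2) with (e * e * u a) by (field; apply C2_nz). rewrite ee. ring. }
        rewrite Eu1, Ua2.
        replace (2 * e / x ^ 3 + 2 * A + x * B - 2 * (e / x + x * U0) ^ 3 - 3 * - C0 * (e / x + x * U0))
          with (2 * e * (1 - e * e) / x ^ 3 + 2 * A + x * B - 6 * (e * e) * U0 / x - 6 * e * x * (U0 * U0) - 2 * x ^ 3 * (U0 * U0 * U0) + 3 * C0 * e / x + 3 * C0 * x * U0) by (field; auto).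
        rewrite ee. field; repeat split; auto using C2_nz.
  - intros a. pose proof (mer_derive_shift _ 1 M (proj2 (G_elliptic l Hl) 1 (in_lattice_1 tau))) as S1.
    pose proof (mer_derive_shift _ 1 M1 S1) as S2.
    apply (near'_imp2 (S2 a) (regular_pt_near' a)). intros z _ -> Hg.
    rewrite G_shift; auto. apply in_lattice_1.
  - intros a. pose proof (mer_derive_shift _ tau M (proj2 (G_elliptic l Hl) tau (in_lattice_tau tau))) as S1.
    pose proof (mer_derive_shift _ tau M1 S1) as S2.
    apply (near'_imp2 (S2 a) (regular_pt_near' a)). intros z _ -> Hg.
    rewrite G_shift; auto. apply in_lattice_tau.
  - exists K. split; auto. intros a. generalize (HC0 a). apply near'_imp. intros z _ <-. ring.
Qed.

End Half.

(** * Solutions of the differential equation *)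

Lemma mero_derivs (F : C -> C) : meromorphic F ->
  meromorphic (C_derive F) /\ meromorphic (C_derive (C_derive F)) /\
  (forall a : C, near' a (fun z => der F z (C_derive F z))) /\
  (forall a : C, near' a (fun z => der (C_derive F) z (C_derive (C_derive F) z))) /\
  (forall a : C, near' a (fun z => der (C_derive (C_derive F)) z (C_derive (C_derive (C_derive F)) z))).
Proof.
  intros M0. assert (M1 : meromorphic (C_derive F)) by (intros a; apply mero_C_derive, M0).
  assert (M2 : meromorphic (C_derive (C_derive F))) by (intros a; apply mero_C_derive, M1).
  split; auto. split; auto. split; [|split]; intros a; apply mero_C_derive; auto.
Qed.

Lemma derivs3 (f g g1 g2 g3 : C -> C) (a : C) : near' a (fun z => f z = g z) ->
  near' a (fun z => der g z (g1 z)) -> near' a (fun z => der g1 z (g2 z)) -> near' a (fun z => der g2 z (g3 z)) ->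
  near' a (fun z => C_derive f z = g1 z /\ C_derive (C_derive f) z = g2 z /\ C_derive (C_derive (C_derive f)) z = g3 z).
Proof.
  intros E D1 D2 D3.
  pose proof (near'_C_derive _ _ _ _ E D1) as E1.
  pose proof (near'_C_derive _ _ _ _ E1 D2) as E2.
  pose proof (near'_C_derive _ _ _ _ E2 D3) as E3.
  generalize (near'_and E1 (near'_and E2 E3)). apply near'_imp. auto.
Qed.

Lemma sol_ext Q F F' : mer_eq F F' -> meromorphic F -> is_solution Q F -> is_solution Q F'.
Proof.
  intros E M S a. destruct (mero_derivs F M) as [M1 [M2 [D1 [D2 D3]]]].
  assert (E' : near' a (fun z => F' z = F z)) by (generalize (E a); apply near'_imp; intros; congruence).
  apply (near'_imp3 (S a) E' (derivs3 F' F _ _ _ a E' (D1 a) (D2 a) (D3 a))). intros z _ s e [e1 [e2 e3]]. rewrite e3, e1, e. exact s.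
Qed.

Lemma sol_comb (Q F G : C -> C) (c : C) : meromorphic F -> meromorphic G -> is_solution Q F -> is_solution Q G ->
  is_solution Q (fun z => c * F z + G z).
Proof.
  intros MF MG SF SG a. destruct (mero_derivs F MF) as [_ [_ [D1 [D2 D3]]]].
  destruct (mero_derivs G MG) as [_ [_ [H1 [H2 H3]]]].
  assert (L : forall f g f' g' : C -> C, near' a (fun z => der f z (f' z)) -> near' a (fun z => der g z (g' z)) ->
     near' a (fun z => der (fun z => c * f z + g z) z (c * f' z + g' z))).
  { intros f g f' g' h k. apply (near'_imp2 h k). intros z _ d e.
    apply (der_plus (fun z => c * f z) g); auto. apply der_scal; auto. }
  apply (near'_imp3 (SF a) (SG a) (derivs3 (fun z => c * F z + G z) _ _ _ _ a (near'_all a _ (fun z _ => eq_refl)) (L _ _ _ _ (D1 a) (H1 a)) (L _ _ _ _ (D2 a) (H2 a)) (L _ _ _ _ (D3 a) (H3 a)))). intros z _ s t [e1 [e2 e3]]. rewrite e3, e1.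
  transitivity (c * (C_derive (C_derive (C_derive F)) z - 4 * Q z * C_derive F z - 2 * C_derive Q z * F z)
     + (C_derive (C_derive (C_derive G)) z - 4 * Q z * C_derive G z - 2 * C_derive Q z * G z)).
  - ring.
  - rewrite s, t. ring.
Qed.

Lemma elliptic_ext tau F F' : mer_eq F F' -> elliptic tau F -> elliptic tau F'.
Proof.
  intros E [M P]. split.
  - intros a. apply mero_ext with (f := F); auto.
  - intros w Hw a. apply (near'_imp3 (P w Hw a) (E a) (near'_translate _ _ _ (E (a + w)))). intros z _ p e s. congruence.
Qed.

Lemma elliptic_comb tau (F G : C -> C) (c : C) : elliptic tau F -> elliptic tau G -> elliptic tau (fun z => c * F z + G z).
Proof.
  intros [MF PF] [MG PG]. split.
  - intros a. apply (mero_plus (fun z => c * F z)); auto. apply mero_scal; auto.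
  - intros w Hw a. apply (near'_imp2 (PF w Hw a) (PG w Hw a)). intros z _ -> ->. reflexivity.
Qed.

Lemma elliptic_const tau c : elliptic tau (fun _ => c).
Proof. split. intros a; apply mero_const. intros w Hw a. apply near'_all. auto. Qed.

Lemma ES_ext tau l T F F' : mer_eq F F' -> ES tau l T F -> ES tau l T F'.
Proof.
  intros E [HE HS]. split. eapply elliptic_ext; eauto. eapply sol_ext; eauto. apply HE.
Qed.

Lemma ES_comb tau l T (F G : C -> C) (c : C) : ES tau l T F -> ES tau l T G -> ES tau l T (fun z => c * F z + G z).
Proof.
  intros [HE HS] [KE KS]. split. apply elliptic_comb; auto. apply sol_comb; auto. apply HE. apply KE.
Qed.

Lemma ES_zero tau l T : ES tau l T (fun _ => 0).
Proof.
  split. apply elliptic_const. intros a.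
  assert (D : near' a (fun z => der (fun _ => RtoC 0) z ((fun _ => RtoC 0) z))) by (apply near'_all; intros; apply der_const).
  generalize (derivs3 (fun _ => RtoC 0) (fun _ => RtoC 0) _ _ _ a (near'_all a _ (fun z _ => eq_refl)) D D D).
  apply near'_imp. intros z _ [e1 [e2 e3]]. rewrite e3, e1. ring.
Qed.

(** * The indicial equation *)

(** Multiply the equation by [(z - a) ^ (n + 3)] and let [z] tend to [a].  With [r = - n]
    the first factor is the indicial polynomial, where [q0 a] is the coefficient of the double
    pole of the potential. *)
Lemma ode_indicial (Q F q0 v : C -> C) (a : C) (n : nat) : is_solution Q F ->
  hol a v -> near' a (fun z => (z - a) ^ n * F z = v z) ->
  hol a q0 -> near' a (fun z => (z - a) ^ 2 * Q z = q0 z) ->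
  (- (RtoC (INR (S (S n))) * RtoC (INR (S n)) * RtoC (INR n)) + 4 * RtoC (INR n) * q0 a + 4 * q0 a) * v a = 0.
Proof.
  intros S Hv Ev Hq Eq.
  destruct (mero_der _ _ _ _ Hv Ev) as [_ E1].
  set (v1 := fun z => (z - a) * C_derive v z - RtoC (INR n) * v z) in *.
  assert (H1 : hol a v1).
  { analytic. }
  destruct (mero_der _ _ _ _ H1 E1) as [_ E2].
  set (v2 := fun z => (z - a) * C_derive v1 z - RtoC (INR (Datatypes.S n)) * v1 z) in *.
  assert (H2 : hol a v2).
  { analytic. }
  destruct (mero_der _ _ _ _ H2 E2) as [_ E3].
  set (v3 := fun z => (z - a) * C_derive v2 z - RtoC (INR (Datatypes.S (Datatypes.S n))) * v2 z) in *.
  assert (H3 : hol a v3).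
  { analytic. }
  destruct (mero_der _ _ _ _ Hq Eq) as [_ Eq1].
  set (q1 := fun z => (z - a) * C_derive q0 z - RtoC (INR 2) * q0 z) in *.
  assert (Hq1 : hol a q1).
  { analytic. }
  assert (X : v3 a - 4 * q0 a * v1 a - 2 * q1 a * v a = 0).
  { apply (hol_zero a (fun z => v3 z - 4 * q0 z * v1 z - 2 * q1 z * v z)).
    - analytic.
    - generalize (near'_and (near'_and (S a) (near'_and Ev Eq)) (near'_and (near'_and E1 E3) Eq1)).
      apply near'_imp. intros z _ [[s [ev eq]] [[e1 e3] eq1]].
      change ((z - a) ^ (Datatypes.S (Datatypes.S (Datatypes.S n))) * C_derive (C_derive (C_derive F)) z = v3 z) in e3.
      change ((z - a) ^ (Datatypes.S n) * C_derive F z = v1 z) in e1.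
      change ((z - a) ^ 3 * C_derive Q z = q1 z) in eq1.
      rewrite <- e3, <- e1, <- ev, <- eq, <- eq1.
      transitivity ((z - a) ^ (Datatypes.S (Datatypes.S (Datatypes.S n))) * (C_derive (C_derive (C_derive F)) z
          - 4 * Q z * C_derive F z - 2 * C_derive Q z * F z)).
      + simpl. ring.
      + rewrite s. ring. }
  unfold v3, v2, v1, q1 in X. change (INR 2) with (1 + 1)%R in X. rewrite RtoC_plus in X.
  etransitivity; [|exact X]. ring.
Qed.

Section Final.
Context (tau : C) (Ht : (0 < Im tau)%R).

(** * The functions F are solutions *)

Lemma Fl_G l T z : Fl tau l T z = 2 * T - G tau l z.
Proof. unfold Fl, G, zeta_tr, half_period. ring. Qed.

Lemma q_G l T z : q tau l T z = 3 / 4 * wp_sum tau z + T * G tau l z + T ^ 2.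
Proof. unfold q, G, wp_sum, wp_tr, zeta_tr, half_period. ring. Qed.

Lemma Fl_elliptic l T : (1 <= l <= 3)%nat -> elliptic tau (Fl tau l T).
Proof.
  intros Hl. apply elliptic_ext with (F := fun z => - (1) * G tau l z + 2 * T).
  - intros a. apply near'_all. intros z _. rewrite Fl_G. ring.
  - apply (elliptic_comb tau (G tau l) (fun _ => 2 * T)). apply G_elliptic; auto. apply elliptic_const.
Qed.

(** With [P = G ^ 2 + C] the terms in [T] cancel, and the equation reduces to the
    derivative of [G_second_order]. *)
Lemma Fl_solution l T : (1 <= l <= 3)%nat -> is_solution (q tau l T) (Fl tau l T).
Proof.
  intros Hl a. destruct (G_second_order tau Ht l Hl) as [Cc [K [HP HK]]].
  set (g := G tau l) in *.
  destruct (mero_derivs g (G_mero tau Ht l Hl)) as [_ [_ [D1 [D2 D3]]]].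
  set (g1 := C_derive g) in *. set (g2 := C_derive g1) in *. set (g3 := C_derive g2) in *.
  specialize (D1 a). specialize (D2 a). specialize (D3 a).
  assert (G3 : near' a (fun z => g3 z = 6 * g z ^ 2 * g1 z + 3 * Cc * g1 z)).
  { assert (D0 : near' a (fun z => der (fun z => g2 z - 2 * g z ^ 3 - 3 * Cc * g z) z
        (g3 z - 6 * g z ^ 2 * g1 z - 3 * Cc * g1 z))).
    { apply (near'_imp2 D1 D3). intros z _ d1 d3.
      derive. simpl. ring. }
    apply (near'_imp2 (near'_near (HK a)) D0). intros z _ k d.
    assert (Z : der (fun z => g2 z - 2 * g z ^ 3 - 3 * Cc * g z) z (RtoC 0)).
    { apply der_ext with (f := fun _ => K). { revert k. apply near_imp. intros y e. symmetry. exact e. } apply der_const. }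
    pose proof (der_unique _ _ _ _ d Z) as E.
    replace (g3 z) with (g3 z - 6 * g z ^ 2 * g1 z - 3 * Cc * g1 z + (6 * g z ^ 2 * g1 z + 3 * Cc * g1 z)) by ring.
    rewrite E. ring. }
  assert (Eq : near' a (fun z => q tau l T z = 3 / 4 * (g z * g z + Cc) + T * g z + T ^ 2)).
  { generalize (HP a). apply near'_imp. intros z _ e. rewrite q_G, e. fold g. ring. }
  assert (Dq : near' a (fun z => C_derive (q tau l T) z = 3 / 4 * (g1 z * g z + g z * g1 z + 0) + T * g1 z + 0)).
  { apply (near'_C_derive a _ _ _ Eq). revert D1. apply near'_imp. intros z _ d.
    derive. ring. }
  assert (DF : near' a (fun z => C_derive (Fl tau l T) z = (0 - g1 z) /\ C_derive (C_derive (Fl tau l T)) z = - g2 z /\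
        C_derive (C_derive (C_derive (Fl tau l T))) z = - g3 z)).
  { apply (derivs3 _ (fun z => 2 * T - g z) (fun z => 0 - g1 z) (fun z => - g2 z) (fun z => - g3 z)).
    - apply near'_all. intros z _. apply Fl_G.
    - revert D1. apply near'_imp. intros z _ d. derive. reflexivity.
    - revert D2. apply near'_imp. intros z _ d. derive. ring.
    - revert D3. apply near'_imp. intros z _ d. apply der_opp; auto. }
  generalize (near'_and (near'_and G3 Eq) (near'_and Dq DF)). apply near'_imp.
  intros z _ [[h3 eq] [dq [e1 [_ e3]]]]. rewrite e3, e1, dq, eq, h3, Fl_G. fold g. field.
Qed.

End Final.

Section Local.
Context (tau : C) (Ht : (0 < Im tau)%R) (l : nat) (Hl : (1 <= l <= 3)%nat) (T : C).

(** * Poles of elliptic solutions *)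

Lemma RtoC_nz (x : R) : x <> 0%R -> RtoC x <> 0.
Proof. intros H E. apply H. apply RtoC_inj. exact E. Qed.

Lemma q_regular (a : C) : regular_pt tau a -> hol a (q tau l T).
Proof.
  intros H. apply hol_ext_all with (u := fun z => 3 / 4 * wp_sum tau z + T * G tau l z + T ^ 2).
  { intros z. symmetry. apply q_G. }
  analytic. apply wp_sum_regular; auto. apply G_regular; auto.
Qed.

Lemma q_half (a : C) k : (k <= 3)%nat -> in_lattice tau (a - half_period tau k) ->
  exists w, hol a w /\ near' a (fun z => q tau l T z = 3 / 4 * (1 / (z - a) ^ 2) + T * eps l k / (z - a) + w z).
Proof.
  intros Hk Hh. destruct (G_half tau Ht l a k Hl Hk Hh) as [u [Hu E1]].
  destruct (wp_sum_half tau Ht a k Hk Hh) as [v [Hv E2]].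
  exists (fun z => (z - a) * (3 / 4 * v z + T * u z) + T ^ 2). split.
  - analytic.
  - apply (near'_imp2 E1 E2). intros z N e1 e2. rewrite q_G, e1, e2. unfold Cdiv. ring.
Qed.

Context (F : C -> C) (HE : elliptic tau F) (HS : is_solution (q tau l T) F).

(** The indicial roots 0, 1, 2 exclude a pole. *)
Lemma solution_regular (a : C) : regular_pt tau a -> removable a F.
Proof.
  intros Hg. destruct (mero_cases F a (proj1 HE a)) as [|[j [v [Hv [V0 E]]]]]; auto. exfalso.
  pose proof (ode_indicial (q tau l T) F (fun z => (z - a) ^ 2 * q tau l T z) v a (S j) HS Hv E) as I.
  assert (Hq : hol a (fun z => (z - a) ^ 2 * q tau l T z)).
  { analytic. apply q_regular; auto. }
  specialize (I Hq (near'_all a _ (fun z _ => eq_refl))). cbv beta in I.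
  replace (a - a) with (RtoC 0) in I by ring.
  revert I. apply Cmult_neq_0; auto.
  replace (_ + _) with (RtoC (- (INR (S (S (S j))) * INR (S (S j)) * INR (S j)))).
  - apply RtoC_nz. rewrite !S_INR. pose proof (pos_INR j).
    assert (0 < (INR j + 1 + 1 + 1) * (INR j + 1 + 1) * (INR j + 1))%R by (repeat apply Rmult_lt_0_compat; lra). lra.
  - rewrite RtoC_opp, !RtoC_mult. ring.
Qed.

(** The indicial roots -1, 1, 3 bound the order of the pole by 1.  The coefficient of
    [(z - a) ^ (- 3)] in the equation is [6 T eps r + 3 u(a)]. *)
Lemma solution_half (a : C) k : (k <= 3)%nat -> in_lattice tau (a - half_period tau k) ->
  exists r u, hol a u /\ near' a (fun z => F z = r / (z - a) + u z) /\ u a = - 2 * T * eps l k * r.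
Proof.
  intros Hk Hh. destruct (q_half a k Hk Hh) as [w [Hw Ew]].
  set (e := eps l k) in *.
  set (q0 := fun z => 3 / 4 + T * e * (z - a) + (z - a) ^ 2 * w z).
  assert (Hq0 : hol a q0).
  { analytic. }
  assert (Eq0 : near' a (fun z => (z - a) ^ 2 * q tau l T z = q0 z)).
  { revert Ew. apply near'_imp. intros z N Ew. rewrite Ew. unfold q0. apply Csub_neq in N. field. auto. }
  assert (Q0 : q0 a = 3 / 4). { unfold q0. ring. }
  destruct (mero_cases F a (proj1 HE a)) as [[v [Hv E]]|[j [v [Hv [V0 E]]]]].
  - exists 0, v. split; auto. split.
    + revert E. apply near'_imp. intros z N E. rewrite E. apply Csub_neq in N. field. auto.
    + assert (E' : near' a (fun z => (z - a) ^ 0 * F z = v z)).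
      { revert E. apply near'_imp. intros z _ <-. simpl. ring. }
      pose proof (ode_indicial _ F q0 v a 0 HS Hv E' Hq0 Eq0) as I. rewrite Q0 in I. simpl INR in I.
      replace (v a) with ((- ((1 + 1)%R * 1 * 0) + 4 * 0 * (3 / 4) + 4 * (3 / 4)) * v a / 3) by (field; apply RtoC_nz; lra).
      rewrite I. field; apply RtoC_nz; lra.
  - pose proof (ode_indicial _ F q0 v a (S j) HS Hv E Hq0 Eq0) as I. rewrite Q0 in I.
    assert (J : j = 0%nat).
    { destruct j as [|j]; auto. exfalso. revert I. apply Cmult_neq_0; auto.
      replace (_ + _) with (RtoC (- ((INR j + 3) * (INR j + 5) * (INR j + 1)))).
      - apply RtoC_nz. pose proof (pos_INR j).
        assert (0 < (INR j + 3) * (INR j + 5) * (INR j + 1))%R by (repeat apply Rmult_lt_0_compat; lra). lra.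
      - rewrite !S_INR. repeat rewrite ?RtoC_opp, ?RtoC_mult, ?RtoC_plus. field; apply RtoC_nz; lra. }
    subst j. clear I.
    destruct (hol_div _ _ Hv) as [u [Hu Eu]]. exists (v a), u. set (r := v a) in *.
    assert (EF : near' a (fun z => F z = r * (1 / (z - a)) + u z)).
    { apply (near'_imp2 E (near_near' Eu)). intros z N e1 e2.
      apply Csub_neq in N. replace (F z) with ((z - a) ^ 1 * F z / (z - a)) by (simpl; field; auto).
      rewrite e1, e2. field. auto. }
    split; auto. split.
    { revert EF. apply near'_imp. intros z _ ->. unfold Cdiv. ring. }
    destruct (hol_C_derive _ _ Hu) as [Hu1 D1]. set (u1 := C_derive u) in *.
    destruct (hol_C_derive _ _ Hu1) as [Hu2 D2]. set (u2 := C_derive u1) in *.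
    destruct (hol_C_derive _ _ Hu2) as [Hu3 D3]. set (u3 := C_derive u2) in *.
    destruct (hol_C_derive _ _ Hw) as [Hw1 Dw]. set (w1 := C_derive w) in *.
    assert (DF : near' a (fun z => C_derive F z = (- r * (1 / (z - a) ^ 2) + u1 z) /\
       C_derive (C_derive F) z = (2 * r * (1 / (z - a)) ^ 3 + u2 z) /\
       C_derive (C_derive (C_derive F)) z = (- 6 * r * (1 / (z - a)) ^ 4 + u3 z))).
    { apply (derivs3 F _ (fun z => - r * (1 / (z - a) ^ 2) + u1 z) (fun z => 2 * r * (1 / (z - a)) ^ 3 + u2 z)
         (fun z => - 6 * r * (1 / (z - a)) ^ 4 + u3 z) a EF).
      - generalize (near_near' D1). apply near'_imp. intros z N d.
        derive. ring.
      - generalize (near_near' D2). apply near'_imp. intros z N d.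
        derive. apply Csub_neq in N. field. auto.
      - generalize (near_near' D3). apply near'_imp. intros z N d.
        derive. apply Csub_neq in N. field. auto. }
    assert (Dq : near' a (fun z => C_derive (q tau l T) z = 3 / 4 * (- (2 / (z - a) ^ 3)) + T * e * (- (1 / (z - a) ^ 2)) + w1 z)).
    { apply (near'_C_derive a _ (fun z => 3 / 4 * (1 / (z - a) ^ 2) + T * e * (1 / (z - a)) + w z)).
      { revert Ew. apply near'_imp. intros z _ ->. unfold Cdiv. ring. }
      generalize (near_near' Dw). apply near'_imp. intros z N d.
      derive. unfold Cdiv. ring. }
    (* (z - a)^3 times the equation is 6 T e r + 3 u + (z - a) * rest *)
    set (rest := fun z => (z - a) ^ 2 * u3 z - 3 * u1 z - 4 * T * e * (z - a) * u1 z - 4 * (z - a) ^ 2 * (w z * u1 z)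
         + 4 * r * w z + 2 * T * e * u z - 2 * r * (z - a) * w1 z - 2 * (z - a) ^ 2 * (w1 z * u z)).
    assert (Hrest : hol a rest).
    { analytic. }
    assert (X : 6 * T * e * r + 3 * u a + (a - a) * rest a = 0).
    { apply (hol_zero a (fun z => 6 * T * e * r + 3 * u z + (z - a) * rest z)).
      - analytic.
      - generalize (near'_and (near'_and (HS a) EF) (near'_and (near'_and DF Dq) Ew)).
        apply near'_imp. intros z N [[s ef] [[[d1 [_ d3]] dq] ew]].
        rewrite d3, d1, dq, ew, ef in s. apply Csub_neq in N.
        transitivity ((z - a) ^ 3 * (- (6) * r * (1 / (z - a)) ^ 4 + u3 z -
           4 * (3 / 4 * (1 / (z - a) ^ 2) + T * e / (z - a) + w z) * (- r * (1 / (z - a) ^ 2) + u1 z) -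
           2 * (3 / 4 * - (2 / (z - a) ^ 3) + T * e * - (1 / (z - a) ^ 2) + w1 z) * (r * (1 / (z - a)) + u z))).
        + unfold rest. field. auto.
        + match goal with |- _ * ?A = _ => replace A with (RtoC 0) end. ring. rewrite <- s. ring. }
    replace (u a) with ((6 * T * e * r + 3 * u a + (a - a) * rest a) / 3 - 2 * T * e * r) by (field; apply RtoC_nz; lra).
    rewrite X. field; apply RtoC_nz; lra.
Qed.
End Local.

(** * Elliptic functions of order one *)

Lemma removable_plus (a : C) (f g : C -> C) : removable a f -> removable a g -> removable a (fun z => f z + g z).
Proof.
  intros [u [Hu E]] [v [Hv F]]. exists (fun z => u z + v z). split. analytic.
  apply (near'_imp2 E F). intros z _ -> ->. reflexivity.
Qed.
Lemma removable_mult (a : C) (f g : C -> C) : removable a f -> removable a g -> removable a (fun z => f z * g z).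
Proof.
  intros [u [Hu E]] [v [Hv F]]. exists (fun z => u z * v z). split. analytic.
  apply (near'_imp2 E F). intros z _ -> ->. reflexivity.
Qed.
Lemma removable_ext (a : C) (f g : C -> C) : near' a (fun z => f z = g z) -> removable a f -> removable a g.
Proof.
  intros E [u [Hu F]]. exists u. split; auto. apply (near'_imp2 E F). intros z _ <- h. exact h.
Qed.
Lemma removable_translate (a w : C) (f : C -> C) : removable (a + w) f -> removable a (fun z => f (z + w)).
Proof.
  intros [u [Hu E]]. exists (fun z => u (z + w)). split.
  apply hol_translate; auto. apply near'_translate in E; auto.
Qed.
Lemma removable_reflect (a b : C) (f : C -> C) : removable (b - a) f -> removable a (fun z => f (b - z)).
Proof.
  intros [u [Hu E]]. exists (fun z => u (b - z)). split.
  apply hol_reflect; auto. apply near'_reflect in E; auto.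
Qed.
Lemma removable_period (a w : C) (f : C -> C) :
  mer_eq (fun z => f (z + - w)) f -> removable a f -> removable (a + w) f.
Proof.
  intros P H. apply (removable_ext _ _ _ (P (a + w))).
  apply removable_translate. replace (a + w + - w) with a by ring. exact H.
Qed.

Section Order1.
Context (tau : C) (Ht : (0 < Im tau)%R).

(** After subtraction of a constant the function [h] is odd, so it vanishes at the half
    periods off the lattice.  Then [h z * h (z + 1/2)] has no poles, hence is a constant, and its
    value at [tau / 2] is 0.  Since [h] does not vanish near 0, it vanishes near 1/2, hence
    identically. *)
Lemma no_single_pole (H : C -> C) (s : C) (u : C -> C) : elliptic tau H ->
  (forall a, off_lattice tau a -> removable a H) -> hol 0 u -> near' (RtoC 0) (fun z => H z = s / z + u z) -> s = 0.
Proof.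
  intros HE HR Hu E0. destruct (Ceq_dec s 0) as [|Hs]; auto. exfalso.
  pose proof HE as [HM HP].
  set (S := fun z => H z + H (0 - z)).
  assert (SP : forall w, in_lattice tau w -> mer_eq (fun z => S (z + w)) S).
  { intros w Hw a. pose proof (near'_reflect a 0 _ (HP (- w) (in_lattice_opp _ _ Hw) (0 - a))) as A.
    apply (near'_imp2 (HP w Hw a) A). intros z _ e1 e2. unfold S.
    replace (0 - (z + w)) with (0 - z + - w) by ring. rewrite e1, e2. reflexivity. }
  assert (S0 : removable 0 S).
  { exists (fun z => u z + u (0 - z)). split.
    - analytic. apply hol_reflect. replace (0 - 0) with (RtoC 0) by ring. exact Hu.
    - pose proof E0 as E1. replace (RtoC 0) with (0 - 0) in E1 at 1 by ring. apply near'_reflect in E1.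
      apply (near'_imp2 E0 E1). intros z N e0 e1. unfold S. rewrite e0, e1.
      replace (0 - z) with (- z) by ring. field. auto. }
  (* subtracting a constant makes H odd *)
  destruct (liouville tau S Ht) as [c Odd].
  { intros a. destruct (classic (in_lattice tau a)) as [La|Na].
    - replace a with (0 + a) by ring. apply removable_period; auto. apply SP, in_lattice_opp; auto.
    - apply removable_plus; auto. apply removable_reflect, HR.
      replace (0 - a) with (- a) by ring. apply off_lattice_opp; auto. }
  { apply SP, in_lattice_1. } { apply SP, in_lattice_tau. }
  set (h := fun z => 1 * H z + - (c / 2)).
  assert (hE : elliptic tau h) by (apply (elliptic_comb tau H (fun _ => - (c / 2)) 1); auto; apply elliptic_const).
  pose proof hE as [hM hP].
  assert (hodd : forall a : C, near' a (fun z => h (0 - z) = - h z)).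
  { intros a. generalize (Odd a). apply near'_imp. intros z _ e. unfold h, S in *.
    replace (H (0 - z)) with (H z + H (0 - z) - H z) by ring. rewrite e. field; apply C2_nz. }
  assert (hR : forall a, off_lattice tau a -> removable a h).
  { intros a Na. destruct (HR a Na) as [v [Hv Ev]]. exists (fun z => 1 * v z + - (c / 2)). split; [analytic|].
    revert Ev. apply near'_imp. intros z _ e. unfold h. rewrite e. reflexivity. }
  set (u0 := fun z => u z - c / 2).
  assert (Hu0 : hol 0 u0) by analytic.
  assert (h0 : near' (RtoC 0) (fun z => h z = s / z + u0 z)).
  { revert E0. apply near'_imp. intros z _ e. unfold h, u0. rewrite e. ring. }
  assert (hpole : forall a, in_lattice tau a -> near' (RtoC 0) (fun x => h (x + a) = s / x + u0 x)).
  { intros a La. apply (near'_imp2 (hP a La 0) h0). intros x _ e1 e2. rewrite e1. exact e2. }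
  (* h is odd about every half period b, so it vanishes there unless b is a pole *)
  assert (hzero : forall b, off_lattice tau b -> in_lattice tau (2 * b) ->
    exists g, hol b g /\ near' b (fun z => h z = (z - b) * g z)).
  { intros b Nb Lb. destruct (hR b Nb) as [g [Hg Eg]].
    assert (E2b : 2 * b - b = b) by ring.
    assert (G0 : g b = - g (2 * b - b)).
    { apply (hol_eq b g (fun z => - g (2 * b - z))); auto.
      - analytic. apply hol_reflect. rewrite E2b. exact Hg.
      - pose proof Eg as Eg'. rewrite <- E2b in Eg' at 1. apply near'_reflect in Eg'.
        pose proof (near'_reflect b 0 _ (hP (2 * b) Lb (0 - b))) as A.
        apply (near'_imp3 (near'_and Eg Eg') A (hodd b)).
        intros z _ [e1 e2] e3 e4. rewrite <- e1, <- e2.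
        replace (2 * b - z) with (0 - z + 2 * b) by ring. rewrite e3, e4. ring. }
    rewrite E2b in G0.
    assert (G1 : g b = 0).
    { replace (g b) with ((g b - - g b) / 2) by (field; apply C2_nz). rewrite G0 at 1. field; apply C2_nz. }
    destruct (hol_div _ _ Hg) as [g1 [Hg1 Eg1]]. exists g1. split; auto.
    apply (near'_imp2 Eg (near_near' Eg1)). intros z _ -> ->. rewrite G1. ring. }
  assert (half_notl : off_lattice tau (1 / 2)) by (apply off_lattice_half; auto).
  assert (L1 : in_lattice tau (2 * (1 / 2))).
  { replace (2 * (1 / 2)) with (RtoC 1) by (field; apply C2_nz). apply in_lattice_1. }
  (* in the product h(z) h(z + 1/2) the poles of one factor meet zeros of the other *)
  assert (ZP : forall a b : C, in_lattice tau a -> off_lattice tau b -> in_lattice tau (2 * b) ->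
     exists v, hol 0 v /\ near' (RtoC 0) (fun x => h (x + a) * h (x + b) = v x)).
  { intros a b La Nb Lb. destruct (hzero b Nb Lb) as [g [Hg e2]].
    replace b with (0 + b) in Hg, e2 at 1 by ring.
    exists (fun x => (s + x * u0 x) * g (x + b)). split.
    - analytic. apply hol_translate. exact Hg.
    - apply near'_translate in e2.
      apply (near'_imp2 (hpole a La) e2). intros x N f1 f2. rewrite f1, f2.
      replace (x + b - b) with x by ring. field. auto. }
  assert (back : forall (a : C) (f : C -> C), removable 0 (fun x => f (x + a)) -> removable a f).
  { intros a f R. apply removable_ext with (f := fun z => f (z + - a + a)). { apply near'_all. intros z _. f_equal. ring. }
    apply (removable_translate a (- a) (fun x => f (x + a))). replace (a + - a) with (RtoC 0) by ring. exact R. }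
  assert (Pper : forall w, in_lattice tau w ->
    mer_eq (fun z => h (z + w) * h (z + w + 1 / 2)) (fun z => h z * h (z + 1 / 2))).
  { intros w weight a. apply (near'_imp2 (hP w weight a) (near'_translate a (1 / 2) _ (hP w weight (a + 1 / 2)))).
    intros z _ e1 e2. replace (z + w + 1 / 2) with (z + 1 / 2 + w) by ring. rewrite e1, e2. reflexivity. }
  assert (Pc : exists K, mer_eq (fun z => h z * h (z + 1 / 2)) (fun _ => K)).
  { apply (liouville tau _ Ht).
    - intros a. destruct (classic (in_lattice tau a)) as [La|Na].
      + apply back. destruct (ZP a (a + 1 / 2) La) as [v [Hv Ev]].
        * intros K. apply half_notl. replace (1 / 2) with (a + 1 / 2 + - a) by ring. apply in_lattice_plus; auto. apply in_lattice_opp; auto.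
        * replace (2 * (a + 1 / 2)) with (a + a + 2 * (1 / 2)) by ring. apply in_lattice_plus; auto. apply in_lattice_plus; auto.
        * exists v. split; auto. revert Ev. apply near'_imp. intros x _ <-. f_equal. f_equal. ring.
      + destruct (classic (in_lattice tau (a + 1 / 2))) as [La'|Na'].
        * apply back. destruct (ZP (a + 1 / 2) a La' Na) as [v [Hv Ev]].
          { replace (2 * a) with ((a + 1 / 2) + (a + 1 / 2) + - (2 * (1 / 2))) by ring.
            apply in_lattice_plus. apply in_lattice_plus; auto. apply in_lattice_opp; auto. }
          exists v. split; auto. revert Ev. apply near'_imp. intros x _ <-.
          replace (x + (a + 1 / 2)) with (x + a + 1 / 2) by ring. ring.
        * apply removable_mult; auto. apply (removable_translate a (1 / 2) h). auto.
    - apply Pper, in_lattice_1.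
    - apply Pper, in_lattice_tau. }
  destruct Pc as [K Pc].
  (* the constant vanishes, since h vanishes at tau / 2 *)
  assert (Nt2 : off_lattice tau (tau / 2)).
  { replace (tau / 2) with (half_period tau 2 - half_period tau 0). apply half_period_diff; auto; lia. unfold half_period; simpl. field; apply C2_nz. }
  assert (Nt3 : off_lattice tau (tau / 2 + 1 / 2)).
  { replace (tau / 2 + 1 / 2) with (half_period tau 3 - half_period tau 0). apply half_period_diff; auto; lia. unfold half_period; simpl. field; apply C2_nz. }
  assert (K0 : K = 0).
  { destruct (hzero (tau / 2) Nt2) as [g [Hg Eg]].
    { replace (2 * (tau / 2)) with tau by (field; apply C2_nz). apply in_lattice_tau. }
    destruct (hR _ Nt3) as [g2 [Hg2 Eg2]]. apply near'_translate in Eg2.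
    assert (X : K = (tau / 2 - tau / 2) * g (tau / 2) * g2 (tau / 2 + 1 / 2)).
    { apply (hol_eq (tau / 2) (fun _ => K) (fun z => (z - tau / 2) * g z * g2 (z + 1 / 2))).
      - analytic.
      - analytic. apply hol_translate. exact Hg2.
      - apply (near'_imp3 (Pc (tau / 2)) Eg Eg2). intros z _ p e1 e2.
        rewrite <- p, e1, e2. reflexivity. }
    rewrite X. ring. }
  (* near 0 the first factor does not vanish, so h vanishes near 1/2 *)
  assert (Z : near' (1 / 2) (fun z => h z = 0)).
  { assert (A : near' (RtoC 0) (fun x => h (x + 1 / 2) = 0)).
    { assert (Hv : hol 0 (fun x => s + x * u0 x)) by analytic.
      assert (V : near (RtoC 0) (fun x => s + x * u0 x <> 0)).
      { apply (hol_near_neq0 0 _ Hv). replace (s + 0 * u0 0) with s by ring. exact Hs. }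
      apply (near'_imp3 (Pc 0) h0 (near_near' V)). intros x N p e v. rewrite K0, e in p.
      destruct (Ceq_dec (h (x + 1 / 2)) 0) as [|Nh]; auto. exfalso.
      assert (Y : (s + x * u0 x) * h (x + 1 / 2) <> 0) by (apply Cmult_neq_0; auto).
      apply Y. transitivity (x * ((s / x + u0 x) * h (x + 1 / 2))). field; auto. rewrite p. ring. }
    assert (E12 : 1 / 2 + - (1 / 2) = 0) by ring. rewrite <- E12 in A at 1. apply near'_translate in A. revert A. apply near'_imp.
    intros z _ e. replace z with (z + - (1 / 2) + 1 / 2) by ring. exact e. }
  pose proof (identity_thm h (1 / 2) hM Z 0) as Z0.
  apply Hs. assert (X : s + 0 * u0 0 = 0).
  { apply (hol_zero 0 (fun x => s + x * u0 x)).
    - analytic.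
    - apply (near'_imp2 Z0 h0). intros x N e1 e2. rewrite e1 in e2.
      transitivity (x * (s / x + u0 x)). field; auto. rewrite <- e2. ring. }
  rewrite <- X. ring.
Qed.

End Order1.

Section Global.
Context (tau : C) (Ht : (0 < Im tau)%R).

(** * The space of elliptic solutions *)

Definition G_comb (c : nat -> C) (z : C) : C := c 1%nat * G tau 1 z + (c 2%nat * G tau 2 z + (c 3%nat * G tau 3 z + 0)).
Definition G_residue (c : nat -> C) (k : nat) : C := c 1%nat * eps 1 k + c 2%nat * eps 2 k + c 3%nat * eps 3 k.

Lemma G_comb_elliptic c : elliptic tau (G_comb c).
Proof.
  unfold G_comb. apply (elliptic_comb tau (G tau 1) (fun z => c 2%nat * G tau 2 z + (c 3%nat * G tau 3 z + 0))).
  apply G_elliptic; auto; lia.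
  apply (elliptic_comb tau (G tau 2) (fun z => c 3%nat * G tau 3 z + 0)). apply G_elliptic; auto; lia.
  apply (elliptic_comb tau (G tau 3) (fun z => 0)). apply G_elliptic; auto; lia. apply elliptic_const.
Qed.

Lemma G_comb_regular c a : regular_pt tau a -> hol a (G_comb c).
Proof.
  intros Hg. unfold G_comb.
  analytic; apply G_regular; auto.
Qed.

Lemma G_comb_half c (a : C) k : (k <= 3)%nat -> in_lattice tau (a - half_period tau k) ->
  exists u, hol a u /\ near' a (fun z => G_comb c z = G_residue c k / (z - a) + (z - a) * u z).
Proof.
  intros Hk Hh.
  destruct (G_half tau Ht 1 a k ltac:(lia) Hk Hh) as [u1 [H1 E1]].
  destruct (G_half tau Ht 2 a k ltac:(lia) Hk Hh) as [u2 [H2 E2]].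
  destruct (G_half tau Ht 3 a k ltac:(lia) Hk Hh) as [u3 [H3 E3]].
  exists (fun z => c 1%nat * u1 z + (c 2%nat * u2 z + c 3%nat * u3 z)). split.
  - analytic.
  - apply (near'_imp3 E1 E2 E3). intros z _ e1 e2 e3.
    unfold G_comb, G_residue. rewrite e1, e2, e3. unfold Cdiv. ring.
Qed.

Lemma half_period_self k : in_lattice tau (half_period tau k - half_period tau k).
Proof. replace (half_period tau k - half_period tau k) with (RtoC 0) by ring. apply in_lattice_0. Qed.

(** Multiply by [z - half_period k] and let [z] tend to the half period. *)
Lemma residues_zero c (T0 : C) : mer_eq (fun z => T0 + G_comb c z) (fun _ => 0) -> forall k, (k <= 3)%nat -> G_residue c k = 0.
Proof.
  intros H k Hk. destruct (G_comb_half c (half_period tau k) k Hk (half_period_self k)) as [u [Hu E]].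
  set (a := half_period tau k) in *.
  assert (X : G_residue c k + (a - a) * (T0 + (a - a) * u a) = 0).
  { apply (hol_zero a (fun z => G_residue c k + (z - a) * (T0 + (z - a) * u z))).
    - analytic.
    - apply (near'_imp2 (H a) E). intros z N e1 e2. rewrite e2 in e1.
      apply Csub_neq in N. transitivity ((z - a) * (T0 + (G_residue c k / (z - a) + (z - a) * u z))). field; auto.
      rewrite e1. ring. }
  rewrite <- X. ring.
Qed.

(** The coefficients [c] are solved from the residues at the three nonzero half periods.
    The residue left at 0 vanishes by [no_single_pole], and the constant is compared with the
    constant terms of [solution_half]. *)
Lemma solution_form l (T : C) (F : C -> C) : (1 <= l <= 3)%nat -> ES tau l T F ->
  exists c b, mer_eq F (fun z => G_comb c z + b) /\ forall k, (1 <= k <= 3)%nat -> b = - 2 * T * eps l k * G_residue c k.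
Proof.
  intros Hl [HE HS].
  destruct (solution_half tau Ht l Hl T F HE HS (half_period tau 0) 0 ltac:(lia) (half_period_self 0)) as [r0 [u0 [H0 [E0 V0]]]].
  destruct (solution_half tau Ht l Hl T F HE HS (half_period tau 1) 1 ltac:(lia) (half_period_self 1)) as [r1 [u1 [H1 [E1 V1]]]].
  destruct (solution_half tau Ht l Hl T F HE HS (half_period tau 2) 2 ltac:(lia) (half_period_self 2)) as [r2 [u2 [H2 [E2 V2]]]].
  destruct (solution_half tau Ht l Hl T F HE HS (half_period tau 3) 3 ltac:(lia) (half_period_self 3)) as [r3 [u3 [H3 [E3 V3]]]].
  (* the solution of sum_m c_m eps^(m)_k = r_k for k = 1, 2, 3 *)
  set (c := fun m => match m with 1%nat => - ((r2 + r3) / 2) | 2%nat => - ((r1 + r3) / 2) | _ => - ((r1 + r2) / 2) end).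
  pose proof C2_nz as n2.
  assert (R1 : G_residue c 1 = r1). { unfold G_residue, c, eps; simpl. field; auto. }
  assert (R2 : G_residue c 2 = r2). { unfold G_residue, c, eps; simpl. field; auto. }
  assert (R3 : G_residue c 3 = r3). { unfold G_residue, c, eps; simpl. field; auto. }
  set (H := fun z => - (1) * G_comb c z + F z).
  assert (EH : elliptic tau H) by (apply elliptic_comb; auto; apply G_comb_elliptic).
  assert (Loc : forall k r u, (k <= 3)%nat -> hol (half_period tau k) u -> near' (half_period tau k) (fun z => F z = r / (z - half_period tau k) + u z) ->
     exists v, hol (half_period tau k) v /\ near' (half_period tau k) (fun z => H z = (r - G_residue c k) / (z - half_period tau k) + v z) /\ v (half_period tau k) = u (half_period tau k)).
  { intros k r u Hk Hu E. destruct (G_comb_half c (half_period tau k) k Hk (half_period_self k)) as [w [Hw Ew]].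
    set (a := half_period tau k) in *. exists (fun z => u z - (z - a) * w z). split; [|split].
    - analytic.
    - apply (near'_imp2 E Ew). intros z _ e1 e2. unfold H. rewrite e1, e2. unfold Cdiv. ring.
    - ring. }
  destruct (Loc 0%nat _ _ ltac:(lia) H0 E0) as [v0 [K0 [L0 W0]]].
  assert (Reg : forall k r u, (k <= 3)%nat -> hol (half_period tau k) u -> near' (half_period tau k) (fun z => F z = r / (z - half_period tau k) + u z) ->
     G_residue c k = r -> exists v, hol (half_period tau k) v /\ near' (half_period tau k) (fun z => H z = v z) /\ v (half_period tau k) = u (half_period tau k)).
  { intros k r u Hk Hu E Rk. destruct (Loc k r u Hk Hu E) as [v [Kv [Lv Wv]]]. exists v. split; auto. split; auto.
    revert Lv. apply near'_imp. intros z N ->. rewrite Rk. apply Csub_neq in N. field; auto. }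
  destruct (Reg 1%nat _ _ ltac:(lia) H1 E1 R1) as [v1 [K1 [L1 W1]]].
  destruct (Reg 2%nat _ _ ltac:(lia) H2 E2 R2) as [v2 [K2 [L2 W2]]].
  destruct (Reg 3%nat _ _ ltac:(lia) H3 E3 R3) as [v3 [K3 [L3 W3]]].
  assert (Rgood : forall a, regular_pt tau a -> removable a H).
  { intros a Hg. unfold H. apply (removable_plus a (fun z => - (1) * G_comb c z) F).
    - apply hol_removable. apply hol_scal, G_comb_regular; auto.
    - apply (solution_regular tau Ht l T F HE HS); auto. }
  assert (Rhalf : forall a k, in_lattice tau (a - half_period tau k) -> removable (half_period tau k) H -> removable a H).
  { intros a k La R. replace a with (half_period tau k + (a - half_period tau k)) by ring. apply removable_period; auto.
    apply EH, in_lattice_opp; auto. }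
  assert (Hw0 : half_period tau 0 = 0). { unfold half_period; simpl. field; auto. }
  assert (S0 : r0 - G_residue c 0 = 0).
  { rewrite Hw0 in K0, L0. apply (no_single_pole tau Ht H (r0 - G_residue c 0) v0); auto.
    - intros a Na. destruct (half_cases tau a) as [Hg | [k [Hk Hh]]]; auto.
      apply (Rhalf a k Hh). destruct k as [|[|[|[|k]]]].
      + exfalso. apply Na. replace a with (a - half_period tau 0); auto. rewrite Hw0. ring.
      + exists v1; auto.
      + exists v2; auto.
      + exists v3; auto.
      + lia.
    - revert L0. apply near'_imp. intros z _ ->. replace (z - 0) with z by ring. reflexivity. }
  destruct (liouville tau H Ht) as [b Hb].
  - intros a. destruct (half_cases tau a) as [Hg | [k [Hk Hh]]]; auto.
    apply (Rhalf a k Hh). destruct k as [|[|[|[|k]]]].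
    + exists v0. split; auto. revert L0. apply near'_imp. intros z N ->. rewrite S0. apply Csub_neq in N. field; auto.
    + exists v1; auto.
    + exists v2; auto.
    + exists v3; auto.
    + lia.
  - apply EH, in_lattice_1.
  - apply EH, in_lattice_tau.
  - exists c, b. split.
    + intros a. generalize (Hb a). apply near'_imp. intros z _ <-. unfold H. ring.
    + assert (V : forall k v, hol (half_period tau k) v -> near' (half_period tau k) (fun z => H z = v z) -> b = v (half_period tau k)).
      { intros k v Kv Lv. apply (hol_eq (half_period tau k) (fun _ => b) v); auto. analytic.
        apply (near'_imp2 (Hb (half_period tau k)) Lv). intros z _ <- h. exact h. }
      intros k Hk. destruct (l_cases k Hk) as [-> | [-> | ->]].
      * rewrite R1, <- V1, <- W1. apply V; auto.
      * rewrite R2, <- V2, <- W2. apply V; auto.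
      * rewrite R3, <- V3, <- W3. apply V; auto.
Qed.

Lemma ES_Fl l (T : C) : (1 <= l <= 3)%nat -> ES tau l T (Fl tau l T).
Proof. intros Hl. split. apply Fl_elliptic; auto. apply Fl_solution; auto. Qed.

(** At [T = 0] the potential is the same for every [l]. *)
Lemma ES_Fl0 l m : (1 <= m <= 3)%nat -> ES tau l 0 (Fl tau m 0).
Proof.
  intros Hm. split. apply Fl_elliptic; auto.
  replace (q tau l 0) with (q tau m 0). apply Fl_solution; auto.
  apply functional_extensionality. intros z. rewrite !q_G. ring.
Qed.

Lemma length1 (c : list C) : length c = 1%nat -> exists x, c = [x].
Proof. destruct c as [|x [|]]; simpl; try lia. intros _. exists x. reflexivity. Qed.
Lemma length3 (c : list C) : length c = 3%nat -> exists x y z, c = [x; y; z].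
Proof. destruct c as [|x [|y [|z [|]]]]; simpl; try lia. intros _. exists x, y, z. reflexivity. Qed.

Definition vec3 (x y z : C) (k : nat) : C := match k with 1%nat => x | 2%nat => y | _ => z end.

(** The sign vectors of [eps 1], [eps 2], [eps 3] are orthogonal. *)
Lemma residues_invert x y z : (forall k, (k <= 3)%nat -> G_residue (vec3 x y z) k = 0) -> x = 0 /\ y = 0 /\ z = 0.
Proof.
  intros H. pose proof (H 0%nat ltac:(lia)) as h0. pose proof (H 1%nat ltac:(lia)) as h1.
  pose proof (H 2%nat ltac:(lia)) as h2. pose proof (H 3%nat ltac:(lia)) as h3.
  unfold G_residue, vec3, eps in h0, h1, h2, h3. simpl in h0, h1, h2, h3. pose proof C2_nz.
  repeat split.
  - replace x with ((x * 1 + y * 1 + z * 1 + (x * 1 + y * - (1) + z * - (1))) / 2) by (field; auto). rewrite h0, h1. field; auto.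
  - replace y with ((x * 1 + y * 1 + z * 1 + (x * - (1) + y * 1 + z * - (1))) / 2) by (field; auto). rewrite h0, h2. field; auto.
  - replace z with ((x * 1 + y * 1 + z * 1 + (x * - (1) + y * - (1) + z * 1)) / 2) by (field; auto). rewrite h0, h3. field; auto.
Qed.

Lemma spanned1 l (T : C) : (1 <= l <= 3)%nat -> T <> 0 -> spanned_by (ES tau l T) [Fl tau l T].
Proof.
  intros Hl HT F. split.
  - intros HF. destruct (solution_form l T F Hl HF) as [c [b [E Hb]]].
    exists [b / (2 * T)]. split; auto. intros a. generalize (E a). apply near'_imp. intros z _ ->.
    pose proof C2_nz as n2.
    assert (Rk : forall k, (1 <= k <= 3)%nat -> G_residue c k = - (b / (2 * T)) * eps l k).
    { intros k Hk. rewrite (Hb k Hk).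
      transitivity ((eps l k * eps l k) * G_residue c k). rewrite eps_sq; ring. field; auto. }
    assert (c1 : c 1%nat = - ((G_residue c 2 + G_residue c 3) / 2)). { unfold G_residue, eps; simpl. field; auto. }
    assert (c2 : c 2%nat = - ((G_residue c 1 + G_residue c 3) / 2)). { unfold G_residue, eps; simpl. field; auto. }
    assert (c3 : c 3%nat = - ((G_residue c 1 + G_residue c 2) / 2)). { unfold G_residue, eps; simpl. field; auto. }
    rewrite !Rk in c1, c2, c3 by lia.
    unfold G_comb. simpl lincomb. rewrite Fl_G, c1, c2, c3.
    destruct (l_cases l Hl) as [-> | [-> | ->]]; unfold eps; simpl; field; auto.
  - intros [c [Hc E]]. destruct (length1 c Hc) as [x ->].
    apply ES_ext with (F := lincomb [x] [Fl tau l T]).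
    { intros a. generalize (E a). apply near'_imp. intros; congruence. }
    apply (ES_comb tau l T (Fl tau l T) (fun _ => 0)). apply ES_Fl; auto. apply ES_zero.
Qed.

Lemma indep1 l (T : C) : (1 <= l <= 3)%nat -> lin_indep [Fl tau l T].
Proof.
  intros Hl c Hc E. destruct (length1 c Hc) as [x ->]. constructor; auto.
  assert (R : G_residue (fun m => if Nat.eqb m l then - x else 0) 0 = 0).
  { apply (residues_zero _ (x * (2 * T))); [|lia]. intros a. generalize (E a). apply near'_imp. intros z _ e.
    transitivity (lincomb [x] [Fl tau l T] z); [|exact e]. simpl lincomb. rewrite Fl_G. unfold G_comb.
    destruct (l_cases l Hl) as [-> | [-> | ->]]; cbn [Nat.eqb]; ring. }
  replace x with (- (- x)) by ring.
  replace (- x) with (G_residue (fun m => if Nat.eqb m l then - x else 0) 0). rewrite R; ring.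
  unfold G_residue. destruct (l_cases l Hl) as [-> | [-> | ->]]; unfold eps; simpl; ring.
Qed.

Lemma spanned3 l : (1 <= l <= 3)%nat -> spanned_by (ES tau l 0) [Fl tau 1 0; Fl tau 2 0; Fl tau 3 0].
Proof.
  intros Hl F. split.
  - intros HF. destruct (solution_form l 0 F Hl HF) as [c [b [E Hb]]].
    exists [- c 1%nat; - c 2%nat; - c 3%nat]. split; auto. intros a. generalize (E a). apply near'_imp. intros z _ ->.
    rewrite (Hb 1%nat) by lia. unfold G_comb. simpl lincomb. rewrite !Fl_G. ring.
  - intros [c [Hc E]]. destruct (length3 c Hc) as [x [y [w ->]]].
    apply ES_ext with (F := lincomb [x; y; w] [Fl tau 1 0; Fl tau 2 0; Fl tau 3 0]).
    { intros a. generalize (E a). apply near'_imp. intros; congruence. }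
    apply (ES_comb tau l 0 (Fl tau 1 0) (fun z => y * Fl tau 2 0 z + (w * Fl tau 3 0 z + 0))). apply ES_Fl0; lia.
    apply (ES_comb tau l 0 (Fl tau 2 0) (fun z => w * Fl tau 3 0 z + 0)). apply ES_Fl0; lia.
    apply (ES_comb tau l 0 (Fl tau 3 0) (fun z => 0)). apply ES_Fl0; lia. apply ES_zero.
Qed.

Lemma indep3 : lin_indep [Fl tau 1 0; Fl tau 2 0; Fl tau 3 0].
Proof.
  intros c Hc E. destruct (length3 c Hc) as [x [y [w ->]]].
  destruct (residues_invert (- x) (- y) (- w)) as [hx [hy hw0]].
  - apply (residues_zero (vec3 (- x) (- y) (- w)) 0). intros a. generalize (E a). apply near'_imp. intros z _ e.
    transitivity (lincomb [x; y; w] [Fl tau 1 0; Fl tau 2 0; Fl tau 3 0] z); [|exact e]. unfold G_comb, vec3. simpl lincomb. rewrite !Fl_G. ring.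
  - assert (N : forall t : C, - t = 0 -> t = 0). { intros t e. replace t with (- (- t)) by ring. rewrite e. ring. }
    auto.
Qed.

End Global.

Theorem theorem3p2 (tau : C) (l : nat) (T : C)
    (htau : (0 < Im tau)%R) (hl : (1 <= l <= 3)%nat) :
  ES tau l T (Fl tau l T)
  /\ (T <> 0 ->
        has_dim (ES tau l T) 1 /\
        spanned_by (ES tau l T) [Fl tau l T])
  /\ (T = 0 ->
        has_dim (ES tau l T) 3 /\
        spanned_by (ES tau l T) [Fl tau 1 0; Fl tau 2 0; Fl tau 3 0]).
Proof.
  split; [|split].
  - apply ES_Fl; auto.
  - intros HT. pose proof (spanned1 tau htau l T hl HT) as S. split; auto.
    exists [Fl tau l T]. split; auto. split; auto. apply indep1; auto.
  - intros ->. pose proof (spanned3 tau htau l hl) as S. split; auto.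
    exists [Fl tau 1 0; Fl tau 2 0; Fl tau 3 0]. split; auto. split; auto. apply indep3; auto.
Qed.
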